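(* Fix $\alpha>0$ and real numbers $h_2,h_3$ with $0<h_2^2+h_3^2<1$, and let $\Lambda_T=(0,h_2,h_3,0)\in\mathbb{R}^4$. There exist an open neighbourhood $\mathcal{U}$ of $\Lambda_T$ in $\mathbb{R}^4$ and, for every $\Lambda=(H_1,H_2,H_3,K_2)\in\mathcal{U}$, a profile $\hat{\mathbf m}(\cdot\,;\Lambda):\mathbb{R}\to S^2$ and a velocity $V(\Lambda)\in\mathbb{R}$ such that $\hat{\mathbf m}=\hat{\mathbf m}(\cdot\,;\Lambda)$ and $V=V(\Lambda)$ solve the travelling-wave equation $$V\hat{\mathbf m}'+\alpha V\,\hat{\mathbf m}\times\hat{\mathbf m}'+\hat{\mathbf m}\times\mathbf H(\hat{\mathbf m})=0\ \text{ on }\mathbb{R},\qquad \lim_{\xi\to\pm\infty}\hat{\mathbf m}(\xi)=\hat{\mathbf m}^\Lambda_\pm ,$$ where $\mathbf H(\hat{\mathbf m})=\hat{\mathbf m}''+(\hat{\mathbf m}\cdot\hat{\mathbf x})\hat{\mathbf x}-K_2(\hat{\mathbf m}\cdot\hat{\mathbf y})\hat{\mathbf y}+H_1\hat{\mathbf x}+H_2\hat{\mathbf y}+H_3\hat{\mathbf z}$. Moreover, $\hat{\mathbf m}$ and $V$ are continuously differentiable in $\Lambda$, i.e. the maps $\Lambda\mapsto V(\Lambda)\in\mathbb{R}$ and $\Lambda\mapsto\hat{\mathbf m}(\cdot\,;\Lambda)\in C_b(\mathbb{R};\mathbb{R}^3)$ are $C^1$ on $\mathcal{U}$; and for $\Lambda=\Lambda_T$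 one has $\hat{\mathbf m}(\cdot\,;\Lambda_T)=\hat{\mathbf m}_T$, the static profile defined in the context.
   Context: $\hat{\mathbf x},\hat{\mathbf y},\hat{\mathbf z}$ is the standard basis of $\mathbb{R}^3$, $S^2\subset\mathbb{R}^3$ is the unit sphere, primes denote $d/d\xi$, and $C_b(\mathbb{R};\mathbb{R}^3)$ is the space of bounded continuous functions with the supremum norm. For $\Lambda=(H_1,H_2,H_3,K_2)\in\mathbb{R}^4$ and $\mathbf H_a=H_1\hat{\mathbf x}+H_2\hat{\mathbf y}+H_3\hat{\mathbf z}$, the potential is $$U^\Lambda(\hat{\mathbf m})=\tfrac12\left(1-(\hat{\mathbf m}\cdot\hat{\mathbf x})^2+K_2(\hat{\mathbf m}\cdot\hat{\mathbf y})^2-2\mathbf H_a\cdot\hat{\mathbf m}\right).$$ The boundary values $\hat{\mathbf m}^\Lambda_\pm\in S^2$ are local minima of the restriction of $U^\Lambda$ to $S^2$ with $\hat{\mathbf x}\cdot\hat{\mathbf m}^\Lambda_+>0$ and $\hat{\mathbf x}\cdot\hat{\mathbf m}^\Lambda_-<0$ (these exist for $\Lambda$ near $\Lambda_T$). The travelling-wave equation is obtained by substituting $\hat{\mathbf M}(x,t)=\hat{\mathbf m}(x-Vt)$ in the Landau--Lifshitz--Gilbert equation $\hat{\mathbf M}_t+\alpha\hat{\mathbf M}\times\hat{\mathbf M}_t=\hat{\mathbf M}\times\mathbf H(\hat{\mathbf M})$. Static profile: put $h=\sqrt{h_2^2+h_3^2}\in(0,1)$ and $\hat{\mathbf e}=(h_2\hat{\mathbf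 y}+h_3\hat{\mathbf z})/h$. Let $\beta_T:\mathbb{R}\to\mathbb{R}$ be a (fixed) solution, which is unique up to translation, of $$\beta_T'=h-\sin\beta_T,\qquad \lim_{\xi\to-\infty}\beta_T(\xi)=\pi-\sin^{-1}h,\qquad \lim_{\xi\to\infty}\beta_T(\xi)=\sin^{-1}h .$$ Then $\hat{\mathbf m}_T(\xi)=\cos\beta_T(\xi)\,\hat{\mathbf x}+\sin\beta_T(\xi)\,\hat{\mathbf e}$. *)

(* Defs.v *)
From Stdlib Require Import Reals Lra FunctionalExtensionality ProofIrrelevance.
From Coquelicot Require Import Coquelicot.

Open Scope R_scope.

(** The norm that Coquelicot puts on these iterated products is the Euclidean
    one. *)
Notation R3 := (R * R * R)%type.
Notation R4 := (R * R * R * R)%type.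

(** * Bounded continuous functions on the line *)

Section BoundedContinuous.

Context {W : NormedModule R_AbsRing}.

Record Cb : Type := mkCb {
  Cb_fun :> R -> W;
  Cb_continuous : forall xi : R, continuous Cb_fun xi;
  Cb_bounded : exists M : R, forall xi : R, norm (Cb_fun xi) <= M }.

Lemma Cb_ext (f g : Cb) : (forall xi, f xi = g xi) -> f = g.
Proof.
destruct f as [f cf bf], g as [g cg bg]; simpl; intros H.
assert (E : f = g) by (apply functional_extensionality; exact H).
subst g; f_equal; apply proof_irrelevance.
Qed.

Definition Cb_zero : Cb.
Proof.
refine (mkCb (fun _ => zero) _ _).
- intros xi; apply continuous_const.
- exists 0; intros _; rewrite norm_zero; lra.
Defined.

Definition Cb_plus (f g : Cb) : Cb.
Proof.
refine (mkCb (fun xi => plus (f xi) (g xi)) _ _).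
- intros xi; apply (continuous_plus f g); apply Cb_continuous.
- destruct (Cb_bounded f) as [M HM], (Cb_bounded g) as [N HN].
  exists (M + N); intros xi.
  eapply Rle_trans; [apply norm_triangle | apply Rplus_le_compat; auto].
Defined.

Definition Cb_opp (f : Cb) : Cb.
Proof.
refine (mkCb (fun xi => opp (f xi)) _ _).
- intros xi; apply (continuous_opp f); apply Cb_continuous.
- destruct (Cb_bounded f) as [M HM].
  exists M; intros xi; rewrite norm_opp; auto.
Defined.

Definition Cb_scal (a : R) (f : Cb) : Cb.
Proof.
refine (mkCb (fun xi => scal a (f xi)) _ _).
- intros xi; apply (continuous_scal_r a f); apply Cb_continuous.
- destruct (Cb_bounded f) as [M HM].
  exists (Rabs a * M); intros xi.
  eapply Rle_trans; [apply (norm_scal a (f xi)) |].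
  apply Rmult_le_compat_l; [apply Rabs_pos | auto].
Defined.

Definition Cb_norm (f : Cb) : R :=
  real (Lub_Rbar (fun r => exists xi : R, r = norm (f xi))).

Lemma Cb_norm_lub (f : Cb) :
  is_lub_Rbar (fun r => exists xi : R, r = norm (f xi)) (Cb_norm f).
Proof.
unfold Cb_norm.
set (E := fun r => exists xi : R, r = norm (f xi)).
assert (L := Lub_Rbar_correct E).
destruct (Cb_bounded f) as [M HM].
assert (H1 := proj1 L (norm (f 0)) (ex_intro _ 0 eq_refl)).
assert (H2 : Rbar_le (Lub_Rbar E) M).
{ apply (proj2 L); intros r [xi ->]; apply HM. }
destruct (Lub_Rbar E); simpl in *; easy.
Qed.

Lemma Cb_norm_ge (f : Cb) (xi : R) : norm (f xi) <= Cb_norm f.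
Proof. apply (proj1 (Cb_norm_lub f)); exists xi; reflexivity. Qed.

Lemma Cb_norm_le (f : Cb) (M : R) :
  (forall xi, norm (f xi) <= M) -> Cb_norm f <= M.
Proof.
intros H; apply (proj2 (Cb_norm_lub f) (Finite M)).
intros r [xi ->]; apply H.
Qed.

Definition Cb_AbelianMonoid_mixin : AbelianMonoid.mixin_of Cb.
Proof.
apply (AbelianMonoid.Mixin Cb Cb_plus Cb_zero); intros; apply Cb_ext;
  intros xi; simpl.
- apply plus_comm.
- apply plus_assoc.
- apply plus_zero_r.
Defined.

Canonical Cb_AbelianMonoid := AbelianMonoid.Pack Cb Cb_AbelianMonoid_mixin Cb.

Definition Cb_AbelianGroup_mixin : AbelianGroup.mixin_of Cb_AbelianMonoid.
Proof.
apply (AbelianGroup.Mixin Cb_AbelianMonoid Cb_opp); intros f; apply Cb_ext;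
  intros xi; exact (plus_opp_r (f xi)).
Defined.

Canonical Cb_AbelianGroup :=
  AbelianGroup.Pack Cb
    (AbelianGroup.Class Cb Cb_AbelianMonoid_mixin Cb_AbelianGroup_mixin) Cb.

Definition Cb_ModuleSpace_mixin : ModuleSpace.mixin_of R_Ring Cb_AbelianGroup.
Proof.
apply (ModuleSpace.Mixin R_Ring Cb_AbelianGroup Cb_scal).
- intros a b f; apply Cb_ext; intros xi; exact (scal_assoc a b (f xi)).
- intros f; apply Cb_ext; intros xi; exact (scal_one (f xi)).
- intros a f g; apply Cb_ext; intros xi; exact (scal_distr_l a (f xi) (g xi)).
- intros a b f; apply Cb_ext; intros xi; exact (scal_distr_r a b (f xi)).
Defined.

Canonical Cb_ModuleSpace :=
  ModuleSpace.Pack R_Ring Cb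
    (ModuleSpace.Class R_Ring Cb (AbelianGroup.class Cb_AbelianGroup)
       Cb_ModuleSpace_mixin) Cb.

Definition Cb_ball (f : Cb) (e : R) (g : Cb) : Prop :=
  Cb_norm (minus g f) < e.

Lemma Cb_norm_triangle (f g : Cb) :
  Cb_norm (plus f g) <= Cb_norm f + Cb_norm g.
Proof.
apply Cb_norm_le; intros xi.
eapply Rle_trans; [apply (norm_triangle (f xi) (g xi)) |].
apply Rplus_le_compat; apply Cb_norm_ge.
Qed.

Lemma Cb_norm_opp_le (f : Cb) : Cb_norm (opp f) <= Cb_norm f.
Proof.
apply Cb_norm_le; intros xi.
change (norm (opp (f xi)) <= Cb_norm f); rewrite norm_opp; apply Cb_norm_ge.
Qed.

Definition Cb_UniformSpace_mixin : UniformSpace.mixin_of Cb.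
Proof.
apply (UniformSpace.Mixin Cb Cb_zero Cb_ball); unfold Cb_ball.
- intros f e; rewrite minus_eq_zero.
  apply Rle_lt_trans with 0; [| apply cond_pos].
  apply Cb_norm_le; intros xi.
  change (norm (zero : W) <= 0); rewrite norm_zero; lra.
- intros f g e H; rewrite <- opp_minus.
  eapply Rle_lt_trans; [apply Cb_norm_opp_le | exact H].
- intros f g k e1 e2 H1 H2.
  rewrite (minus_trans g k f).
  eapply Rle_lt_trans; [apply Cb_norm_triangle | lra].
Defined.

Canonical Cb_UniformSpace := UniformSpace.Pack Cb Cb_UniformSpace_mixin Cb.

Canonical Cb_NormedModuleAux :=
  NormedModuleAux.Pack R_AbsRing Cb
    (NormedModuleAux.Class R_AbsRing Cb (ModuleSpace.class R_Ring Cb_ModuleSpace)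
       Cb_UniformSpace_mixin) Cb.

Definition Cb_NormedModule_mixin :
  NormedModule.mixin_of R_AbsRing Cb_NormedModuleAux.
Proof.
apply (NormedModule.Mixin R_AbsRing Cb_NormedModuleAux Cb_norm 1).
- apply Cb_norm_triangle.
- intros a f; apply Cb_norm_le; intros xi.
  eapply Rle_trans; [apply (norm_scal a (f xi)) |].
  apply Rmult_le_compat_l; [apply Rabs_pos | apply Cb_norm_ge].
- intros f g e H; exact H.
- intros f g e H; rewrite Rmult_1_l; exact H.
- intros f H; apply Cb_ext; intros xi; apply norm_eq_zero.
  apply Rle_antisym; [rewrite <- H; apply Cb_norm_ge | apply norm_ge_0].
Defined.

Canonical Cb_NormedModule :=
  NormedModule.Pack R_AbsRing Cb
    (NormedModule.Class R_AbsRing Cb (NormedModuleAux.class R_AbsRing Cb_NormedModuleAux)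
       Cb_NormedModule_mixin) Cb.

End BoundedContinuous.

Arguments Cb W : clear implicits.

Notation R3_NormedModule :=
  (prod_NormedModule R_AbsRing
     (prod_NormedModule R_AbsRing R_NormedModule R_NormedModule) R_NormedModule).

(** The last condition is continuity of [x => D x] in operator norm. *)
Definition C1_on {X Y : NormedModule R_AbsRing} (U : X -> Prop) (f : X -> Y) : Prop :=
  exists D : X -> X -> Y,
    (forall x, U x -> filterdiff f (locally x) (D x)) /\
    (forall x, U x -> forall eps : posreal,
       locally x (fun y => forall v : X, norm (minus (D y v) (D x v)) <= eps * norm v)).

(** * The Landau-Lifshitz-Gilbert travelling-wave problem *)

Definition xhat : R3 := (1, 0, 0).
Definition yhat : R3 := (0, 1, 0).
Definition zhat : R3 := (0, 0, 1).

Definition dot (u v : R3) : R :=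
  let '(u1, u2, u3) := u in
  let '(v1, v2, v3) := v in
  u1 * v1 + u2 * v2 + u3 * v3.

Definition cross (u v : R3) : R3 :=
  let '(u1, u2, u3) := u in
  let '(v1, v2, v3) := v in
  (u2 * v3 - u3 * v2, u3 * v1 - u1 * v3, u1 * v2 - u2 * v1).

Definition S2 (u : R3) : Prop := dot u u = 1.

(** A parameter is [L = (H1, H2, H3, K2)]. *)
Definition applied_field (L : R4) : R3 :=
  let '(H1, H2, H3, _) := L in
  plus (plus (scal H1 xhat) (scal H2 yhat)) (scal H3 zhat).

Definition anisotropy (L : R4) : R := let '(_, _, _, K2) := L in K2.

Definition potential (L : R4) (m : R3) : R :=
  1 / 2 * (1 - dot m xhat ^ 2 + anisotropy L * dot m yhat ^ 2
           - 2 * dot (applied_field L) m).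

Definition local_min_on_S2 (F : R3 -> R) (p : R3) : Prop :=
  S2 p /\ within S2 (locally p) (fun q => F p <= F q).

Definition boundary_values (L : R4) (mplus mminus : R3) : Prop :=
  (local_min_on_S2 (potential L) mplus /\ 0 < dot xhat mplus) /\
  (local_min_on_S2 (potential L) mminus /\ dot xhat mminus < 0).

(** [m] and [m''] are the values of the profile and of its second derivative
    at the same point. *)
Definition effective_field (L : R4) (m m'' : R3) : R3 :=
  plus (minus (plus m'' (scal (dot m xhat) xhat))
              (scal (anisotropy L * dot m yhat) yhat))
       (applied_field L).

Definition travelling_wave (alpha : R) (L : R4) (V : R) (m : R -> R3) : Prop :=
  exists m' m'' : R -> R3,
    (forall xi, is_derive m xi (m' xi)) /\
    (forall xi, is_derive m' xi (m'' xi)) /\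
    (forall xi,
       plus (plus (scal V (m' xi)) (scal (alpha * V) (cross (m xi) (m' xi))))
            (cross (m xi) (effective_field L (m xi) (m'' xi))) = zero).

Definition static_angle (h : R) (beta : R -> R) : Prop :=
  (forall xi, is_derive beta xi (h - sin (beta xi))) /\
  is_lim beta m_infty (PI - asin h) /\
  is_lim beta p_infty (asin h).

Definition static_profile (h2 h3 : R) (beta : R -> R) (xi : R) : R3 :=
  let h := sqrt (h2 ^ 2 + h3 ^ 2) in
  let e : R3 := scal (/ h) (plus (scal h2 yhat) (scal h3 zhat)) in
  plus (scal (cos (beta xi)) xhat) (scal (sin (beta xi)) e).

(* Main.v *)
Require Import Defs.
From Stdlib Require Import Reals Lra Lia List ClassicalEpsilon FunctionalExtensionality.
From Coquelicot Require Import Coquelicot.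
Open Scope R_scope.

(** Let [e] be the direction of the transverse field, [p] the product of [xhat]
    and [e], and write the profile as
    [cos y * cos be * xhat + cos y * sin be * e + sin y * p]. The travelling-wave
    equation becomes a second-order system for the angles [be] and [y], solved at
    the base point by the static angle [b], by [y = 0] and by [V = 0]. The theorem
    is an implicit function theorem around this solution, in the space of bounded
    continuous functions.

    In the plane one writes [be' = h - sin be + r], which splits the linearization
    into the equations [B' = - cos b * B + g] and [r' = cos b * r + g]; their
    homogeneous solutions are [speed = sin b - h], which is minus the derivative of
    [b], and [1 / speed]. The first equation has bounded solutions for every
    bounded [g] ([stable_op]). The second has one exactly when the integral of
    [speed * g] vanishes ([unstable_op]). The velocity enters [g] through
    [alpha * V * speed], and [alpha > 0], so that it can be chosen to meet this
    condition.

    Out of the plane the linearization is [- w'' + l * w], where [l] may be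
    negative. It maps [sin b] to the positive constant [h], hence it has a positive
    supersolution. Therefore [w = K ((4 - l) * w + g)], with [K] the inverse of
    [- w'' + 4 * w], is a contraction of ratio [1 - h / 4] in the norm weighted by
    [sin b] ([resolvent_supersolution], [psi_op_estimate]).

    The other terms are quadratic in the unknowns or vanish with the parameter,
    and a rescaling of the unknowns makes the off-diagonal linear terms small. The
    solution is thus the fixed point of a contraction of functions with values in
    [R^5] ([profile_family]); the contraction is differentiable with Lipschitz
    derivative, and so is its fixed point as a function of the parameter
    ([parametric_fixed_point]).

    Functions with limits at both ends form a closed set that the contraction
    preserves, by the asymptotics of scalar linear equations ([ode_limit]). So the
    profiles have limits, which are critical points of the potential on the sphere
    ([wave_limit_critical]). A local minimum cannot lie near the equator
    orthogonal to [xhat] ([local_min_away]), and away from it there is one critical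
    point on each side ([critical_unique]): the limits are the prescribed boundary
    values. *)

(** * Identities in a module *)

Section ModuleIdentities.

Context {E : NormedModule R_AbsRing}.

Inductive mexp : Type :=
  | MVar (n : nat) | MZero | MPlus (a b : mexp) | MOpp (a : mexp) | MScal (r : R) (a : mexp).

Fixpoint meval (l : list E) (a : mexp) : E :=
  match a with
  | MVar n => nth n l zero
  | MZero => zero
  | MPlus a b => plus (meval l a) (meval l b)
  | MOpp a => opp (meval l a)
  | MScal r a => scal r (meval l a)
  end.

Fixpoint mcoef (a : mexp) (k : nat) : R :=
  match a with
  | MVar n => if Nat.eqb n k then 1 else 0
  | MZero => 0
  | MPlus a b => mcoef a k + mcoef b k
  | MOpp a => - mcoef a k
  | MScal r a => r * mcoef a k
  end.

Fixpoint mcomb (c : nat -> R) (l : list E) : E :=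
  match l with
  | nil => zero
  | cons x l => plus (scal (c 0%nat) x) (mcomb (fun k => c (S k)) l)
  end.

Lemma mcomb_ext c d l :
  (forall k, (k < length l)%nat -> c k = d k) -> mcomb c l = mcomb d l.
Proof.
revert c d; induction l as [|x l IH]; simpl; intros c d H; [reflexivity|].
rewrite H by lia; f_equal; apply IH; intros; apply H; lia.
Qed.

Lemma mcomb_zero l : mcomb (fun _ => 0) l = zero.
Proof.
induction l as [|x l IH]; simpl; [reflexivity|].
rewrite IH, plus_zero_r; exact (scal_zero_l x).
Qed.

Lemma mcomb_plus c d l : mcomb (fun k => c k + d k) l = plus (mcomb c l) (mcomb d l).
Proof.
revert c d; induction l as [|x l IH]; simpl; intros c d; [exact (eq_sym (plus_zero_r zero))|].
rewrite IH.
replace (scal (c 0%nat + d 0%nat) x) with (plus (scal (c 0%nat) x) (scal (d 0%nat) x))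
  by (symmetry; exact (scal_distr_r (c 0%nat) (d 0%nat) x)).
rewrite <- !plus_assoc; f_equal.
rewrite !plus_assoc; f_equal; apply plus_comm.
Qed.

Lemma mcomb_scal r c l : mcomb (fun k => r * c k) l = scal r (mcomb c l).
Proof.
revert c; induction l as [|x l IH]; simpl; intros c; [exact (eq_sym (scal_zero_r r))|].
rewrite IH.
transitivity (plus (scal r (scal (c 0%nat) x)) (scal r (mcomb (fun k => c (S k)) l))).
- f_equal; exact (eq_sym (scal_assoc r (c 0%nat) x)).
- exact (eq_sym (scal_distr_l r _ _)).
Qed.

Lemma mcomb_var n l : mcomb (fun k => if Nat.eqb n k then 1 else 0) l = nth n l zero.
Proof.
revert n; induction l as [|x l IH]; intros [|n]; try reflexivity.
- change (plus (scal 1 x) (mcomb (fun _ => 0) l) = x).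
  rewrite mcomb_zero, plus_zero_r; exact (scal_one x).
- change (plus (scal 0 x) (mcomb (fun k => if Nat.eqb n k then 1 else 0) l) = nth n l zero).
  rewrite IH.
  replace (scal 0 x) with (zero : E) by (symmetry; exact (scal_zero_l x)).
  apply plus_zero_l.
Qed.

Lemma meval_mcomb l a : meval l a = mcomb (mcoef a) l.
Proof.
induction a; simpl.
- symmetry; apply mcomb_var.
- symmetry; apply mcomb_zero.
- rewrite mcomb_plus; congruence.
- rewrite IHa; transitivity (scal (-1) (mcomb (mcoef a) l)).
  + symmetry; exact (scal_opp_one (mcomb (mcoef a) l)).
  + rewrite <- mcomb_scal; apply mcomb_ext; intros; lra.
- rewrite mcomb_scal; congruence.
Qed.

Fixpoint coef_eq (n : nat) (c d : nat -> R) : Prop :=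
  match n with
  | O => True
  | S n => c 0%nat = d 0%nat /\ coef_eq n (fun k => c (S k)) (fun k => d (S k))
  end.

Lemma meval_eq l a b : coef_eq (length l) (mcoef a) (mcoef b) -> meval l a = meval l b.
Proof.
rewrite !meval_mcomb; generalize (mcoef a) (mcoef b).
induction l as [|x l IH]; simpl; intros c d H; [reflexivity|].
destruct H as [-> H]; f_equal; apply IH; exact H.
Qed.

End ModuleIdentities.

(** Both sides are reified as linear combinations of their atoms, and [ring]
    compares the coefficients. *)
Ltac mindex x l :=
  lazymatch l with
  | cons x _ => constr:(O)
  | cons _ ?l => let n := mindex x l in constr:(S n)
  end.
Ltac mmem x l :=
  lazymatch l with
  | nil => constr:(false) | cons x _ => constr:(true) | cons _ ?l => mmem x l
  end.
Ltac mvars t l :=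
  lazymatch t with
  | plus ?a ?b => let l := mvars a l in mvars b l
  | minus ?a ?b => let l := mvars a l in mvars b l
  | opp ?a => mvars a l
  | scal _ ?a => mvars a l
  | zero => l
  | _ => lazymatch mmem t l with true => l | false => constr:(cons t l) end
  end.
Ltac mreify t l :=
  lazymatch t with
  | plus ?a ?b => let a := mreify a l in let b := mreify b l in constr:(MPlus a b)
  | minus ?a ?b => let a := mreify a l in let b := mreify b l in constr:(MPlus a (MOpp b))
  | opp ?a => let a := mreify a l in constr:(MOpp a)
  | scal ?r ?a => let a := mreify a l in constr:(MScal r a)
  | zero => constr:(MZero)
  | _ => let n := mindex t l in constr:(MVar n)
  end.
Ltac module_in E :=
  lazymatch goal with
  | |- ?a = ?b =>
      let l := mvars a (@nil (NormedModule.sort R_AbsRing E)) in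
      let l := mvars b l in
      let a' := mreify a l in let b' := mreify b l in
      change (meval (E := E) l a' = meval (E := E) l b');
      apply meval_eq; cbn; repeat split; ring
  end.

(** * Uniform differentiability with Lipschitz derivative *)

Lemma norm_of_plus {E : NormedModule R_AbsRing} (a b c : E) (B C : R) :
  a = plus b c -> norm b <= B -> norm c <= C -> norm a <= B + C.
Proof.
intros -> HB HC; eapply Rle_trans; [apply norm_triangle | lra].
Qed.

Lemma norm_minus_self {E : NormedModule R_AbsRing} (a : E) : norm (minus a a) = 0.
Proof.
transitivity (norm (zero : E)); [f_equal; exact (minus_eq_zero a) | exact norm_zero].
Qed.

Lemma norm_minus_sym {E : NormedModule R_AbsRing} (a b : E) :
  norm (minus a b) = norm (minus b a).
Proof. rewrite <- norm_opp, opp_minus; reflexivity. Qed.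

Lemma norm_scal_R {E : NormedModule R_AbsRing} (r : R) (v : E) :
  norm (scal r v) <= Rabs r * norm v.
Proof. exact (norm_scal r v). Qed.

Section Products.
Context {E F : NormedModule R_AbsRing}.

Lemma norm_pair_le (x : E) (y : F) :
  norm ((x, y) : prod_NormedModule R_AbsRing E F) <= norm x + norm y.
Proof.
change (sqrt (norm x ^ 2 + norm y ^ 2) <= norm x + norm y).
assert (Hx := norm_ge_0 x); assert (Hy := norm_ge_0 y).
rewrite <- (sqrt_pow2 (norm x + norm y)) by lra.
apply sqrt_le_1_alt; nra.
Qed.

Lemma norm_fst_le (z : prod_NormedModule R_AbsRing E F) : norm (fst z) <= norm z.
Proof.
change (norm (fst z) <= sqrt (norm (fst z) ^ 2 + norm (snd z) ^ 2)).
assert (Hx := norm_ge_0 (fst z)); assert (Hy := norm_ge_0 (snd z)).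
rewrite <- (sqrt_pow2 (norm (fst z))) at 1 by lra.
apply sqrt_le_1_alt; nra.
Qed.

Lemma norm_snd_le (z : prod_NormedModule R_AbsRing E F) : norm (snd z) <= norm z.
Proof.
change (norm (snd z) <= sqrt (norm (fst z) ^ 2 + norm (snd z) ^ 2)).
assert (Hx := norm_ge_0 (fst z)); assert (Hy := norm_ge_0 (snd z)).
rewrite <- (sqrt_pow2 (norm (snd z))) at 1 by lra.
apply sqrt_le_1_alt; nra.
Qed.

End Products.

(** Equalities between reals stated with the operations of [R_NormedModule]. *)
Ltac ringR :=
  unfold minus, plus, opp, scal; simpl; unfold mult; simpl;
  lazymatch goal with |- @eq _ ?a ?b => change (@eq R a b) end; ring.

(** Continuous differentiability in quantitative form: a Lipschitz derivative and
    a quadratic remainder, with constants that do not depend on the index [i]. Each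
    clause is one inequality, hence the class is stable under the constructions
    below without any choice of neighbourhoods, and pointwise estimates for a
    family indexed by the line are estimates in the supremum norm. *)
Record C11 {I : Type} {Z Y : NormedModule R_AbsRing} (D : Z -> Prop)
    (F : I -> Z -> Y) (dF : I -> Z -> Z -> Y) : Prop := mkC11 {
  C11_add : forall i z u v, D z -> dF i z (plus u v) = plus (dF i z u) (dF i z v);
  C11_hom : forall i z c v, D z -> dF i z (scal c v) = scal c (dF i z v);
  C11_val : exists C, 0 <= C /\ forall i z, D z -> norm (F i z) <= C;
  C11_der : exists C, 0 <= C /\ forall i z v, D z -> norm (dF i z v) <= C * norm v;
  C11_lip : exists C, 0 <= C /\ forall i z z', D z -> D z' ->
    norm (minus (F i z') (F i z)) <= C * norm (minus z' z);
  C11_der_lip : exists C, 0 <= C /\ forall i z z' v, D z -> D z' ->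
    norm (minus (dF i z' v) (dF i z v)) <= C * norm (minus z' z) * norm v;
  C11_taylor : exists C, 0 <= C /\ forall i z z', D z -> D z' ->
    norm (minus (minus (F i z') (F i z)) (dF i z (minus z' z)))
      <= C * norm (minus z' z) ^ 2 }.

Section C11Closure.

Context {I : Type} {Z : NormedModule R_AbsRing} (D : Z -> Prop).

Lemma C11_minus {Y : NormedModule R_AbsRing} (F : I -> Z -> Y) dF :
  C11 D F dF -> forall i z u v, D z ->
  dF i z (minus u v) = minus (dF i z u) (dF i z v).
Proof.
intros H i z u v Hz; unfold minus; rewrite (C11_add _ _ _ H) by assumption; f_equal.
transitivity (dF i z (scal (-1) v)); [f_equal; module_in Z|].
rewrite (C11_hom _ _ _ H) by assumption; module_in Y.
Qed.

Lemma C11_linear {Y : NormedModule R_AbsRing} (l : I -> Z -> Y) (K : R) :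
  (forall i u v, l i (plus u v) = plus (l i u) (l i v)) ->
  (forall i c v, l i (scal c v) = scal c (l i v)) ->
  (exists C, 0 <= C /\ forall i v, norm (l i v) <= C * norm v) ->
  (forall z, D z -> norm z <= K) ->
  C11 D l (fun i _ v => l i v).
Proof.
intros Hp Hs [C [HC Hb]] HK.
assert (Hm : forall i u v, l i (minus u v) = minus (l i u) (l i v)).
{ intros i u v; unfold minus; rewrite Hp; f_equal.
  transitivity (l i (scal (-1) v)); [f_equal; module_in Z|].
  rewrite Hs; module_in Y. }
split; auto.
- exists (C * Rabs K); split; [apply Rmult_le_pos; auto using Rabs_pos|].
  intros i z Hz; eapply Rle_trans; [apply Hb|].
  apply Rmult_le_compat_l; auto.
  apply Rle_trans with K; auto using Rle_abs.
- exists C; split; auto.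
- exists C; split; auto; intros; rewrite <- Hm; auto.
- exists 0; split; [lra|]; intros; rewrite norm_minus_self; lra.
- exists 0; split; [lra|]; intros; rewrite Hm, norm_minus_self; lra.
Qed.

Lemma C11_const {Y : NormedModule R_AbsRing} (c : I -> Y) :
  (exists C, forall i, norm (c i) <= C) -> C11 D (fun i _ => c i) (fun _ _ _ => zero).
Proof.
intros [C HC]; split.
- intros; now rewrite plus_zero_r.
- intros i z r v _; exact (eq_sym (scal_zero_r r)).
- exists (Rabs C); split; [apply Rabs_pos|]; intros.
  apply Rle_trans with C; auto using Rle_abs.
- exists 0; split; [lra|]; intros; rewrite norm_zero; lra.
- exists 0; split; [lra|]; intros; rewrite norm_minus_self; lra.
- exists 0; split; [lra|]; intros; rewrite norm_minus_self; lra.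
- exists 0; split; [lra|]; intros i z z' _ _; rewrite (minus_eq_zero (c i)); change (norm (minus (zero : Y) zero) <= 0 * norm (minus z' z) ^ 2); rewrite norm_minus_self; lra.
Qed.

Lemma C11_plus {Y : NormedModule R_AbsRing} (F G : I -> Z -> Y) dF dG :
  C11 D F dF -> C11 D G dG ->
  C11 D (fun i z => plus (F i z) (G i z)) (fun i z v => plus (dF i z v) (dG i z v)).
Proof.
intros [Fa Fh [C1 [P1 F1]] [C2 [P2 F2]] [C3 [P3 F3]] [C4 [P4 F4]] [C5 [P5 F5]]]
       [Ga Gh [D1 [Q1 G1]] [D2 [Q2 G2]] [D3 [Q3 G3]] [D4 [Q4 G4]] [D5 [Q5 G5]]].
split.
- intros; rewrite Fa, Ga by assumption; module_in Y.
- intros; rewrite Fh, Gh by assumption; module_in Y.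
- exists (C1 + D1); split; [lra|]; intros.
  eapply norm_of_plus; [reflexivity| |]; auto.
- exists (C2 + D2); split; [lra|]; intros; rewrite Rmult_plus_distr_r.
  eapply norm_of_plus; [reflexivity| |]; auto.
- exists (C3 + D3); split; [lra|]; intros i z z' Hz Hz'; rewrite Rmult_plus_distr_r.
  eapply (norm_of_plus _ (minus (F i z') (F i z)) (minus (G i z') (G i z)));
    [module_in Y| |]; auto.
- exists (C4 + D4); split; [lra|]; intros i z z' v Hz Hz'; rewrite !Rmult_plus_distr_r.
  eapply (norm_of_plus _ (minus (dF i z' v) (dF i z v)) (minus (dG i z' v) (dG i z v)));
    [module_in Y| |]; auto.
- exists (C5 + D5); split; [lra|]; intros i z z' Hz Hz'; rewrite !Rmult_plus_distr_r.
  eapply (norm_of_plus _ (minus (minus (F i z') (F i z)) (dF i z (minus z' z)))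
            (minus (minus (G i z') (G i z)) (dG i z (minus z' z))));
    [module_in Y| |]; auto.
Qed.

Lemma C11_pair {Y Y' : NormedModule R_AbsRing} (F : I -> Z -> Y) (G : I -> Z -> Y') dF dG :
  C11 D F dF -> C11 D G dG ->
  C11 (Y := prod_NormedModule R_AbsRing Y Y') D
    (fun i z => (F i z, G i z)) (fun i z v => (dF i z v, dG i z v)).
Proof.
intros [Fa Fh [C1 [P1 F1]] [C2 [P2 F2]] [C3 [P3 F3]] [C4 [P4 F4]] [C5 [P5 F5]]]
       [Ga Gh [D1 [Q1 G1]] [D2 [Q2 G2]] [D3 [Q3 G3]] [D4 [Q4 G4]] [D5 [Q5 G5]]].
split.
- intros; rewrite Fa, Ga by assumption; reflexivity.
- intros; rewrite Fh, Gh by assumption; reflexivity.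
- exists (C1 + D1); split; [lra|]; intros.
  eapply Rle_trans; [apply norm_pair_le|]; apply Rplus_le_compat; auto.
- exists (C2 + D2); split; [lra|]; intros; rewrite Rmult_plus_distr_r.
  eapply Rle_trans; [apply norm_pair_le|]; apply Rplus_le_compat; auto.
- exists (C3 + D3); split; [lra|]; intros; rewrite Rmult_plus_distr_r.
  eapply Rle_trans; [apply norm_pair_le|]; apply Rplus_le_compat.
  + apply F3; auto. + apply G3; auto.
- exists (C4 + D4); split; [lra|]; intros; rewrite !Rmult_plus_distr_r.
  eapply Rle_trans; [apply norm_pair_le|]; apply Rplus_le_compat.
  + apply F4; auto. + apply G4; auto.
- exists (C5 + D5); split; [lra|]; intros; rewrite !Rmult_plus_distr_r.
  eapply Rle_trans; [apply norm_pair_le|]; apply Rplus_le_compat.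
  + apply F5; auto. + apply G5; auto.
Qed.

Lemma Rabs_mult_le a b A B : Rabs a <= A -> Rabs b <= B -> Rabs (a * b) <= A * B.
Proof.
intros; rewrite Rabs_mult; apply Rmult_le_compat; auto using Rabs_pos.
Qed.

Lemma Rabs_plus_le a b A B : Rabs a <= A -> Rabs b <= B -> Rabs (a + b) <= A + B.
Proof.
intros; eapply Rle_trans; [apply Rabs_triang|]; lra.
Qed.

(** The remainder of the product is [G R_F + F R_G] plus the product of the
    increments. *)
Lemma C11_mult (F G : I -> Z -> R) dF dG :
  C11 (Y := R_NormedModule) D F dF -> C11 (Y := R_NormedModule) D G dG ->
  C11 (Y := R_NormedModule) D (fun i z => F i z * G i z)
    (fun i z v => dF i z v * G i z + F i z * dG i z v).
Proof.
intros [Fa Fh [C1 [P1 F1]] [C2 [P2 F2]] [C3 [P3 F3]] [C4 [P4 F4]] [C5 [P5 F5]]]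
       [Ga Gh [D1 [Q1 G1]] [D2 [Q2 G2]] [D3 [Q3 G3]] [D4 [Q4 G4]] [D5 [Q5 G5]]].
change (@norm R_AbsRing R_NormedModule) with Rabs in *.
change (@plus R_NormedModule) with Rplus in *.
change (@minus R_NormedModule) with Rminus in *.
assert (N := fun z : Z => norm_ge_0 z).
split; change (@norm R_AbsRing R_NormedModule) with Rabs;
  change (@plus R_NormedModule) with Rplus;
  change (@minus R_NormedModule) with Rminus.
- intros; rewrite Fa, Ga by assumption; ringR.
- intros; rewrite Fh, Gh by assumption; ringR.
- exists (C1 * D1); split; [now apply Rmult_le_pos|]; intros; apply Rabs_mult_le; auto.
- exists (C2 * D1 + C1 * D2); split; [nra|]; intros.
  replace ((C2 * D1 + C1 * D2) * norm v) with (C2 * norm v * D1 + C1 * (D2 * norm v)) by ring.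
  apply Rabs_plus_le; apply Rabs_mult_le; auto.
- exists (C1 * D3 + C3 * D1); split; [nra|]; intros i z z' Hz Hz'.
  replace (F i z' * G i z' - F i z * G i z)
    with (F i z' * (G i z' - G i z) + (F i z' - F i z) * G i z)
    by ring.
  replace ((C1 * D3 + C3 * D1) * norm (minus z' z))
    with (C1 * (D3 * norm (minus z' z)) + (C3 * norm (minus z' z)) * D1) by ring.
  apply Rabs_plus_le; apply Rabs_mult_le; auto.
- exists (C4 * D1 + C2 * D3 + C3 * D2 + C1 * D4); split; [nra|]; intros i z z' v Hz Hz'.
  set (n := norm (minus z' z)) in *; set (m := norm v) in *.
  replace ((dF i z' v * G i z' + F i z' * dG i z' v)
             - (dF i z v * G i z + F i z * dG i z v))
    with ((dF i z' v - dF i z v) * G i z' + dF i z v * (G i z' - G i z)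
          + (F i z' - F i z) * dG i z' v + F i z * (dG i z' v - dG i z v))
    by ring.
  replace ((C4 * D1 + C2 * D3 + C3 * D2 + C1 * D4) * n * m)
    with (C4 * n * m * D1 + C2 * m * (D3 * n) + C3 * n * (D2 * m) + C1 * (D4 * n * m)) by ring.
  repeat apply Rabs_plus_le; apply Rabs_mult_le; unfold n, m; auto.
- exists (C5 * D1 + C1 * D5 + C3 * D3); split; [nra|]; intros i z z' Hz Hz'.
  replace ((F i z' * G i z' - F i z * G i z)
             - (dF i z (minus z' z) * G i z + F i z * dG i z (minus z' z)))
    with (((F i z' - F i z) - dF i z (minus z' z)) * G i z
          + F i z * ((G i z' - G i z) - dG i z (minus z' z))
          + (F i z' - F i z) * (G i z' - G i z))
    by ring.
  set (n := norm (minus z' z)) in *.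
  replace ((C5 * D1 + C1 * D5 + C3 * D3) * n ^ 2)
    with (C5 * n ^ 2 * D1 + C1 * (D5 * n ^ 2) + C3 * n * (D3 * n)) by ring.
  repeat apply Rabs_plus_le; apply Rabs_mult_le; unfold n; auto.
Qed.

(** The remainder is that of [F] for the increment of [g], plus the image by [dF]
    of the remainder of [g]. *)
Lemma C11_comp {X Y : NormedModule R_AbsRing} (B : X -> Prop) (F : I -> X -> Y) dF
    (g : I -> Z -> X) dg :
  C11 B F dF -> C11 D g dg -> (forall i z, D z -> B (g i z)) ->
  C11 D (fun i z => F i (g i z)) (fun i z v => dF i (g i z) (dg i z v)).
Proof.
intros HF [Ga Gh [D1 [Q1 G1]] [D2 [Q2 G2]] [D3 [Q3 G3]] [D4 [Q4 G4]] [D5 [Q5 G5]]] HB.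
assert (Fm : forall i x u v, B x -> dF i x (minus u v) = minus (dF i x u) (dF i x v)).
{ intros i x u v Hx; unfold minus; rewrite (C11_add _ _ _ HF) by assumption; f_equal.
  transitivity (dF i x (scal (-1) v)); [f_equal; module_in X|].
  rewrite (C11_hom _ _ _ HF) by assumption; module_in Y. }
destruct HF as [Fa Fh [C1 [P1 F1]] [C2 [P2 F2]] [C3 [P3 F3]] [C4 [P4 F4]] [C5 [P5 F5]]].
assert (N := fun z : Z => norm_ge_0 z).
assert (NX := fun z : X => norm_ge_0 z).
split.
- intros; rewrite Ga, Fa by auto; reflexivity.
- intros; rewrite Gh, Fh by auto; reflexivity.
- exists C1; split; auto.
- exists (C2 * D2); split; [nra|]; intros; rewrite Rmult_assoc.
  eapply Rle_trans; [apply F2; auto|]; apply Rmult_le_compat_l; auto.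
- exists (C3 * D3); split; [nra|]; intros; rewrite Rmult_assoc.
  eapply Rle_trans; [apply F3; auto|]; apply Rmult_le_compat_l; auto.
- exists (C4 * D3 * D2 + C2 * D4); split; [assert (0 <= C4 * D3) by nra; nra|].
  intros i z z' v Hz Hz'.
  set (n := norm (minus z' z)); set (m := norm v).
  replace ((C4 * D3 * D2 + C2 * D4) * n * m)
    with (C4 * (D3 * n) * (D2 * m) + C2 * (D4 * n * m)) by ring.
  apply (norm_of_plus _ (minus (dF i (g i z') (dg i z' v)) (dF i (g i z) (dg i z' v)))
           (dF i (g i z) (minus (dg i z' v) (dg i z v)))).
  + rewrite Fm by auto; module_in Y.
  + eapply Rle_trans; [apply F4; auto|].
    apply Rmult_le_compat;
      [now apply Rmult_le_pos | auto | | apply G2; auto].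
    apply Rmult_le_compat_l; [auto | apply G3; auto].
  + eapply Rle_trans; [apply F2; auto|]; apply Rmult_le_compat_l; [auto | apply G4; auto].
- exists (C5 * D3 ^ 2 + C2 * D5); split; [assert (0 <= C5 * D3 ^ 2) by (apply Rmult_le_pos; nra); nra|].
  intros i z z' Hz Hz'.
  set (n := norm (minus z' z)).
  replace ((C5 * D3 ^ 2 + C2 * D5) * n ^ 2)
    with (C5 * (D3 * n) ^ 2 + C2 * (D5 * n ^ 2)) by ring.
  apply (norm_of_plus _
    (minus (minus (F i (g i z')) (F i (g i z))) (dF i (g i z) (minus (g i z') (g i z))))
    (dF i (g i z) (minus (minus (g i z') (g i z)) (dg i z (minus z' z))))).
  + rewrite (Fm i (g i z) (minus (g i z') (g i z)) (dg i z (minus z' z))) by auto.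
    module_in Y.
  + eapply Rle_trans; [apply F5; auto|]; apply Rmult_le_compat_l; [auto|].
    apply pow_incr; split; [auto | apply G3; auto].
  + eapply Rle_trans; [apply F2; auto|]; apply Rmult_le_compat_l; [auto|].
    apply G5; auto.
Qed.

End C11Closure.

(** The mean value theorem for [g] and for [g1] provides the constants. *)
Lemma C11_real {I : Type} (J : R -> Prop) (g g1 g2 : R -> R) (K : R) :
  (forall x y z, J x -> J y -> x <= z <= y -> J z) ->
  (forall x, J x -> is_derive g x (g1 x)) ->
  (forall x, J x -> is_derive g1 x (g2 x)) ->
  (forall x, J x -> Rabs (g x) <= K /\ Rabs (g1 x) <= K /\ Rabs (g2 x) <= K) ->
  C11 (I := I) (Z := R_NormedModule) (Y := R_NormedModule) J
    (fun _ x => g x) (fun _ x v => g1 x * v).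
Proof.
intros HJ Hg Hg1 HK.
assert (mvt : forall f f1 : R -> R, (forall x, J x -> is_derive f x (f1 x)) ->
   forall x y, J x -> J y -> exists c, J c /\ Rabs (c - x) <= Rabs (y - x) /\
     f y - f x = f1 c * (y - x)).
{ intros f f1 Hf x y Hx Hy.
  assert (HM : forall z, Rmin x y <= z <= Rmax x y -> J z).
  { intros z Hz; revert Hz; unfold Rmin, Rmax; destruct (Rle_dec x y); intros Hz;
      [apply (HJ x y)|apply (HJ y x)]; auto; lra. }
  destruct (MVT_gen f x y f1) as [c [Hc E]].
  - intros z Hz; apply Hf, HM; lra.
  - intros z Hz; apply continuity_pt_filterlim.
    apply (ex_derive_continuous f); eexists; apply Hf, HM; lra.
  - exists c; split; [apply HM; lra|]; split; [|exact E].
    revert Hc; unfold Rmin, Rmax; destruct (Rle_dec x y); intros Hc;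
      unfold Rabs; repeat destruct Rcase_abs; lra. }
assert (L : forall x y, J x -> J y -> Rabs (g1 y - g1 x) <= K * Rabs (y - x)).
{ intros x y Hx Hy; destruct (mvt g1 g2 Hg1 x y Hx Hy) as [c [Hc [_ ->]]].
  apply Rabs_mult_le; [apply HK; auto|lra]. }
split; change (@norm R_AbsRing R_NormedModule) with Rabs;
  change (@plus R_NormedModule) with Rplus.
- intros; ringR.
- intros; ringR.
- exists (Rabs K); split; [apply Rabs_pos|]; intros i z Hz.
  apply Rle_trans with K; [apply HK; auto|apply Rle_abs].
- exists (Rabs K); split; [apply Rabs_pos|]; intros i z v Hz.
  apply Rabs_mult_le; [|lra].
  apply Rle_trans with K; [apply HK; auto|apply Rle_abs].
- exists (Rabs K); split; [apply Rabs_pos|]; intros i z z' Hz Hz'.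
  change (Rabs (g z' - g z) <= Rabs K * Rabs (z' - z)).
  destruct (mvt g g1 Hg z z' Hz Hz') as [c [Hc [_ ->]]].
  apply Rabs_mult_le; [|lra].
  apply Rle_trans with K; [apply HK; auto|apply Rle_abs].
- exists (Rabs K); split; [apply Rabs_pos|]; intros i z z' v Hz Hz'.
  change (Rabs (g1 z' * v - g1 z * v) <= Rabs K * Rabs (z' - z) * Rabs v).
  replace (g1 z' * v - g1 z * v) with ((g1 z' - g1 z) * v) by ring.
  apply Rabs_mult_le; [|lra].
  eapply Rle_trans; [apply L; auto|]; apply Rmult_le_compat_r; [apply Rabs_pos|apply Rle_abs].
- exists (Rabs K); split; [apply Rabs_pos|]; intros i z z' Hz Hz'.
  change (Rabs ((g z' - g z) - g1 z * (z' - z)) <= Rabs K * Rabs (z' - z) ^ 2).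
  destruct (mvt g g1 Hg z z' Hz Hz') as [c [Hc [Hc' ->]]].
  replace (g1 c * (z' - z) - g1 z * (z' - z)) with ((g1 c - g1 z) * (z' - z)) by ring.
  replace (Rabs K * Rabs (z' - z) ^ 2) with (Rabs K * Rabs (z' - z) * Rabs (z' - z)) by ring.
  apply Rabs_mult_le; [|lra].
  eapply Rle_trans; [apply L; auto|].
  apply Rmult_le_compat; auto using Rabs_pos, Rle_abs.
  apply Rle_trans with (Rabs (g2 z)); [apply Rabs_pos | apply HK; auto].
Qed.

(** * Fixed points depending smoothly on parameters *)

(** Completeness for sequences with geometric increments; in this form it passes
    to pairs and to bounded functions with the same rate. *)
Definition geo_complete (E : NormedModule R_AbsRing) : Prop :=
  forall (u : nat -> E) (C t : R), 0 <= t < 1 ->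
  (forall n, norm (minus (u (S n)) (u n)) <= C * t ^ n) ->
  exists l, forall n, norm (minus l (u n)) <= C * t ^ n / (1 - t).

Lemma geo_dist {E : NormedModule R_AbsRing} (u : nat -> E) (C t : R) :
  0 <= t < 1 -> (forall n, norm (minus (u (S n)) (u n)) <= C * t ^ n) ->
  forall n k, norm (minus (u (n + k)%nat) (u n)) <= C * t ^ n / (1 - t).
Proof.
intros Ht Hu n k.
assert (HC : 0 <= C) by (generalize (Hu 0%nat) (norm_ge_0 (minus (u 1%nat) (u 0%nat))); simpl; lra).
assert (H : norm (minus (u (n + k)%nat) (u n)) <= C * t ^ n * (1 - t ^ k) / (1 - t)).
{ induction k as [|k IH].
  - rewrite Nat.add_0_r, norm_minus_self; simpl; right; field; lra.
  - replace (n + S k)%nat with (S (n + k)) by lia.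
    replace (C * t ^ n * (1 - t ^ S k) / (1 - t))
      with (C * t ^ (n + k) + C * t ^ n * (1 - t ^ k) / (1 - t))
      by (rewrite pow_add; simpl; field; lra).
    apply (norm_of_plus _ (minus (u (S (n + k))) (u (n + k)%nat)) (minus (u (n + k)%nat) (u n)));
      [module_in E|apply Hu|exact IH]. }
eapply Rle_trans; [exact H|]; unfold Rdiv.
apply Rmult_le_compat_r; [left; apply Rinv_0_lt_compat; lra|].
rewrite <- (Rmult_1_r (C * t ^ n)) at 2; apply Rmult_le_compat_l.
- apply Rmult_le_pos; [assumption | apply pow_le; lra].
- assert (0 <= t ^ k) by (apply pow_le; lra); lra.
Qed.

Lemma geo_small (C t : R) : 0 <= t < 1 -> forall eps, 0 < eps ->
  exists N, forall n, (N <= n)%nat -> C * t ^ n / (1 - t) <= eps.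
Proof.
intros Ht eps He.
destruct (pow_lt_1_zero t) with (y := eps * (1 - t) / (Rabs C + 1)) as [N HN].
- rewrite Rabs_pos_eq; lra.
- assert (0 < Rabs C + 1) by (generalize (Rabs_pos C); lra).
  apply Rdiv_lt_0_compat; [nra|assumption].
- exists N; intros n Hn; assert (H := HN n Hn).
  assert (HC : 0 < Rabs C + 1) by (generalize (Rabs_pos C); lra).
  assert (Hp : 0 <= t ^ n) by (apply pow_le; lra).
  rewrite Rabs_pos_eq in H by assumption.
  apply Rmult_lt_compat_l with (r := Rabs C + 1) in H; [|assumption].
  replace ((Rabs C + 1) * (eps * (1 - t) / (Rabs C + 1))) with (eps * (1 - t)) in H
    by (field; lra).
  apply Rmult_le_reg_r with (1 - t); [lra|].
  replace (C * t ^ n / (1 - t) * (1 - t)) with (C * t ^ n) by (field; lra).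
  generalize (Rle_abs C); nra.
Qed.

Lemma geo_complete_R : geo_complete R_NormedModule.
Proof.
intros u C t Ht Hu.
assert (D := geo_dist u C t Ht Hu).
destruct (proj1 (filterlim_locally_cauchy (U := R_CompleteSpace) (F := eventually) u))
  as [l Hl].
- intros eps.
  destruct (geo_small C t Ht (eps / 3)) as [N HN]; [destruct eps; simpl; lra|].
  exists (fun n => (N <= n)%nat); split; [exists N; auto|].
  intros n m Hn Hm.
  assert (Dn := D N (n - N)%nat); assert (Dm := D N (m - N)%nat).
  replace (N + (n - N))%nat with n in Dn by lia.
  replace (N + (m - N))%nat with m in Dm by lia.
  specialize (HN N (le_n N)).
  change (Rabs (u n - u N) <= C * t ^ N / (1 - t)) in Dn.
  change (Rabs (u m - u N) <= C * t ^ N / (1 - t)) in Dm.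
  change (Rabs (u m - u n) < eps).
  replace (u m - u n) with ((u m - u N) - (u n - u N)) by ring.
  eapply Rle_lt_trans; [apply Rabs_triang|]; rewrite Rabs_Ropp.
  destruct eps as [e He]; simpl in *; lra.
- exists l; intros n.
  change (Rabs (l - u n) <= C * t ^ n / (1 - t)).
  apply le_epsilon; intros eps He.
  destruct (proj1 (filterlim_locally u l) Hl (mkposreal eps He)) as [N HN].
  specialize (HN (n + N)%nat ltac:(lia)).
  change (Rabs (u (n + N)%nat - l) < eps) in HN.
  specialize (D n N).
  change (Rabs (u (n + N)%nat - u n) <= C * t ^ n / (1 - t)) in D.
  replace (l - u n) with ((u (n + N)%nat - u n) - (u (n + N)%nat - l)) by ring.
  eapply Rle_trans; [apply Rabs_triang|]; rewrite Rabs_Ropp; lra.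
Qed.

(** The limits of the components only give the rate up to a factor two; letting
    the second index tend to infinity restores it. *)
Lemma geo_complete_pair (E F : NormedModule R_AbsRing) :
  geo_complete E -> geo_complete F -> geo_complete (prod_NormedModule R_AbsRing E F).
Proof.
intros HE HF u C t Ht Hu.
destruct (HE (fun n => fst (u n)) C t Ht) as [x Hx].
{ intros n; eapply Rle_trans; [|apply Hu]; apply (norm_fst_le (minus (u (S n)) (u n))). }
destruct (HF (fun n => snd (u n)) C t Ht) as [y Hy].
{ intros n; eapply Rle_trans; [|apply Hu]; apply (norm_snd_le (minus (u (S n)) (u n))). }
exists (x, y); intros n; apply le_epsilon; intros eps He.
destruct (geo_small C t Ht (eps / 2)) as [N HN]; [lra|].
specialize (HN (n + N)%nat ltac:(lia)).
rewrite Rplus_comm.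
eapply (norm_of_plus (E := prod_NormedModule R_AbsRing E F) _
         (minus (x, y) (u (n + N)%nat)) (minus (u (n + N)%nat) (u n))).
- module_in (prod_NormedModule R_AbsRing E F).
- eapply Rle_trans; [|apply Req_le, (Rplus_half_diag eps)].
  destruct (u (n + N)%nat) as [a b] eqn:Eu.
  eapply Rle_trans; [apply (norm_pair_le (minus x a) (minus y b))|].
  specialize (Hx (n + N)%nat); specialize (Hy (n + N)%nat); cbv beta in *.
  rewrite Eu in Hx, Hy; simpl in Hx, Hy; lra.
- apply geo_dist; assumption.
Qed.

Lemma geo_complete_Cb (W : NormedModule R_AbsRing) :
  geo_complete W -> geo_complete (@Cb_NormedModule W).
Proof.
intros HW u C t Ht Hu.
assert (Hp : forall xi, exists l : W, forall n, norm (minus l (u n xi)) <= C * t ^ n / (1 - t)).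
{ intros xi; apply (HW (fun n => u n xi) C t Ht); intros n.
  eapply Rle_trans; [|apply Hu].
  apply (Cb_norm_ge (minus (u (S n)) (u n)) xi). }
set (l := fun xi => proj1_sig (constructive_indefinite_description _ (Hp xi))).
assert (Hl : forall xi n, norm (minus (l xi) (u n xi)) <= C * t ^ n / (1 - t)).
{ intros xi; exact (proj2_sig (constructive_indefinite_description _ (Hp xi))). }
assert (Hc : forall xi, continuous l xi).
{ intros xi; apply (proj2 (filterlim_locally_ball_norm _ _)); intros [eps He].
  destruct (geo_small C t Ht (eps / 4)) as [N HN]; [lra|].
  specialize (HN N (le_n N)).
  assert (He3 : 0 < eps / 3) by lra.
  assert (Hu' := proj1 (filterlim_locally_ball_norm _ _) (Cb_continuous (u N) xi)
                    (mkposreal _ He3)).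
  revert Hu'; apply filter_imp; unfold ball_norm; simpl; intros x Hx.
  apply Rle_lt_trans with ((eps / 4 + eps / 3) + eps / 4); [|lra].
  eapply (norm_of_plus _ (plus (minus (l x) (u N x)) (minus (u N x) (u N xi)))
            (minus (u N xi) (l xi))).
  - module_in W.
  - eapply norm_of_plus; [reflexivity| |left; exact Hx].
    eapply Rle_trans; [apply Hl|assumption].
  - rewrite norm_minus_sym; eapply Rle_trans; [apply Hl|assumption]. }
assert (Hb : exists M, forall xi, norm (l xi) <= M).
{ destruct (Cb_bounded (u 0%nat)) as [M HM].
  exists (C * t ^ 0 / (1 - t) + M); intros xi.
  apply (norm_of_plus _ (minus (l xi) (u 0%nat xi)) (u 0%nat xi));
    [module_in W|apply Hl|apply HM]. }
exists (mkCb l Hc Hb); intros n; apply Cb_norm_le; intros xi; apply Hl.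
Qed.

Definition norm_closed {E : NormedModule R_AbsRing} (Q : E -> Prop) : Prop :=
  forall l, (forall eps, 0 < eps -> exists x, Q x /\ norm (minus l x) <= eps) -> Q l.

(** The iteration stays in [Q], and so does its limit: this is how qualitative
    properties of the fixed point are obtained. *)
Lemma contraction_fixed_point (E : NormedModule R_AbsRing) (G : E -> E) (Q : E -> Prop)
    (s t : R) :
  geo_complete E -> 0 <= s -> 0 <= t < 1 ->
  (forall x y, norm x <= s -> norm y <= s ->
     norm (minus (G x) (G y)) <= t * norm (minus x y)) ->
  norm (G zero) <= (1 - t) * s ->
  Q zero -> (forall x, norm x <= s -> Q x -> Q (G x)) -> norm_closed Q ->
  exists x, norm x <= s /\ G x = x /\ Q x.
Proof.
intros HE Hs Ht HG H0 Q0 QG Qc.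
set (u := fix u n := match n with O => zero | S n => G (u n) end : E).
set (C := norm (G zero)) in *.
assert (HC : 0 <= C) by apply norm_ge_0.
assert (Hself : forall x, norm x <= s -> norm (G x) <= s).
{ intros x Hx; replace s with (t * s + (1 - t) * s) by ring.
  eapply (norm_of_plus _ (minus (G x) (G zero)) (G zero)); [module_in E| |exact H0].
  eapply Rle_trans; [apply HG; auto; rewrite norm_zero; exact Hs|].
  apply Rmult_le_compat_l; [lra|].
  apply Rle_trans with (norm x); [right; f_equal; module_in E | exact Hx]. }
assert (Hu : forall n, norm (u n) <= s /\ Q (u n) /\
                       norm (minus (u (S n)) (u n)) <= C * t ^ n).
{ induction n as [|n [IH1 [IH2 IH3]]].
  - simpl; rewrite norm_zero; repeat split; auto.
    rewrite Rmult_1_r; right; unfold C; f_equal; module_in E.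
  - assert (H1 : norm (u (S n)) <= s) by (apply Hself; auto).
    repeat split; auto.
    + apply QG; auto.
    + eapply Rle_trans; [apply (HG (u (S n)) (u n)); auto|].
      simpl; replace (C * (t * t ^ n)) with (t * (C * t ^ n)) by ring.
      apply Rmult_le_compat_l; [lra|exact IH3]. }
destruct (HE u C t Ht (fun n => proj2 (proj2 (Hu n)))) as [l Hl].
assert (Hls : norm l <= s).
{ apply le_epsilon; intros eps He; rewrite Rplus_comm.
  destruct (geo_small C t Ht eps He) as [N HN].
  eapply (norm_of_plus _ (minus l (u N)) (u N)); [module_in E| |apply Hu].
  eapply Rle_trans; [apply Hl|]; auto. }
exists l; repeat split; auto.
- assert (Hz : norm (minus (G l) l) <= 0).
  { apply le_epsilon; intros eps He; rewrite Rplus_0_l.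
    destruct (geo_small C t Ht (eps / 2)) as [N HN]; [lra|].
    replace eps with (eps / 2 + eps / 2) by field.
    eapply (norm_of_plus _ (minus (G l) (u (S N))) (minus (u (S N)) l)); [module_in E| |].
    - eapply Rle_trans; [apply (HG l (u N)); auto; apply Hu|].
      apply Rle_trans with (1 * norm (minus l (u N))).
      + apply Rmult_le_compat_r; [apply norm_ge_0|lra].
      + rewrite Rmult_1_l; eapply Rle_trans; [apply Hl|]; auto.
    - rewrite norm_minus_sym; eapply Rle_trans; [apply Hl|]; auto. }
  assert (Hz' : minus (G l) l = zero).
  { apply norm_eq_zero; apply Rle_antisym; [exact Hz | apply norm_ge_0]. }
  transitivity (plus (minus (G l) l) l); [module_in E|].
  rewrite Hz'; apply plus_zero_l.
- apply Qc; intros eps He.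
  destruct (geo_small C t Ht eps He) as [N HN].
  exists (u N); split; [apply Hu|]; eapply Rle_trans; [apply Hl|]; auto.
Qed.

Section ParametricFixedPoint.

Variables (E P : NormedModule R_AbsRing).
Notation EP := (prod_NormedModule R_AbsRing E P).
Variables (p0 : P) (T : EP -> E) (dT : EP -> EP -> E) (Q : E -> Prop) (t : R).

Let D (z : EP) : Prop := norm (fst z) <= 1 /\ norm (minus (snd z) p0) <= 1.

Hypothesis E_complete : geo_complete E.
Hypothesis T_C11 : C11 (I := unit) D (fun _ => T) (fun _ => dT).
Hypothesis T_base : T (zero, p0) = zero.
Hypothesis t_bounds : 0 <= t < 1.
Hypothesis dT_base : forall v, norm (dT (zero, p0) (v, zero)) <= t * norm v.
Hypothesis Q_zero : Q zero.
Hypothesis Q_closed : norm_closed Q.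
Hypothesis Q_T : forall x p, D (x, p) -> Q x -> Q (T (x, p)).

(** Absorption of the contracted term into the left-hand side. *)
Lemma absorb (n c t' : R) : t' < 1 -> n <= t' * n + c -> n <= c / (1 - t').
Proof.
intros Ht H; apply Rmult_le_reg_r with (1 - t'); [lra|].
replace (c / (1 - t') * (1 - t')) with c by (field; lra); lra.
Qed.

Lemma norm_pair_zero (v : E) : norm ((v, zero) : EP) <= norm v.
Proof.
eapply Rle_trans; [apply norm_pair_le|]; rewrite norm_zero; lra.
Qed.

(** The contraction estimate at the base point persists near it, because the
    derivative is Lipschitz. The derivative of the fixed point in the direction [w]
    is the fixed point of the linear contraction [y |-> dT (y, w)]. Each estimate
    then comes from writing the fixed-point equation for a difference, splitting
    off the part that [dT (_, 0)] contracts, and absorbing it. *)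
Theorem parametric_fixed_point :
  exists rho (x : P -> E) (dx : P -> P -> E),
    0 < rho <= 1 /\
    C11 (I := unit) (fun p => norm (minus p p0) <= rho) (fun _ => x) (fun _ => dx) /\
    x p0 = zero /\
    forall p, norm (minus p p0) <= rho -> norm (x p) <= 1 /\ T (x p, p) = x p /\ Q (x p).
Proof.
assert (dTm := C11_minus D _ _ T_C11 tt).
assert (dTa := C11_add _ _ _ T_C11 tt).
assert (dTs := C11_hom _ _ _ T_C11 tt).
destruct (C11_der _ _ _ T_C11) as [C2 [P2 H2]]; specialize (H2 tt).
destruct (C11_lip _ _ _ T_C11) as [C3 [P3 H3]]; specialize (H3 tt).
destruct (C11_der_lip _ _ _ T_C11) as [C4 [P4 H4]]; specialize (H4 tt).
destruct (C11_taylor _ _ _ T_C11) as [C5 [P5 H5]]; specialize (H5 tt).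
cbv beta in *.
set (s := Rmin 1 ((1 - t) / (4 * (C4 + C5 + 1)))).
assert (Hs : 0 < s <= 1 /\ 2 * (C4 + C5) * s <= (1 - t) / 2).
{ assert (0 < (1 - t) / (4 * (C4 + C5 + 1))) by (apply Rdiv_lt_0_compat; lra).
  unfold s; split; [split; [apply Rmin_glb_lt; lra|apply Rmin_l]|].
  apply Rle_trans with (2 * (C4 + C5 + 1) * ((1 - t) / (4 * (C4 + C5 + 1)))).
  - apply Rmult_le_compat; try lra; [left; apply Rmin_glb_lt; lra | apply Rmin_r].
  - right; field; lra. }
destruct Hs as [Hs Hst].
set (t' := (1 + t) / 2).
assert (Ht' : 0 <= t' < 1) by (unfold t'; lra).
assert (N := fun v : E => norm_ge_0 v); assert (NP := fun v : P => norm_ge_0 v).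
assert (D0 : D (zero, p0)).
{ split; simpl; [rewrite norm_zero; lra | rewrite norm_minus_self; lra]. }
assert (HD : forall x p, norm x <= s -> norm (minus p p0) <= s -> D (x, p)).
{ intros; split; simpl; lra. }
assert (HA : forall x p v, norm x <= s -> norm (minus p p0) <= s ->
          norm (dT (x, p) (v, zero)) <= (t + 2 * C4 * s) * norm v).
{ intros x p v Hx Hp.
  replace ((t + 2 * C4 * s) * norm v) with (C4 * (2 * s) * norm v + t * norm v) by ring.
  apply (norm_of_plus _ (minus (dT (x, p) (v, zero)) (dT (zero, p0) (v, zero)))
            (dT (zero, p0) (v, zero))); [module_in E| |apply dT_base].
  eapply Rle_trans; [apply H4; auto|].
  apply Rmult_le_compat; auto using norm_pair_zero, norm_ge_0.
  - apply Rmult_le_pos; auto; apply norm_ge_0.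
  - apply Rmult_le_compat_l; auto.
    eapply Rle_trans; [apply (norm_pair_le (minus x zero) (minus p p0))|].
    replace (norm (minus x zero)) with (norm x) by (f_equal; module_in E); lra. }
assert (HA' : forall x p v, norm x <= s -> norm (minus p p0) <= s ->
          norm (dT (x, p) (v, zero)) <= t' * norm v).
{ intros x p v Hx Hp; eapply Rle_trans; [apply HA; auto|].
  apply Rmult_le_compat_r; auto; unfold t'; nra. }
assert (HT : forall x y p, norm x <= s -> norm y <= s -> norm (minus p p0) <= s ->
          norm (minus (T (y, p)) (T (x, p))) <= t' * norm (minus y x)).
{ intros x y p Hx Hy Hp.
  assert (Hxy : norm (minus y x) <= 2 * s).
  { eapply Rle_trans; [apply norm_triangle|]; rewrite norm_opp; lra. }
  assert (Em : minus ((y, p) : EP) (x, p) = (minus y x, zero)).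
  { change (minus ((y, p) : EP) (x, p)) with (minus y x, minus p p); f_equal; module_in P. }
  assert (H := H5 (x, p) (y, p) (HD _ _ Hx Hp) (HD _ _ Hy Hp)); rewrite Em in H.
  apply Rle_trans with (C5 * norm (minus y x) ^ 2 + (t + 2 * C4 * s) * norm (minus y x)).
  - apply (norm_of_plus _ (minus (minus (T (y, p)) (T (x, p))) (dT (x, p) (minus y x, zero)))
             (dT (x, p) (minus y x, zero))); [module_in E| |apply HA; auto].
    eapply Rle_trans; [exact H|]; apply Rmult_le_compat_l; auto.
    apply pow_incr; split; [apply norm_ge_0|apply norm_pair_zero].
  - assert (H0 := N (minus y x)).
    apply Rle_trans with ((C5 * (2 * s) + (t + 2 * C4 * s)) * norm (minus y x)).
    + rewrite (Rmult_plus_distr_r (C5 * (2 * s))); apply Rplus_le_compat_r.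
      rewrite Rmult_assoc; apply Rmult_le_compat_l; auto; simpl; nra.
    + apply Rmult_le_compat_r; auto; unfold t'; nra. }
set (rho := Rmin s ((1 - t') * s / (C3 + 1))).
assert (Hrho : 0 < rho <= s /\ C3 * rho <= (1 - t') * s).
{ assert (H1 : 0 < (1 - t') * s) by (apply Rmult_lt_0_compat; lra).
  assert (0 < (1 - t') * s / (C3 + 1)) by (apply Rdiv_lt_0_compat; lra).
  unfold rho; split; [split; [apply Rmin_glb_lt; lra|apply Rmin_l]|].
  apply Rle_trans with ((C3 + 1) * ((1 - t') * s / (C3 + 1))).
  - apply Rmult_le_compat; try lra; [left; apply Rmin_glb_lt; lra | apply Rmin_r].
  - right; field; lra. }
destruct Hrho as [Hrho Hrho3].
set (B := fun p : P => norm (minus p p0) <= rho).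
assert (HB : forall p, B p -> norm (minus p p0) <= s) by (unfold B; intros; lra).
assert (Hx : forall p, exists x, B p -> norm x <= s /\ T (x, p) = x /\ Q x).
{ intros p; destruct (Rle_dec (norm (minus p p0)) rho) as [Hp|Hp];
    [|exists zero; intros Hp'; contradiction].
  destruct (contraction_fixed_point E (fun x => T (x, p)) Q s t') as [x Hx]; auto.
  - lra.
  - apply Rle_trans with (C3 * rho); auto.
    assert (H := H3 (zero, p0) (zero, p) D0
       (HD zero p ltac:(rewrite norm_zero; lra) (HB p Hp))).
    apply Rle_trans with (C3 * norm (minus p p0)); [|apply Rmult_le_compat_l; auto].
    eapply Rle_trans; [|eapply Rle_trans; [exact H|]].
    + right; f_equal; transitivity (minus (T (zero, p)) zero);
        [change (T (zero, p) = minus (T (zero, p)) zero); module_in E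
        | f_equal; symmetry; exact T_base].
    + apply Rmult_le_compat_l; auto.
      eapply Rle_trans; [apply (norm_pair_le (minus zero zero) (minus p p0))|].
      rewrite norm_minus_self; lra.
  - exists x; auto. }
set (x := fun p => proj1_sig (constructive_indefinite_description _ (Hx p))).
assert (Hxp : forall p, B p -> norm (x p) <= s /\ T (x p, p) = x p /\ Q (x p)).
{ intros p; exact (proj2_sig (constructive_indefinite_description _ (Hx p))). }
assert (HDx : forall p, B p -> D (x p, p)) by (intros p Hp; apply HD; [apply Hxp|]; auto).
assert (Hy : forall p w, exists y, B p -> dT (x p, p) (y, w) = y).
{ intros p w; destruct (Rle_dec (norm (minus p p0)) rho) as [Hp|Hp];
    [|exists zero; intros Hp'; contradiction].
  set (c := norm (dT (x p, p) (zero, w))).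
  destruct (contraction_fixed_point E (fun y => dT (x p, p) (y, w)) (fun _ => True)
              (c / (1 - t')) t') as [y [_ [Ey _]]]; auto.
  - apply Rmult_le_pos; [apply norm_ge_0|left; apply Rinv_0_lt_compat; lra].
  - intros y y' _ _; rewrite <- dTm by (apply HDx; exact Hp).
    eapply Rle_trans; [|apply HA'; [apply Hxp; exact Hp|apply HB; exact Hp]].
    right; f_equal; f_equal.
    change (minus ((y, w) : EP) (y', w)) with (minus y y', minus w w); f_equal; module_in P.
  - change (norm (dT (x p, p) (zero, w))) with c; right; field; lra.
  - intros l _; exact I.
  - exists y; auto. }
set (dx := fun p w => proj1_sig (constructive_indefinite_description _ (Hy p w))).
assert (Hdx : forall p w, B p -> dT (x p, p) (dx p w, w) = dx p w).
{ intros p w; exact (proj2_sig (constructive_indefinite_description _ (Hy p w))). }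
assert (Huniq : forall p w y, B p -> dT (x p, p) (y, w) = y -> y = dx p w).
{ intros p w y Hp Ey.
  assert (H : norm (minus y (dx p w)) <= t' * norm (minus y (dx p w)) + 0).
  { rewrite Rplus_0_r.
    eapply Rle_trans; [|apply (HA' (x p) p); [apply Hxp; exact Hp|apply HB; exact Hp]].
    right; f_equal; rewrite <- Ey at 1; rewrite <- (Hdx p w Hp) at 1.
    rewrite <- dTm by (apply HDx; exact Hp); f_equal.
    change (minus ((y, w) : EP) (dx p w, w)) with (minus y (dx p w), minus w w).
    f_equal; module_in P. }
  apply absorb in H; [|lra].
  assert (Hz : minus y (dx p w) = zero).
  { apply norm_eq_zero, Rle_antisym; [|apply norm_ge_0].
    eapply Rle_trans; [exact H|]; right; field; lra. }
  transitivity (plus (minus y (dx p w)) (dx p w)); [module_in E|].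
  rewrite Hz; apply plus_zero_l. }
set (M := C2 / (1 - t')).
assert (HM : 0 <= M).
{ apply Rmult_le_pos; [auto|left; apply Rinv_0_lt_compat; lra]. }
assert (HdxM : forall p w, B p -> norm (dx p w) <= M * norm w).
{ intros p w Hp.
  replace (M * norm w) with (C2 * norm w / (1 - t')) by (unfold M; field; lra).
  apply absorb; [lra|].
  apply (norm_of_plus _ (dT (x p, p) (dx p w, zero)) (dT (x p, p) (zero, w))).
  - rewrite <- dTa by (apply HDx; exact Hp); rewrite <- (Hdx p w Hp) at 1; f_equal.
    change (plus ((dx p w, zero) : EP) (zero, w)) with (plus (dx p w) zero, plus zero w).
    f_equal; [module_in E|module_in P].
  - apply HA'; [apply Hxp; exact Hp|apply HB; exact Hp].
  - eapply Rle_trans; [apply H2; apply HDx; exact Hp|]; apply Rmult_le_compat_l; auto.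
    eapply Rle_trans; [apply norm_pair_le|]; rewrite norm_zero; lra. }
set (L := C3 / (1 - t')).
assert (HL : 0 <= L).
{ apply Rmult_le_pos; [auto|left; apply Rinv_0_lt_compat; lra]. }
assert (HxL : forall p q, B p -> B q -> norm (minus (x q) (x p)) <= L * norm (minus q p)).
{ intros p q Hp Hq.
  replace (L * norm (minus q p)) with (C3 * norm (minus q p) / (1 - t')) by (unfold L; field; lra).
  apply absorb; [lra|].
  apply (norm_of_plus _ (minus (T (x q, q)) (T (x p, q))) (minus (T (x p, q)) (T (x p, p)))).
  - rewrite (proj1 (proj2 (Hxp p Hp))), (proj1 (proj2 (Hxp q Hq))); module_in E.
  - apply HT; [apply Hxp; exact Hp|apply Hxp; exact Hq|apply HB; exact Hq].
  - eapply Rle_trans; [apply H3|].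
    + apply HDx; exact Hp.
    + apply HD; [apply Hxp; exact Hp|apply HB; exact Hq].
    + apply Rmult_le_compat_l; auto.
      eapply Rle_trans; [apply (norm_pair_le (minus (x p) (x p)) (minus q p))|].
      rewrite norm_minus_self; lra. }
assert (Hz : forall p q, B p -> B q ->
          norm (minus ((x q, q) : EP) (x p, p)) <= (L + 1) * norm (minus q p)).
{ intros p q Hp Hq.
  eapply Rle_trans; [apply (norm_pair_le (minus (x q) (x p)) (minus q p))|].
  specialize (HxL p q Hp Hq); lra. }
exists rho, x, dx; split; [lra|]; split; [|split].
- split.
  + intros _ p u v Hp; symmetry; apply Huniq; [exact Hp|].
    rewrite <- (Hdx p u Hp) at 2; rewrite <- (Hdx p v Hp) at 2.
    rewrite <- dTa by (apply HDx; exact Hp); reflexivity.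
  + intros _ p c v Hp; symmetry; apply Huniq; [exact Hp|].
    rewrite <- (Hdx p v Hp) at 2.
    rewrite <- dTs by (apply HDx; exact Hp); reflexivity.
  + exists s; split; [lra|]; intros _ p Hp; apply Hxp; exact Hp.
  + exists M; split; auto.
  + exists L; split; auto.
  + exists (C4 * (L + 1) * (M + 1) / (1 - t')); split.
    { apply Rmult_le_pos; [|left; apply Rinv_0_lt_compat; lra].
      repeat apply Rmult_le_pos; lra. }
    intros _ p q w Hp Hq.
    replace (C4 * (L + 1) * (M + 1) / (1 - t') * norm (minus q p) * norm w)
      with (C4 * ((L + 1) * norm (minus q p)) * ((M + 1) * norm w) / (1 - t'))
      by (field; lra).
    apply absorb; [lra|]; rewrite Rplus_comm.
    apply (norm_of_plus _ (minus (dT (x q, q) (dx q w, w)) (dT (x p, p) (dx q w, w)))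
             (dT (x p, p) (minus (dx q w) (dx p w), zero))).
    * transitivity (minus (dT (x q, q) (dx q w, w)) (dT (x p, p) (dx p w, w)));
        [rewrite !Hdx by assumption; reflexivity|].
      transitivity (plus (minus (dT (x q, q) (dx q w, w)) (dT (x p, p) (dx q w, w)))
        (minus (dT (x p, p) (dx q w, w)) (dT (x p, p) (dx p w, w)))); [module_in E|].
      f_equal; rewrite <- dTm by (apply HDx; exact Hp); f_equal.
      change (minus ((dx q w, w) : EP) (dx p w, w))
        with (minus (dx q w) (dx p w), minus w w); f_equal; module_in P.
    * eapply Rle_trans; [apply H4; apply HDx; assumption|].
      apply Rmult_le_compat; try apply norm_ge_0.
      { apply Rmult_le_pos; auto; apply norm_ge_0. }
      { apply Rmult_le_compat_l; auto. }
      { eapply Rle_trans; [apply norm_pair_le|].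
        specialize (HdxM q w Hq); lra. }
    * apply HA'; [apply Hxp; exact Hp|apply HB; exact Hp].
  + exists (C5 * (L + 1) ^ 2 / (1 - t')); split.
    { apply Rmult_le_pos; [|left; apply Rinv_0_lt_compat; lra].
      apply Rmult_le_pos; [auto|apply pow_le; lra]. }
    intros _ p q Hp Hq.
    replace (C5 * (L + 1) ^ 2 / (1 - t') * norm (minus q p) ^ 2)
      with (C5 * ((L + 1) * norm (minus q p)) ^ 2 / (1 - t')) by (field; lra).
    apply absorb; [lra|]; rewrite Rplus_comm.
    set (y := dx p (minus q p)).
    apply (norm_of_plus _
      (minus (minus (T (x q, q)) (T (x p, p))) (dT (x p, p) (minus (x q) (x p), minus q p)))
      (dT (x p, p) (minus (minus (x q) (x p)) y, zero))).
    * rewrite (proj1 (proj2 (Hxp p Hp))), (proj1 (proj2 (Hxp q Hq))).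
      transitivity (minus (minus (x q) (x p)) (dT (x p, p) (y, minus q p)));
        [unfold y; rewrite Hdx by assumption; reflexivity|].
      transitivity (plus (minus (minus (x q) (x p)) (dT (x p, p) (minus (x q) (x p), minus q p)))
        (minus (dT (x p, p) (minus (x q) (x p), minus q p)) (dT (x p, p) (y, minus q p))));
        [module_in E|].
      f_equal; rewrite <- dTm by (apply HDx; exact Hp); f_equal.
      change (minus ((minus (x q) (x p), minus q p) : EP) (y, minus q p))
        with (minus (minus (x q) (x p)) y, minus (minus q p) (minus q p)).
      f_equal; module_in P.
    * eapply Rle_trans; [apply H5; apply HDx; assumption|].
      apply Rmult_le_compat_l; auto; apply pow_incr; split; [apply norm_ge_0|]; auto.
    * apply HA'; [apply Hxp; exact Hp|apply HB; exact Hp].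
- assert (B0 : B p0) by (unfold B; rewrite norm_minus_self; lra).
  destruct (Hxp p0 B0) as [Hx0 [Ex0 _]].
  assert (H : norm (minus (x p0) zero) <= t' * norm (minus (x p0) zero) + 0).
  { rewrite Rplus_0_r.
    apply Rle_trans with (norm (minus (T (x p0, p0)) (T (zero, p0))));
      [right; f_equal; f_equal; symmetry; [exact Ex0 | exact T_base]|].
    apply HT; [apply Rle_trans with 0; [right; exact norm_zero | lra] | exact Hx0 | apply HB, B0]. }
  apply absorb in H; [|lra].
  apply norm_eq_zero, Rle_antisym; [|apply norm_ge_0].
  apply Rle_trans with (norm (minus (x p0) zero)); [right; f_equal; module_in E|].
  eapply Rle_trans; [exact H|]; right; field; lra.
- intros p Hp; destruct (Hxp p Hp) as [H1 H']; split; [lra|exact H'].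
Qed.

End ParametricFixedPoint.

(** * Differentiability in the sense of filters *)

Lemma locally_norm_lt {X : NormedModule R_AbsRing} (x : X) (r : R) :
  0 < r -> locally x (fun y => norm (minus y x) < r).
Proof. intros Hr; exact (locally_ball_norm x (mkposreal r Hr)). Qed.

Lemma locally_norm_small {X : NormedModule R_AbsRing} (x : X) (C : R) (eps : posreal) :
  0 <= C -> locally x (fun y => C * norm (minus y x) <= eps).
Proof.
destruct eps as [eps He]; simpl; intros HC.
assert (Hr : 0 < eps / (C + 1)) by (apply Rdiv_lt_0_compat; lra).
generalize (locally_norm_lt x _ Hr); apply filter_imp; intros y Hy.
apply Rle_trans with ((C + 1) * (eps / (C + 1))); [|right; field; lra].
apply Rmult_le_compat; try lra; apply norm_ge_0.
Qed.

Lemma C11_filterdiff {I : Type} {X Y : NormedModule R_AbsRing} (D : X -> Prop)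
    (F : I -> X -> Y) dF i x :
  C11 D F dF -> locally x D -> filterdiff (F i) (locally x) (dF i x).
Proof.
intros HC HD.
assert (Hx : D x) by exact (locally_singleton x D HD).
split; [split|].
- intros u v; apply (C11_add _ _ _ HC); auto.
- intros c v; apply (C11_hom _ _ _ HC); auto.
- destruct (C11_der _ _ _ HC) as [C [HC0 H]]; exists (C + 1); split; [lra|].
  intros v; eapply Rle_trans; [apply H; auto|].
  apply Rmult_le_compat_r; [apply norm_ge_0|lra].
- intros x' Hx'.
  assert (E := is_filter_lim_locally_unique x x' Hx'); subst x'.
  intros eps; destruct (C11_taylor _ _ _ HC) as [C [HC0 H]].
  generalize (filter_and _ _ HD (locally_norm_small x C eps HC0)); apply filter_imp.
  intros y [Hy Hy']; eapply Rle_trans; [apply H; auto|].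
  simpl; rewrite Rmult_1_r, <- Rmult_assoc; apply Rmult_le_compat_r; auto; apply norm_ge_0.
Qed.

Lemma C11_C1_on {X Y : NormedModule R_AbsRing} (U D : X -> Prop) (f : X -> Y) df :
  C11 (I := unit) D (fun _ => f) (fun _ => df) ->
  (forall x, U x -> locally x D) -> C1_on U f.
Proof.
intros HC HU; exists df; split.
- intros x Hx; exact (C11_filterdiff D _ _ tt x HC (HU x Hx)).
- intros x Hx eps; destruct (C11_der_lip _ _ _ HC) as [C [HC0 H]].
  assert (Dx := locally_singleton x D (HU x Hx)).
  generalize (filter_and _ _ (HU x Hx) (locally_norm_small x C eps HC0)); apply filter_imp.
  intros y [Hy Hy'] v; eapply Rle_trans; [apply (H tt); auto|].
  apply Rmult_le_compat_r; auto; apply norm_ge_0.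
Qed.

(** * Families of functions on the line *)

Section Lift.

Context {W : NormedModule R_AbsRing}.

Definition admissible (f : R -> W) : Prop :=
  (forall xi, continuous f xi) /\ exists M, forall xi, norm (f xi) <= M.

(** A total function, so that maps into [Cb] are written without proofs of
    boundedness and continuity. *)
Definition toCb (f : R -> W) : @Cb_NormedModule W :=
  match excluded_middle_informative (admissible f) with
  | left H => mkCb f (proj1 H) (proj2 H)
  | right _ => zero
  end.

Lemma toCb_eq f : admissible f -> forall xi, toCb f xi = f xi.
Proof.
intros H xi; unfold toCb.
destruct (excluded_middle_informative (admissible f)); [reflexivity|contradiction].
Qed.

Context {Z : NormedModule R_AbsRing} (D : Z -> Prop) (F : R -> Z -> W) (dF : R -> Z -> Z -> W).
Hypothesis HF : C11 D F dF.
Hypothesis F_cont : forall z xi, D z -> continuous (fun x => F x z) xi.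
Hypothesis dF_cont : forall z v xi, D z -> continuous (fun x => dF x z v) xi.

Lemma family_admissible z : D z -> admissible (fun x => F x z).
Proof.
intros Hz; split; [intros; now apply F_cont|].
destruct (C11_val _ _ _ HF) as [C [_ H]]; exists C; intros; now apply H.
Qed.

Lemma family_der_admissible z v : D z -> admissible (fun x => dF x z v).
Proof.
intros Hz; split; [intros; now apply dF_cont|].
destruct (C11_der _ _ _ HF) as [C [_ H]]; exists (C * norm v); intros; now apply H.
Qed.

(** The constants are uniform in the index, so nothing is lost in passing to the
    supremum. *)
Lemma C11_lift :
  C11 (I := unit) D (fun _ z => toCb (fun x => F x z)) (fun _ z v => toCb (fun x => dF x z v)).
Proof.
assert (A := family_admissible); assert (B := family_der_admissible).
split.
- intros _ z u v Hz; apply Cb_ext; intros xi.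
  change (toCb (fun x => dF x z (plus u v)) xi =
    plus (toCb (fun x => dF x z u) xi) (toCb (fun x => dF x z v) xi)).
  rewrite !toCb_eq by auto; apply (C11_add _ _ _ HF); auto.
- intros _ z c v Hz; apply Cb_ext; intros xi.
  change (toCb (fun x => dF x z (scal c v)) xi = scal c (toCb (fun x => dF x z v) xi)).
  rewrite !toCb_eq by auto; apply (C11_hom _ _ _ HF); auto.
- destruct (C11_val _ _ _ HF) as [C [HC H]]; exists C; split; auto; intros.
  apply Cb_norm_le; intros xi; rewrite toCb_eq by auto; auto.
- destruct (C11_der _ _ _ HF) as [C [HC H]]; exists C; split; auto; intros.
  apply Cb_norm_le; intros xi; rewrite toCb_eq by auto; auto.
- destruct (C11_lip _ _ _ HF) as [C [HC H]]; exists C; split; auto; intros _ z z' Hz Hz'.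
  apply Cb_norm_le; intros xi.
  change (norm (minus (toCb (fun x => F x z') xi) (toCb (fun x => F x z) xi))
            <= C * norm (minus z' z)).
  rewrite !toCb_eq by auto; auto.
- destruct (C11_der_lip _ _ _ HF) as [C [HC H]]; exists C; split; auto; intros _ z z' v Hz Hz'.
  apply Cb_norm_le; intros xi.
  change (norm (minus (toCb (fun x => dF x z' v) xi) (toCb (fun x => dF x z v) xi))
            <= C * norm (minus z' z) * norm v).
  rewrite !toCb_eq by auto; auto.
- destruct (C11_taylor _ _ _ HF) as [C [HC H]]; exists C; split; auto; intros _ z z' Hz Hz'.
  apply Cb_norm_le; intros xi.
  change (norm (minus (minus (toCb (fun x => F x z') xi) (toCb (fun x => F x z) xi))
                  (toCb (fun x => dF x z (minus z' z)) xi)) <= C * norm (minus z' z) ^ 2).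
  rewrite !toCb_eq by auto; auto.
Qed.

End Lift.

Definition has_limits (f : R -> R) : Prop :=
  (exists l : R, is_lim f p_infty l) /\ (exists l : R, is_lim f m_infty l).

Definition regular (f : R -> R) : Prop := admissible (W := R_NormedModule) f.

Lemma regular_const c : regular (fun _ => c).
Proof.
split; [intros; apply continuous_const|].
exists (Rabs c); intros; apply Rle_refl.
Qed.

(** The linear operators used below are integral operators on the line; besides
    boundedness they preserve the existence of limits at infinity. *)
Record bounded_op (A : (R -> R) -> R -> R) : Prop := {
  op_plus : forall f g, regular f -> regular g ->
    forall xi, A (fun x => f x + g x) xi = A f xi + A g xi;
  op_scal : forall c f, regular f -> forall xi, A (fun x => c * f x) xi = c * A f xi;
  op_bound : exists C, 0 <= C /\ forall f M, regular f -> (forall xi, Rabs (f xi) <= M) ->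
    forall xi, Rabs (A f xi) <= C * M;
  op_cont : forall f, regular f -> forall xi, continuous (A f) xi;
  op_lim : forall f, regular f -> has_limits f -> has_limits (A f) }.

Lemma op_regular A f : bounded_op A -> regular f -> regular (A f).
Proof.
intros HA Hf; split; [apply (op_cont _ HA _ Hf)|].
destruct (op_bound _ HA) as [C [_ H]]; destruct (proj2 Hf) as [M HM].
exists (C * M); apply H; auto.
Qed.

Lemma bounded_op_comp A B : bounded_op A -> bounded_op B -> bounded_op (fun f => A (B f)).
Proof.
intros HA HB; split.
- intros f g Hf Hg xi; rewrite <- (op_plus _ HA) by (apply op_regular; auto).
  f_equal; apply functional_extensionality; intros x; apply (op_plus _ HB); auto.
- intros c f Hf xi; rewrite <- (op_scal _ HA) by (apply op_regular; auto).
  f_equal; apply functional_extensionality; intros x; apply (op_scal _ HB); auto.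
- destruct (op_bound _ HA) as [C [HC H]]; destruct (op_bound _ HB) as [C' [HC' H']].
  exists (C * C'); split; [now apply Rmult_le_pos|]; intros f M Hf HM xi.
  rewrite Rmult_assoc; apply H; [apply op_regular; auto|]; apply H'; auto.
- intros f Hf; apply (op_cont _ HA); apply op_regular; auto.
- intros f Hf Hl; apply (op_lim _ HA); [apply op_regular; auto|]; apply (op_lim _ HB); auto.
Qed.

Lemma has_limits_mult f g : has_limits f -> has_limits g -> has_limits (fun x => f x * g x).
Proof.
intros [[a Ha] [b Hb]] [[c Hc] [d Hd]]; split.
- exists (a * c); now apply (is_lim_mult f g p_infty a c).
- exists (b * d); now apply (is_lim_mult f g m_infty b d).
Qed.

Lemma has_limits_plus f g : has_limits f -> has_limits g -> has_limits (fun x => f x + g x).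
Proof.
intros [[a Ha] [b Hb]] [[c Hc] [d Hd]]; split.
- exists (a + c); now apply (is_lim_plus' f g p_infty a c).
- exists (b + d); now apply (is_lim_plus' f g m_infty b d).
Qed.

Lemma has_limits_const c : has_limits (fun _ => c).
Proof. split; exists c; apply is_lim_const. Qed.

Lemma bounded_op_mul c : regular c -> has_limits c -> bounded_op (fun f x => c x * f x).
Proof.
intros Hc Hl; split.
- intros; ring.
- intros; ring.
- destruct Hc as [_ [C HC]]; exists (Rabs C); split; [apply Rabs_pos|].
  intros f M Hf HM xi; apply Rabs_mult_le; auto.
  eapply Rle_trans; [exact (HC xi)|apply Rle_abs].
- intros f Hf xi; apply (continuous_mult c f); [apply (proj1 Hc)|apply (proj1 Hf)].
- intros f Hf Hlf; now apply has_limits_mult.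
Qed.

(** [Q] is meant for the arguments that have limits at infinity: it propagates
    this property through nonlinear expressions. *)
Record smooth_family {Z : NormedModule R_AbsRing} (D Q : Z -> Prop)
    (F : R -> Z -> R) (dF : R -> Z -> Z -> R) : Prop := {
  sf_C11 : C11 (Y := R_NormedModule) D F dF;
  sf_cont : forall z xi, D z -> continuous (fun x => F x z) xi;
  sf_dcont : forall z v xi, D z -> continuous (fun x => dF x z v) xi;
  sf_lim : forall z, D z -> Q z -> has_limits (fun x => F x z) }.

Section SmoothFamilies.

Context {Z : NormedModule R_AbsRing} (D Q : Z -> Prop).

Lemma sf_regular F dF z : smooth_family D Q F dF -> D z -> regular (fun x => F x z).
Proof.
intros [H1 H2 _ _] Hz; exact (family_admissible (W := R_NormedModule) D F dF H1 H2 z Hz).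
Qed.

Lemma sf_der_regular F dF z v : smooth_family D Q F dF -> D z -> regular (fun x => dF x z v).
Proof.
intros [H1 _ H2 _] Hz; exact (family_der_admissible (W := R_NormedModule) D F dF H1 H2 z v Hz).
Qed.

Lemma sf_ext F dF dF' : smooth_family D Q F dF ->
  (forall x z v, dF' x z v = dF x z v) -> smooth_family D Q F dF'.
Proof.
intros H E; replace dF' with dF; [exact H|].
do 3 (apply functional_extensionality; intros); symmetry; apply E.
Qed.

Lemma sf_const (c : R -> R) : regular c -> has_limits c ->
  smooth_family D Q (fun x _ => c x) (fun _ _ _ => 0).
Proof.
intros [H1 [M H2]] Hl; split; auto.
- exact (C11_const (Y := R_NormedModule) D c (ex_intro _ M H2)).
- intros; apply continuous_const.
Qed.

Lemma sf_plus F G dF dG : smooth_family D Q F dF -> smooth_family D Q G dG ->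
  smooth_family D Q (fun x z => F x z + G x z) (fun x z v => dF x z v + dG x z v).
Proof.
intros [F1 F2 F3 F4] [G1 G2 G3 G4]; split.
- exact (C11_plus (Y := R_NormedModule) D F G dF dG F1 G1).
- intros z xi Hz; exact (continuous_plus (V := R_NormedModule) _ _ _ (F2 z xi Hz) (G2 z xi Hz)).
- intros z v xi Hz;
    exact (continuous_plus (V := R_NormedModule) _ _ _ (F3 z v xi Hz) (G3 z v xi Hz)).
- intros; apply has_limits_plus; auto.
Qed.

Lemma sf_mult F G dF dG : smooth_family D Q F dF -> smooth_family D Q G dG ->
  smooth_family D Q (fun x z => F x z * G x z) (fun x z v => dF x z v * G x z + F x z * dG x z v).
Proof.
intros [F1 F2 F3 F4] [G1 G2 G3 G4]; split.
- now apply C11_mult.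
- intros z xi Hz; exact (continuous_mult (K := R_AbsRing) _ _ _ (F2 z xi Hz) (G2 z xi Hz)).
- intros z v xi Hz; apply (continuous_plus (V := R_NormedModule)).
  + exact (continuous_mult (K := R_AbsRing) _ _ _ (F3 z v xi Hz) (G2 z xi Hz)).
  + exact (continuous_mult (K := R_AbsRing) _ _ _ (F2 z xi Hz) (G3 z v xi Hz)).
- intros; apply has_limits_mult; auto.
Qed.

Lemma sf_opp F dF : smooth_family D Q F dF ->
  smooth_family D Q (fun x z => - F x z) (fun x z v => - dF x z v).
Proof.
intros H.
assert (H' := sf_mult (fun _ _ => -1) F _ _
  (sf_const (fun _ => -1) (regular_const _) (has_limits_const _)) H).
replace (fun x z => - F x z) with (fun x z => -1 * F x z)
  by (do 2 (apply functional_extensionality; intros); ring).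
apply (sf_ext _ _ _ H'); intros; ring.
Qed.

Lemma sf_minus F G dF dG : smooth_family D Q F dF -> smooth_family D Q G dG ->
  smooth_family D Q (fun x z => F x z - G x z) (fun x z v => dF x z v - dG x z v).
Proof. intros HF HG; exact (sf_plus _ _ _ _ HF (sf_opp _ _ HG)). Qed.

(** The set [J] is closed because the limits at infinity have to stay in the
    domain of [g]. *)
Lemma sf_real (J : R -> Prop) (g g1 g2 : R -> R) (K : R) F dF :
  (forall x y z, J x -> J y -> x <= z <= y -> J z) ->
  closed J ->
  (forall x, J x -> is_derive g x (g1 x)) ->
  (forall x, J x -> is_derive g1 x (g2 x)) ->
  (forall x, J x -> Rabs (g x) <= K /\ Rabs (g1 x) <= K /\ Rabs (g2 x) <= K) ->
  (forall x z, D z -> J (F x z)) ->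
  smooth_family D Q F dF ->
  smooth_family D Q (fun x z => g (F x z)) (fun x z v => g1 (F x z) * dF x z v).
Proof.
intros HJ Jcl Hg Hg1 HK HF [F1 F2 F3 F4].
assert (cg : forall x, J x -> continuous g x).
{ intros x Hx; apply (ex_derive_continuous g); eexists; now apply Hg. }
assert (cg1 : forall x, J x -> continuous g1 x).
{ intros x Hx; apply (ex_derive_continuous g1); eexists; now apply Hg1. }
split.
- exact (C11_comp D J (fun _ => g) _ F dF (C11_real J g g1 g2 K HJ Hg Hg1 HK) F1 HF).
- intros z xi Hz; apply (continuous_comp (fun x => F x z) g); auto.
- intros z v xi Hz; apply (continuous_mult (K := R_AbsRing) (fun x => g1 (F x z))); [|auto].
  apply (continuous_comp (fun x => F x z) g1); auto.
- intros z Hz Hq; destruct (F4 z Hz Hq) as [[a Ha] [b Hb]].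
  assert (Ja : J a).
  { exact (closed_filterlim (F := Rbar_locally p_infty) (fun x => F x z) J a Ha
      (fun x => HF x z Hz) Jcl). }
  assert (Jb : J b).
  { exact (closed_filterlim (F := Rbar_locally m_infty) (fun x => F x z) J b Hb
      (fun x => HF x z Hz) Jcl). }
  split; [exists (g a)|exists (g b)]; apply is_lim_comp_continuous; auto.
Qed.

(** A linear operator commutes with increments, so each constant is multiplied by
    the norm of [A]. *)
Lemma sf_op A F dF : bounded_op A -> smooth_family D Q F dF ->
  smooth_family D Q (fun x z => A (fun y => F y z) x) (fun x z v => A (fun y => dF y z v) x).
Proof.
intros HA HF.
assert (A1 := fun z => sf_regular F dF z HF).
assert (A2 := fun z v => sf_der_regular F dF z v HF).
assert (Gs : forall c f, regular f -> regular (fun x => c * f x)).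
{ intros c f Hf; apply (op_regular (fun f x => c * f x)); auto; apply (bounded_op_mul (fun _ => c)).
  - apply regular_const.
  - apply has_limits_const. }
assert (Gm : forall f g, regular f -> regular g -> regular (fun x => f x - g x)).
{ intros f g [Hf [M HM]] [Hg [M' HM']]; split.
  - intros xi; apply (continuous_minus (V := R_NormedModule) f g); auto.
  - exists (M + M'); intros xi.
    apply (Rabs_plus_le (f xi) (- g xi)); [apply HM|rewrite Rabs_Ropp; apply HM']. }
assert (Am : forall f g, regular f -> regular g -> forall xi,
               A (fun x => f x - g x) xi = A f xi - A g xi).
{ intros f g Hf Hg xi.
  replace (fun x => f x - g x) with (fun x => f x + -1 * g x)
    by (apply functional_extensionality; intros; ring).
  rewrite (op_plus _ HA), (op_scal _ HA) by auto; ring. }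
destruct (op_bound _ HA) as [K [HK Hb]].
destruct HF as [F1 F2 F3 F4].
split.
- split; change (@norm R_AbsRing R_NormedModule) with Rabs;
  change (@plus R_NormedModule) with Rplus;
  change (@minus R_NormedModule) with Rminus.
  + intros i z u v Hz; rewrite <- (op_plus _ HA) by auto; f_equal.
    apply functional_extensionality; intros x; apply (C11_add _ _ _ F1); auto.
  + intros i z c v Hz.
    change (A (fun y => dF y z (scal c v)) i = c * A (fun y => dF y z v) i).
    rewrite <- (op_scal _ HA) by auto; f_equal.
    apply functional_extensionality; intros x; apply (C11_hom _ _ _ F1); auto.
  + destruct (C11_val _ _ _ F1) as [C [HC H]]; exists (K * C); split; [now apply Rmult_le_pos|].
    intros i z Hz; apply Hb; auto; intros; now apply H.
  + destruct (C11_der _ _ _ F1) as [C [HC H]]; exists (K * C); split; [now apply Rmult_le_pos|].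
    intros i z v Hz; rewrite Rmult_assoc; apply Hb; auto; intros; now apply H.
  + destruct (C11_lip _ _ _ F1) as [C [HC H]]; exists (K * C); split; [now apply Rmult_le_pos|].
    intros i z z' Hz Hz'; rewrite Rmult_assoc, <- Am by auto; apply Hb; auto;
    intros; now apply H.
  + destruct (C11_der_lip _ _ _ F1) as [C [HC H]]; exists (K * C); split; [now apply Rmult_le_pos|].
    intros i z z' v Hz Hz'; rewrite !Rmult_assoc, <- Am by auto; apply Hb; auto;
    intros; rewrite <- Rmult_assoc; now apply H.
  + destruct (C11_taylor _ _ _ F1) as [C [HC H]]; exists (K * C); split; [now apply Rmult_le_pos|].
    intros i z z' Hz Hz'; rewrite Rmult_assoc, <- Am by auto.
    rewrite <- Am by auto; apply Hb; auto;
    intros; now apply H.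
- intros z xi Hz; apply (op_cont _ HA (fun y => F y z)); auto.
- intros z v xi Hz; apply (op_cont _ HA (fun y => dF y z v)); auto.
- intros z Hz Hq; apply (op_lim _ HA (fun y => F y z)); auto.
Qed.

End SmoothFamilies.

(** * Scalar linear equations on the line *)

Lemma incr_of_derive (f f' : R -> R) (x y : R) :
  (forall z, x <= z <= y -> is_derive f z (f' z)) ->
  (forall z, x <= z <= y -> 0 <= f' z) -> x <= y -> f x <= f y.
Proof.
intros Hf Hp Hxy.
destruct (MVT_gen f x y f') as [c [Hc E]].
- intros z; rewrite Rmin_left, Rmax_right by assumption; intros; apply Hf; lra.
- intros z; rewrite Rmin_left, Rmax_right by assumption; intros Hz.
  apply continuity_pt_filterlim, (ex_derive_continuous f); eexists; apply Hf; lra.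
- rewrite Rmin_left, Rmax_right in Hc by assumption.
  assert (0 <= f' c * (y - x)) by (apply Rmult_le_pos; [auto|lra]); lra.
Qed.

Lemma const_of_derive (f : R -> R) :
  (forall z, is_derive f z 0) -> forall x y, f x = f y.
Proof.
intros Hf.
assert (H : forall x y, x <= y -> f x = f y).
{ intros x y Hxy; apply Rle_antisym.
  - apply incr_of_derive with (fun _ => 0); auto; intros; lra.
  - assert (- f x <= - f y); [|lra].
    apply (incr_of_derive (fun t => - f t) (fun _ => 0)); auto; [|intros; lra].
    intros z _; rewrite <- Ropp_0; apply (is_derive_opp f z 0 (Hf z)). }
intros x y; destruct (Rle_dec x y); [auto|symmetry; apply H; lra].
Qed.

Lemma increment_le (F G f g : R -> R) (M x y : R) :
  (forall t, is_derive F t (f t)) -> (forall t, is_derive G t (g t)) ->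
  (forall t, Rabs (f t) <= M * g t) -> x <= y -> Rabs (F y - F x) <= M * (G y - G x).
Proof.
intros HF HG H Hxy; assert (B := fun t => proj1 (Rabs_le_between _ _) (H t)).
assert (H1 : M * G x - F x <= M * G y - F y).
{ apply (incr_of_derive (fun t => M * G t - F t) (fun t => M * g t - f t)); auto.
  - intros t _; apply (is_derive_minus (fun t => M * G t) F); [apply (is_derive_scal G t M)|]; auto.
  - intros t _; specialize (B t); lra. }
assert (H2 : M * G x + F x <= M * G y + F y).
{ apply (incr_of_derive (fun t => M * G t + F t) (fun t => M * g t + f t)); auto.
  - intros t _; apply (is_derive_plus (fun t => M * G t) F); [apply (is_derive_scal G t M)|]; auto.
  - intros t _; specialize (B t); lra. }
apply Rabs_le; lra.
Qed.

Lemma is_derive_eq (f : R -> R) x l l' : is_derive f x l -> @eq R l l' -> is_derive f x l'.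
Proof. intros H <-; exact H. Qed.

Lemma is_lim_reflect (f : R -> R) (l : R) :
  is_lim f m_infty l <-> is_lim (fun x => f (- x)) p_infty l.
Proof.
split; intros H; apply is_lim_spec; intros eps;
  apply is_lim_spec in H; destruct (H eps) as [M HM]; exists (- M); intros x Hx.
- apply HM; lra.
- rewrite <- (Ropp_involutive x); apply HM; lra.
Qed.

Lemma is_lim_reflect' (f : R -> R) (l : R) :
  is_lim f p_infty l -> is_lim (fun x => f (- x)) m_infty l.
Proof.
intros H; apply is_lim_reflect.
apply (is_lim_ext f); [intros; now rewrite Ropp_involutive|exact H].
Qed.

(** Far out the homogeneous part dominates: the exponentially weighted excess
    of [(y - l)^2] over a small square is monotone. *)
Lemma ode_limit (y A g : R -> R) (M Ai gi : R) :
  (forall x, is_derive y x (A x * y x + g x)) ->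
  (forall x, Rabs (y x) <= M) ->
  is_lim A p_infty Ai -> Ai <> 0 -> is_lim g p_infty gi ->
  is_lim y p_infty (- gi / Ai).
Proof.
intros Hy HM HA HA0 Hg.
set (l := - gi / Ai); set (z := fun x => y x - l).
set (e := fun x => g x + A x * l).
assert (Hz : forall x, is_derive z x (A x * z x + e x)).
{ intros x; unfold z, e.
  apply is_derive_eq with (A x * y x + g x - 0); [|ring].
  apply (is_derive_minus y (fun _ => l)); [apply Hy|apply (is_derive_const l)]. }
assert (He : is_lim e p_infty 0).
{ replace (Finite 0) with (Finite (gi + Ai * l)) by (f_equal; unfold l; field; auto).
  apply is_lim_plus'; [exact Hg|].
  apply (is_lim_mult A (fun _ => l) p_infty Ai l); [exact HA|apply is_lim_const|exact I]. }
set (B := M + Rabs l).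
assert (HB : forall x, Rabs (z x) <= B).
{ intros x; unfold z, Rminus; apply Rabs_plus_le; [apply HM|rewrite Rabs_Ropp; lra]. }
assert (HB2 : forall x, z x ^ 2 <= B ^ 2).
{ intros x; rewrite <- (pow2_abs (z x)); apply pow_incr; split; [apply Rabs_pos|apply HB]. }
set (c := Rabs Ai / 2).
assert (Hc : 0 < c) by (unfold c; generalize (Rabs_pos_lt Ai HA0); lra).
assert (Hev : forall d, 0 < d -> exists x1, forall x, x1 <= x ->
           Rabs (A x - Ai) <= c /\ Rabs (e x) <= d * c).
{ intros d Hd.
  apply is_lim_spec in HA; apply is_lim_spec in He.
  destruct (HA (mkposreal c Hc)) as [X1 H1].
  destruct (He (mkposreal (d * c) (Rmult_lt_0_compat _ _ Hd Hc))) as [X2 H2].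
  exists (Rmax X1 X2 + 1); intros x Hx.
  assert (X1 < x) by (generalize (Rmax_l X1 X2); lra).
  assert (X2 < x) by (generalize (Rmax_r X1 X2); lra).
  specialize (H1 x H); specialize (H2 x H0); simpl in H1, H2.
  rewrite Rminus_0_r in H2; lra. }
assert (Hkey : forall d, 0 < d -> exists X, forall x, X <= x -> z x ^ 2 <= 2 * d ^ 2).
{ intros d Hd; destruct (Hev d Hd) as [x1 H1].
  assert (Hquad : forall x, x1 <= x -> Rabs (2 * z x * e x) <= c * (z x ^ 2 + d ^ 2)).
  { intros x Hx; destruct (H1 x Hx) as [_ H2].
    rewrite Rabs_mult, (Rabs_mult 2), (Rabs_pos_eq 2) by lra.
    rewrite <- (pow2_abs (z x)); assert (H3 := Rabs_pos (z x)).
    apply Rle_trans with (2 * Rabs (z x) * (d * c)).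
    - apply Rmult_le_compat_l; [lra|exact H2].
    - assert (0 <= c * (Rabs (z x) - d) ^ 2) by (apply Rmult_le_pos; [lra|apply pow2_ge_0]); nra. }
  assert (Hder : forall s x, is_derive (fun x => (z x ^ 2 - d ^ 2) * exp (s * (x - x1))) x
             ((2 * z x * (A x * z x + e x) + s * (z x ^ 2 - d ^ 2)) * exp (s * (x - x1)))).
  { intros s x; auto_derive; [repeat split; exists (A x * z x + e x); apply Hz|].
    replace (Derive (fun x0 => z x0) x) with (A x * z x + e x)
      by (symmetry; apply is_derive_unique, Hz).
    unfold Rminus; ring. }
  destruct (Rle_dec Ai 0) as [HAi|HAi].
  - (* the coefficient is negative: the excess decays exponentially *)
    set (u := fun x => (z x ^ 2 - d ^ 2) * exp (c * (x - x1))).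
    assert (Hu : forall x, x1 <= x -> u x <= B ^ 2).
    { intros x Hx; apply Rle_trans with (u x1).
      - assert (- u x1 <= - u x); [|lra].
        apply (incr_of_derive (fun t => - u t)
          (fun x => - ((2 * z x * (A x * z x + e x) + c * (z x ^ 2 - d ^ 2)) * exp (c * (x - x1)))));
          [| |exact Hx].
        + intros t _; apply (is_derive_opp u); apply Hder.
        + intros t Ht; rewrite Ropp_mult_distr_l; apply Rmult_le_pos; [|left; apply exp_pos].
          destruct (H1 t ltac:(lra)) as [H2 _]; specialize (Hquad t ltac:(lra)).
          apply Rabs_le_between in Hquad; apply Rabs_le_between in H2.
          assert (Ac : A t <= - c) by (unfold c in *; rewrite Rabs_left1 in * by lra; lra).
          assert (0 <= z t ^ 2) by apply pow2_ge_0; nra.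
      - unfold u; rewrite Rminus_diag, Rmult_0_r, exp_0, Rmult_1_r.
        specialize (HB2 x1); assert (0 <= d ^ 2) by apply pow2_ge_0; lra. }
    exists (Rmax x1 (x1 + B ^ 2 / (c * d ^ 2))); intros x Hx.
    assert (Hx1 : x1 <= x) by (eapply Rle_trans; [apply Rmax_l|exact Hx]).
    assert (Hx2 : B ^ 2 / (c * d ^ 2) <= x - x1)
      by (generalize (Rmax_r x1 (x1 + B ^ 2 / (c * d ^ 2))); lra).
    specialize (Hu x Hx1); unfold u in Hu.
    destruct (Rle_dec (z x ^ 2) (d ^ 2)) as [Hs|Hs]; [assert (0 <= d ^ 2) by apply pow2_ge_0; lra|].
    assert (Hd2 : 0 < d ^ 2) by nra.
    assert (Hex : c * (x - x1) <= exp (c * (x - x1))).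
    { apply Rle_trans with (1 + c * (x - x1)); [lra|]; apply exp_ineq1_le. }
    assert (Hcx : B ^ 2 <= d ^ 2 * (c * (x - x1))).
    { apply Rmult_le_compat_r with (r := c * d ^ 2) in Hx2; [|apply Rmult_le_pos; lra].
      replace (B ^ 2 / (c * d ^ 2) * (c * d ^ 2)) with (B ^ 2) in Hx2 by (field; lra).
      nra. }
    assert (H2 : (z x ^ 2 - d ^ 2) * exp (c * (x - x1)) <= d ^ 2 * exp (c * (x - x1))).
    { eapply Rle_trans; [exact Hu|]; eapply Rle_trans; [exact Hcx|].
      apply Rmult_le_compat_l; lra. }
    apply Rmult_le_reg_r in H2; [lra|apply exp_pos].
  - (* the coefficient is positive: a positive excess would grow without bound *)
    exists x1; intros x Hx.
    set (u := fun x => (z x ^ 2 - d ^ 2) * exp (- c * (x - x1))).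
    assert (Hu : forall t, x <= t -> u x <= u t).
    { intros t Ht; apply (incr_of_derive u _ x t (fun s _ => Hder (- c) s)); auto.
      intros s Hs; apply Rmult_le_pos; [|left; apply exp_pos].
      destruct (H1 s ltac:(lra)) as [H2 _]; specialize (Hquad s ltac:(lra)).
      apply Rabs_le_between in Hquad; apply Rabs_le_between in H2.
      assert (Ac : c <= A s) by (unfold c in *; rewrite Rabs_pos_eq in * by lra; lra).
      assert (0 <= z s ^ 2) by apply pow2_ge_0; nra. }
    assert (Hd2 : 0 < d ^ 2) by nra.
    apply Rle_trans with (d ^ 2); [|lra].
    apply Rnot_lt_le; intros Hlt.
    assert (Hp : 0 < u x) by (apply Rmult_lt_0_compat; [lra|apply exp_pos]).
    set (t := Rmax x (x1 + (B ^ 2 + 1) / (c * u x))).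
    assert (Ht1 : x <= t) by apply Rmax_l.
    assert (Ht2 : (B ^ 2 + 1) / (c * u x) <= t - x1)
      by (generalize (Rmax_r x (x1 + (B ^ 2 + 1) / (c * u x))); unfold t; lra).
    specialize (Hu t Ht1).
    assert (Hex : c * (t - x1) <= exp (c * (t - x1))).
    { apply Rle_trans with (1 + c * (t - x1)); [lra|]; apply exp_ineq1_le. }
    assert (Hcu : 0 < c * u x) by (apply Rmult_lt_0_compat; assumption).
    apply Rmult_le_compat_r with (r := c * u x) in Ht2; [|lra].
    replace ((B ^ 2 + 1) / (c * u x) * (c * u x)) with (B ^ 2 + 1) in Ht2 by (field; lra).
    assert (H3 : u t * exp (c * (t - x1)) <= B ^ 2).
    { unfold u; rewrite Rmult_assoc, <- exp_plus.
      replace (- c * (t - x1) + c * (t - x1)) with 0 by ring; rewrite exp_0, Rmult_1_r.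
      specialize (HB2 t); lra. }
    assert (H4 : u x * (c * (t - x1)) <= u t * exp (c * (t - x1))).
    { apply Rmult_le_compat; try lra; apply Rmult_le_pos; [lra|]; unfold t in *; lra. }
    lra. }
apply is_lim_spec; intros [d Hd]; simpl.
destruct (Hkey (d / 2)) as [X HX]; [lra|].
exists X; intros x Hx; specialize (HX x ltac:(lra)); fold l.
change (Rabs (z x) < d).
destruct (Rlt_dec (Rabs (z x)) d) as [|Hn]; [assumption|exfalso].
rewrite <- (pow2_abs (z x)) in HX.
assert (d ^ 2 <= Rabs (z x) ^ 2) by (apply pow_incr; lra).
nra.
Qed.

(** Reflection exchanges the two ends and the sign of the coefficient, and
    [ode_limit] allows both signs. *)
Lemma ode_has_limits (y A g : R -> R) (Ap Am : R) :
  (forall x, is_derive y x (A x * y x + g x)) ->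
  (exists M, forall x, Rabs (y x) <= M) ->
  is_lim A p_infty Ap -> Ap <> 0 -> is_lim A m_infty Am -> Am <> 0 ->
  has_limits g -> has_limits y.
Proof.
intros Hy [M HM] HAp HAp0 HAm HAm0 [[gp Hgp] [gm Hgm]]; split.
- exists (- gp / Ap); now apply (ode_limit y A g M).
- exists (- (- gm) / - Am); apply is_lim_reflect.
  apply (ode_limit (fun x => y (- x)) (fun x => - A (- x)) (fun x => - g (- x)) M).
  + intros x; apply is_derive_eq with (- (A (- x) * y (- x) + g (- x))); [|ring].
    apply is_derive_eq with (-1 * (A (- x) * y (- x) + g (- x))); [|ring].
    apply (is_derive_comp y (fun x => - x)); [apply Hy|].
    auto_derive; [exact I|ring].
  + intros; apply HM.
  + apply (is_lim_opp (fun x => A (- x)) p_infty Am); now apply is_lim_reflect.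
  + lra.
  + apply (is_lim_opp (fun x => g (- x)) p_infty gm); now apply is_lim_reflect.
Qed.

Lemma regular_plus f g : regular f -> regular g -> regular (fun x => f x + g x).
Proof.
intros [Hf [M HM]] [Hg [M' HM']]; split.
- intros xi; apply (continuous_plus (V := R_NormedModule) f g); auto.
- exists (M + M'); intros xi; apply Rabs_plus_le; [apply HM|apply HM'].
Qed.

Lemma regular_mult f g : regular f -> regular g -> regular (fun x => f x * g x).
Proof.
intros [Hf [M HM]] [Hg [M' HM']]; split.
- intros xi; apply (continuous_mult (K := R_AbsRing) f g); auto.
- exists (M * M'); intros xi; apply Rabs_mult_le; [apply HM|apply HM'].
Qed.

Lemma regular_scal c f : regular f -> regular (fun x => c * f x).
Proof. intros; apply regular_mult; auto using regular_const. Qed.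

Lemma regular_reflect f : regular f -> regular (fun x => f (- x)).
Proof.
intros [Hf [M HM]]; split; [|exists M; auto].
intros xi; apply (continuous_comp Ropp f); [|apply Hf].
apply (continuous_opp (V := R_NormedModule) (fun x => x)), continuous_id.
Qed.

Lemma regular_bound f : regular f -> exists M, forall x, Rabs (f x) <= M.
Proof. intros [_ [M HM]]; exists M; exact HM. Qed.

(** * Integrals up to infinity *)

Lemma is_lim_ge (f : R -> R) (l x : R) :
  is_lim f p_infty l -> (forall y, x <= y -> f y <= f x) -> l <= f x.
Proof.
intros Hl H.
assert (K := is_lim_le_loc f (fun _ => f x) p_infty l (f x)).
apply K; [|exact Hl|apply is_lim_const].
exists x; intros y Hy; apply H; lra.
Qed.

Lemma is_derive_primitive (f : R -> R) :
  (forall x, continuous f x) -> forall x, is_derive (RInt f 0) x (f x).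
Proof.
intros Hf x; apply (is_derive_RInt f (RInt f 0) 0); [|apply Hf].
apply filter_forall; intros y.
apply (RInt_correct (V := R_CompleteNormedModule)), (ex_RInt_continuous (V := R_CompleteNormedModule)); auto.
Qed.

Section Tail.

(** [w] is an integrable weight near plus infinity, with primitive [W]. *)
Variables (w W : R -> R) (Wi : R).
Hypothesis w_cont : forall x, continuous w x.
Hypothesis w_pos : forall x, 0 < w x.
Hypothesis W_der : forall x, is_derive W x (w x).
Hypothesis W_lim : is_lim W p_infty Wi.

(** The integral of [w g] from [x] to plus infinity. *)
Definition tail_int (g : R -> R) (x : R) : R :=
  real (Lim (RInt (fun t => w t * g t) 0) p_infty) - RInt (fun t => w t * g t) 0 x.

Let wg_cont g : regular g -> forall x, continuous (fun t => w t * g t) x.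
Proof.
intros Hg x; apply (continuous_mult (K := R_AbsRing) w g); [auto|apply (proj1 Hg)].
Qed.

Lemma tail_derive g : regular g -> forall x, is_derive (tail_int g) x (- (w x * g x)).
Proof.
intros Hg x; unfold tail_int; apply is_derive_eq with (0 - w x * g x); [|ring].
apply (is_derive_minus (fun _ => _) (RInt (fun t => w t * g t) 0));
  [apply (is_derive_const (V := R_NormedModule))|].
apply (is_derive_primitive (fun t => w t * g t)), wg_cont, Hg.
Qed.

(** The increments of the primitive of [w g] are dominated by those of [W], which
    has a limit: Cauchy's criterion applies. *)
Lemma tail_lim g : regular g -> is_lim (tail_int g) p_infty 0.
Proof.
intros Hg; destruct (regular_bound g Hg) as [M HM].
set (G := RInt (fun t => w t * g t) 0).
assert (HG : forall x, is_derive G x (w x * g x)).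
{ exact (is_derive_primitive (fun t => w t * g t) (wg_cont g Hg)). }
assert (Hex : ex_finite_lim G p_infty).
{ destruct (proj1 (filterlim_locally_cauchy (U := R_CompleteSpace)
              (F := Rbar_locally p_infty) G)) as [l Hl]; [|exists l; exact Hl].
  intros [eps He].
  assert (HM0 : 0 <= M) by (eapply Rle_trans; [apply Rabs_pos|apply (HM 0)]).
  assert (Hd : 0 < eps / (2 * (M + 1))) by (apply Rdiv_lt_0_compat; lra).
  apply is_lim_spec in W_lim; destruct (W_lim (mkposreal _ Hd)) as [X HX]; simpl in HX.
  exists (fun x => X < x); split; [exists X; auto|].
  assert (H : forall u v, X < u -> u <= v -> Rabs (G v - G u) < eps).
  { intros u v Hu Huv.
    eapply Rle_lt_trans; [apply (increment_le G W (fun t => w t * g t) w M); auto|].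
    { intros t; rewrite Rabs_mult, Rmult_comm, (Rabs_pos_eq (w t)) by (left; apply w_pos).
      apply Rmult_le_compat_r; [left; apply w_pos|apply HM]. }
    assert (H1 := HX u Hu); assert (H2 := HX v ltac:(lra)).
    apply Rabs_def2 in H1; apply Rabs_def2 in H2.
    apply Rle_lt_trans with (M * (2 * (eps / (2 * (M + 1))))).
    - apply Rmult_le_compat_l; lra.
    - apply Rlt_le_trans with ((M + 1) * (2 * (eps / (2 * (M + 1))))); [|right; field; lra].
      apply Rmult_lt_compat_r; lra. }
  intros u v Hu Hv.
  change (Rabs (G v - G u) < eps).
  destruct (Rle_dec u v); [apply H; auto|].
  rewrite Rabs_minus_sym; apply H; lra. }
apply Lim_correct' in Hex.
unfold tail_int; fold G.
replace (Finite 0) with (Finite (real (Lim G p_infty) - real (Lim G p_infty))) by (f_equal; ring).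
apply is_lim_minus'; [apply is_lim_const|exact Hex].
Qed.

(** Linearity and the left inverses below are instances of this
    characterization. *)
Lemma tail_unique g (H : R -> R) : regular g ->
  (forall x, is_derive H x (- (w x * g x))) -> is_lim H p_infty 0 -> forall x, tail_int g x = H x.
Proof.
intros Hg HH Hl x.
assert (E : forall y, tail_int g y - H y = tail_int g x - H x).
{ intros y; apply (const_of_derive (fun t => tail_int g t - H t)); intros t.
  apply is_derive_eq with (- (w t * g t) - - (w t * g t)); [|ring].
  apply (is_derive_minus (tail_int g) H); auto using tail_derive. }
assert (L : is_lim (fun y => tail_int g y - H y) p_infty (0 - 0)).
{ apply is_lim_minus'; [apply tail_lim|]; auto. }
apply (is_lim_ext _ (fun _ => tail_int g x - H x)) in L; [|exact E].
apply is_lim_unique in L; rewrite Lim_const in L; injection L; lra.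
Qed.

Lemma tail_plus f g : regular f -> regular g ->
  forall x, tail_int (fun t => f t + g t) x = tail_int f x + tail_int g x.
Proof.
intros Hf Hg; apply (tail_unique _ (fun x => tail_int f x + tail_int g x)); [now apply regular_plus| |].
- intros x; apply is_derive_eq with (- (w x * f x) + - (w x * g x)); [|ring].
  apply (is_derive_plus (tail_int f) (tail_int g)); now apply tail_derive.
- replace (Finite 0) with (Finite (0 + 0)) by (f_equal; ring).
  apply is_lim_plus'; now apply tail_lim.
Qed.

Lemma tail_scal c f : regular f -> forall x, tail_int (fun t => c * f t) x = c * tail_int f x.
Proof.
intros Hf; apply (tail_unique _ (fun x => c * tail_int f x)); [now apply regular_scal| |].
- intros x; apply is_derive_eq with (c * - (w x * f x)); [|ring].
  apply (is_derive_scal (tail_int f)); now apply tail_derive.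
- replace (Finite 0) with (Finite (c * 0)) by (f_equal; ring).
  apply (is_lim_scal_l (tail_int f) c p_infty 0); now apply tail_lim.
Qed.

Lemma tail_nonneg g : regular g -> (forall t, 0 <= g t) -> forall x, 0 <= tail_int g x.
Proof.
intros Hg Hp x; apply is_lim_ge; [now apply tail_lim|].
intros y Hy; assert (- tail_int g x <= - tail_int g y); [|lra].
apply (incr_of_derive (fun t => - tail_int g t) (fun t => w t * g t)); auto.
- intros t _; apply is_derive_eq with (- - (w t * g t)); [|ring].
  apply (is_derive_opp (tail_int g)); now apply tail_derive.
- intros t _; apply Rmult_le_pos; [left|]; auto.
Qed.

Lemma tail_le f g : regular f -> regular g -> (forall t, f t <= g t) -> forall x, tail_int f x <= tail_int g x.
Proof.
intros Hf Hg H x.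
assert (H' : 0 <= tail_int (fun t => g t + -1 * f t) x).
{ apply tail_nonneg; [auto using regular_plus, regular_scal|]; intros t; specialize (H t); lra. }
rewrite (tail_plus g (fun t => -1 * f t)), (tail_scal (-1) f) in H' by auto using regular_scal.
lra.
Qed.

Lemma tail_one c x : tail_int (fun _ => c) x = c * (Wi - W x).
Proof.
apply (tail_unique _ (fun x => c * (Wi - W x))); [apply regular_const| |].
- intros t; apply is_derive_eq with (c * (0 - w t)); [|ring].
  apply (is_derive_scal (fun t => Wi - W t)).
  apply (is_derive_minus (fun _ => Wi) W); [apply (is_derive_const Wi)|apply W_der].
- replace (Finite 0) with (Finite (c * (Wi - Wi))) by (f_equal; ring).
  apply (is_lim_scal_l _ c p_infty (Wi - Wi)).
  apply is_lim_minus'; [apply is_lim_const|exact W_lim].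
Qed.

Lemma tail_bound g M : regular g -> (forall x, Rabs (g x) <= M) ->
  forall x, Rabs (tail_int g x) <= M * (Wi - W x).
Proof.
intros Hg HM x; apply Rabs_le; rewrite <- (tail_one M x).
replace (- tail_int (fun _ => M) x) with (tail_int (fun _ => -1 * M) x)
  by (rewrite (tail_scal (-1) (fun _ => M)) by apply regular_const; ring).
split; apply tail_le; auto using regular_const; intros t; specialize (HM t);
  apply Rabs_le_between in HM; lra.
Qed.

End Tail.

(** * The resolvent of the second derivative *)

(** [Sm g] is the bounded solution of [y' = 2 y - g], [Sp g] the one of
    [y' = - 2 y + g]. *)
Definition Sm (g : R -> R) (x : R) : R := exp (2 * x) * tail_int (fun t => exp (-2 * t)) g x.
Definition Sp (g : R -> R) (x : R) : R := Sm (fun t => g (- t)) (- x).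

Lemma is_derive_expc c x : is_derive (fun t => exp (c * t)) x (c * exp (c * x)).
Proof. auto_derive; [exact I|ring]. Qed.

Lemma continuous_expc c x : continuous (fun t : R => exp (c * t)) x.
Proof.
apply (ex_derive_continuous (fun t => exp (c * t))); eexists; apply is_derive_expc.
Qed.

Lemma expW_der x : is_derive (fun t => - exp (-2 * t) / 2) x (exp (-2 * x)).
Proof. auto_derive; [exact I|field]. Qed.

Lemma exp_lim : is_lim (fun t => exp (-2 * t)) p_infty 0.
Proof.
apply (is_lim_comp exp (fun t => -2 * t) p_infty 0 m_infty).
- apply is_lim_exp_m.
- apply is_lim_spec; intros M; exists (- M / 2); intros x Hx; lra.
- exists 0; intros x _; discriminate.
Qed.

Lemma expW_lim : is_lim (fun t => - exp (-2 * t) / 2) p_infty 0.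
Proof.
replace (Finite 0) with (Finite (- / 2 * 0)) by (f_equal; ring).
apply (is_lim_ext (fun t => - / 2 * exp (-2 * t))); [intros; field|].
apply (is_lim_scal_l _ (- / 2) p_infty 0), exp_lim.
Qed.

Section Resolvent.

Let wc : forall x, continuous (fun t : R => exp (-2 * t)) x := continuous_expc (-2).
Let wp := fun x => exp_pos (-2 * x).

Lemma Sm_derive g : regular g -> forall x, is_derive (Sm g) x (2 * Sm g x - g x).
Proof.
intros Hg x; unfold Sm.
apply is_derive_eq with (2 * exp (2 * x) * tail_int (fun t => exp (-2 * t)) g x
   + exp (2 * x) * - (exp (-2 * x) * g x)).
- apply (is_derive_mult (fun t => exp (2 * t)) (tail_int (fun t => exp (-2 * t)) g));
    [apply is_derive_expc | exact (tail_derive _ wc g Hg x) | intros; apply Rmult_comm].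
- replace (exp (2 * x) * - (exp (-2 * x) * g x)) with (- (exp (2 * x) * exp (-2 * x)) * g x) by ring.
  rewrite <- exp_plus; replace (2 * x + -2 * x) with 0 by ring; rewrite exp_0; ring.
Qed.

Lemma Sm_bound g M : regular g -> (forall x, Rabs (g x) <= M) -> forall x, Rabs (Sm g x) <= M / 2.
Proof.
intros Hg HM x; unfold Sm; rewrite Rabs_mult, (Rabs_pos_eq (exp _)) by (left; apply exp_pos).
assert (H := tail_bound _ _ _ wc wp expW_der expW_lim g M Hg HM x); cbv beta in H.
apply Rmult_le_compat_l with (r := exp (2 * x)) in H; [|left; apply exp_pos].
eapply Rle_trans; [exact H|]; right.
replace (exp (2 * x) * (M * (0 - - exp (-2 * x) / 2)))
  with (M / 2 * (exp (2 * x) * exp (-2 * x))) by field.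
rewrite <- exp_plus; replace (2 * x + -2 * x) with 0 by ring; rewrite exp_0; ring.
Qed.

Lemma Sm_le f g : regular f -> regular g -> (forall t, f t <= g t) -> forall x, Sm f x <= Sm g x.
Proof.
intros Hf Hg H x; apply Rmult_le_compat_l; [left; apply exp_pos|].
apply (tail_le _ _ _ wc wp expW_der expW_lim); auto.
Qed.

(** The homogeneous solutions are exponentials, so bounded solutions are
    unique. *)
Lemma Sm_inverse u u' : regular u -> regular u' -> (forall x, is_derive u x (u' x)) ->
  forall x, Sm (fun t => 2 * u t - u' t) x = u x.
Proof.
intros Hu Hu' Hd x; unfold Sm.
rewrite (tail_unique _ _ _ wc wp expW_der expW_lim _ (fun t => exp (-2 * t) * u t)).
- rewrite <- Rmult_assoc, <- exp_plus; replace (2 * x + -2 * x) with 0 by ring.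
  rewrite exp_0; ring.
- replace (fun t => 2 * u t - u' t) with (fun t => 2 * u t + -1 * u' t)
    by (apply functional_extensionality; intros; ring).
  auto using regular_plus, regular_scal.
- intros t; apply is_derive_eq with (-2 * exp (-2 * t) * u t + exp (-2 * t) * u' t); [|ring].
  apply (is_derive_mult (fun t => exp (-2 * t)) u);
    [apply is_derive_expc | apply Hd | intros; apply Rmult_comm].
- destruct (regular_bound u Hu) as [M HM].
  apply (is_lim_le_le_loc (fun t => - M * exp (-2 * t)) (fun t => M * exp (-2 * t))).
  + exists 0; intros t _; specialize (HM t); apply Rabs_le_between in HM.
    assert (He := exp_pos (-2 * t)); nra.
  + replace (Finite 0) with (Finite (- M * 0)) by (f_equal; ring).
    apply (is_lim_scal_l _ (- M) p_infty 0), exp_lim.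
  + replace (Finite 0) with (Finite (M * 0)) by (f_equal; ring).
    apply (is_lim_scal_l _ M p_infty 0), exp_lim.
Qed.

Lemma Sm_op : bounded_op Sm.
Proof.
split.
- intros f g Hf Hg xi; unfold Sm.
  rewrite (tail_plus _ _ _ wc wp expW_der expW_lim) by auto; ring.
- intros c f Hf xi; unfold Sm.
  rewrite (tail_scal _ _ _ wc wp expW_der expW_lim) by auto; ring.
- exists (/ 2); split; [lra|]; intros f M Hf HM xi.
  eapply Rle_trans; [apply (Sm_bound f M); auto|lra].
- intros f Hf xi; apply (ex_derive_continuous (Sm f)); eexists; now apply Sm_derive.
- intros f Hf [[a Ha] [b Hb]].
  destruct (regular_bound f Hf) as [M HM].
  apply (ode_has_limits (Sm f) (fun _ => 2) (fun x => - f x) 2 2); try lra;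
    try apply is_lim_const.
  + intros x; apply is_derive_eq with (2 * Sm f x - f x); [now apply Sm_derive|ring].
  + exists (M / 2); now apply Sm_bound.
  + split; [exists (- a)|exists (- b)].
    * now apply (is_lim_opp f p_infty a). * now apply (is_lim_opp f m_infty b).
Qed.

Lemma Sp_derive g : regular g -> forall x, is_derive (Sp g) x (-2 * Sp g x + g x).
Proof.
intros Hg x; unfold Sp.
apply is_derive_eq with (-1 * (2 * Sm (fun t => g (- t)) (- x) - g (- - x))).
- apply (is_derive_comp (Sm (fun t => g (- t))) Ropp).
  + now apply (Sm_derive (fun t => g (- t))), regular_reflect.
  + auto_derive; [exact I|ring].
- rewrite Ropp_involutive; ring.
Qed.

Lemma has_limits_reflect f : has_limits f -> has_limits (fun x => f (- x)).
Proof.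
intros [[a Ha] [b Hb]]; split; [exists b|exists a].
- now apply is_lim_reflect.
- now apply is_lim_reflect'.
Qed.

Lemma Sp_op : bounded_op Sp.
Proof.
split; unfold Sp.
- intros; apply (op_plus _ Sm_op (fun t => f (- t)) (fun t => g (- t))); now apply regular_reflect.
- intros; apply (op_scal _ Sm_op c (fun t => f (- t))); now apply regular_reflect.
- destruct (op_bound _ Sm_op) as [C [HC H]]; exists C; split; auto; intros.
  apply H; [now apply regular_reflect|auto].
- intros f Hf xi; apply (ex_derive_continuous (Sp f)); eexists; now apply Sp_derive.
- intros f Hf Hl; apply has_limits_reflect, (op_lim _ Sm_op).
  + now apply regular_reflect. + now apply has_limits_reflect.
Qed.

Lemma Sp_le f g : regular f -> regular g -> (forall t, f t <= g t) -> forall x, Sp f x <= Sp g x.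
Proof. intros; apply Sm_le; auto using regular_reflect. Qed.

Lemma Sp_bound g M : regular g -> (forall x, Rabs (g x) <= M) -> forall x, Rabs (Sp g x) <= M / 2.
Proof. intros; apply Sm_bound; auto using regular_reflect. Qed.

Lemma Sp_inverse u u' : regular u -> regular u' -> (forall x, is_derive u x (u' x)) ->
  forall x, Sp (fun t => 2 * u t + u' t) x = u x.
Proof.
intros Hu Hu' Hd x; unfold Sp.
assert (H := Sm_inverse (fun t => u (- t)) (fun t => -1 * u' (- t)) (regular_reflect u Hu)
         (regular_scal (-1) _ (regular_reflect u' Hu'))).
cbv beta in H; rewrite <- (Ropp_involutive x) at 2; rewrite <- H.
- f_equal; apply functional_extensionality; intros; ring.
- intros y; apply (is_derive_comp u Ropp); [apply Hd|auto_derive; [exact I|ring]].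
Qed.

End Resolvent.

(** * The static profile *)

Lemma asin_range h : 0 < h < 1 -> 0 < asin h < PI / 2.
Proof.
intros Hh; assert (Hb := asin_bound_lt h ltac:(lra)); assert (HP := PI_RGT_0).
split; [|lra].
apply Rnot_le_lt; intros Hn.
assert (H := sin_ge_0 (- asin h) ltac:(lra) ltac:(lra)).
rewrite sin_neg, sin_asin in H by lra; lra.
Qed.

(** The equation is invariant under [x |-> - x], [b |-> PI - b]; estimates at one
    end transfer to the other. *)
Lemma static_angle_reflect h b : static_angle h b -> static_angle h (fun x => PI - b (- x)).
Proof.
intros [Hd [Hm Hp]]; split; [|split].
- intros x.
  replace (sin (PI - b (- x))) with (sin (b (- x)))
    by (rewrite sin_minus, sin_PI, cos_PI; ring).
  apply is_derive_eq with (0 - -1 * (h - sin (b (- x)))); [|ring].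
  apply (is_derive_minus (fun _ => PI)); [apply (is_derive_const PI)|].
  apply (is_derive_comp b Ropp); [apply Hd|auto_derive; [exact I|ring]].
- apply (is_lim_minus' (fun _ => PI)); [apply is_lim_const|].
  now apply is_lim_reflect'.
- replace (Finite (asin h)) with (Finite (PI - (PI - asin h))) by (f_equal; ring).
  apply (is_lim_minus' (fun _ => PI)); [apply is_lim_const|].
  now apply is_lim_reflect.
Qed.

(** Minus the derivative of the static angle: by translation invariance it spans
    the kernel of the in-plane linearization. *)
Definition angle_speed (h : R) (b : R -> R) (x : R) : R := sin (b x) - h.

Section Static.

Variables (h : R) (b : R -> R).
Hypothesis Hh : 0 < h < 1.
Hypothesis Hb : static_angle h b.

Notation speed := (angle_speed h b).

Lemma angle_derive x : is_derive b x (- speed x).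
Proof. apply is_derive_eq with (h - sin (b x)); [apply Hb|unfold angle_speed; ring]. Qed.

Lemma angle_cont x : continuous b x.
Proof. apply (ex_derive_continuous b); eexists; apply angle_derive. Qed.

Lemma sin_angle_derive x : is_derive (fun t => sin (b t)) x (- speed x * cos (b x)).
Proof. apply (is_derive_comp sin b); [apply is_derive_sin|apply angle_derive]. Qed.

Lemma cos_angle_derive x : is_derive (fun t => cos (b t)) x (speed x * sin (b x)).
Proof.
apply is_derive_eq with (- speed x * - sin (b x)); [|ring].
apply (is_derive_comp cos b); [apply is_derive_cos|apply angle_derive].
Qed.

Lemma speed_derive x : is_derive speed x (- cos (b x) * speed x).
Proof.
apply is_derive_eq with (- speed x * cos (b x) - 0); [|ring].
apply (is_derive_minus (fun t => sin (b t)) (fun _ => h)); [apply sin_angle_derive|].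
apply (is_derive_const h).
Qed.

Lemma regular_cos_angle : regular (fun x => cos (b x)).
Proof.
split.
- intros x; apply (ex_derive_continuous (fun t => cos (b t))); eexists; apply cos_angle_derive.
- exists 1; intros x; apply Rabs_le, COS_bound.
Qed.

Lemma regular_sin_angle : regular (fun x => sin (b x)).
Proof.
split.
- intros x; apply (ex_derive_continuous (fun t => sin (b t))); eexists; apply sin_angle_derive.
- exists 1; intros x; apply Rabs_le, SIN_bound.
Qed.

Lemma regular_speed : regular speed.
Proof.
apply (regular_plus (fun x => sin (b x)) (fun _ => - h)); [apply regular_sin_angle|apply regular_const].
Qed.

(** [speed] solves a linear equation, hence vanishes everywhere or nowhere;
    the limits of the angle exclude the first case and fix the sign. *)
Lemma speed_pos x : 0 < speed x.
Proof.
set (K := RInt (fun t => cos (b t)) 0).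
assert (HK : forall x, is_derive K x (cos (b x))).
{ apply (is_derive_primitive (fun t => cos (b t))); apply regular_cos_angle. }
assert (E : forall y, speed y * exp (K y) = speed x * exp (K x)).
{ intros y; apply (const_of_derive (fun y => speed y * exp (K y))); intros z.
  apply is_derive_eq with
    ((- cos (b z) * speed z) * exp (K z) + speed z * (cos (b z) * exp (K z))); [|ring].
  apply (is_derive_mult speed (fun y => exp (K y)));
    [apply speed_derive| |intros; apply Rmult_comm].
  apply (is_derive_comp exp K); [apply is_derive_exp|apply HK]. }
assert (Ha := asin_range h Hh).
apply Rnot_le_lt; intros Hle.
assert (Hle' : forall y, speed y <= 0).
{ intros y; specialize (E y).
  assert (H1 := exp_pos (K y)); assert (H2 := exp_pos (K x)).
  apply Rnot_lt_le; intros H; assert (0 < speed y * exp (K y)) by now apply Rmult_lt_0_compat.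
  assert (speed x * exp (K x) <= 0) by nra; lra. }
assert (Hincr : forall y z, y <= z -> b y <= b z).
{ intros y z Hyz; apply (incr_of_derive b (fun t => - speed t)); auto using angle_derive.
  intros t _; specialize (Hle' t); lra. }
destruct Hb as [_ [Hm Hp]].
assert (H1 : b 0 <= asin h).
{ apply (is_lim_le_loc (fun _ => b 0) b p_infty (b 0) (asin h)); [|apply is_lim_const|exact Hp].
  exists 0; intros; apply Hincr; lra. }
assert (H2 : PI - asin h <= b 0).
{ apply (is_lim_le_loc b (fun _ => b 0) m_infty (PI - asin h) (b 0));
    [|exact Hm|apply is_lim_const].
  exists 0; intros; apply Hincr; lra. }
lra.
Qed.

Lemma sin_angle_bounds x : h < sin (b x) <= 1.
Proof. generalize (speed_pos x) (SIN_bound (b x)); unfold angle_speed; lra. Qed.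

Lemma angle_decr x y : x <= y -> b y <= b x.
Proof.
intros Hxy; assert (- b x <= - b y); [|lra].
apply (incr_of_derive (fun t => - b t) speed); auto.
- intros z _; apply is_derive_eq with (- - speed z); [|ring].
  apply (is_derive_opp b), angle_derive.
- intros z _; left; apply speed_pos.
Qed.

Lemma angle_lower x : asin h <= b x.
Proof.
apply is_lim_ge; [apply Hb|]; intros; now apply angle_decr.
Qed.

Lemma middle_exists : exists x0, b x0 = PI / 2.
Proof.
assert (Ha := asin_range h Hh); destruct Hb as [_ [Hm Hp]].
apply is_lim_spec in Hm; apply is_lim_spec in Hp.
assert (He : 0 < PI / 2 - asin h) by lra.
destruct (Hm (mkposreal _ He)) as [X1 H1]; destruct (Hp (mkposreal _ He)) as [X2 H2].
simpl in H1, H2.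
specialize (H1 (X1 - 1) ltac:(lra)); specialize (H2 (X2 + 1) ltac:(lra)).
apply Rabs_def2 in H1; apply Rabs_def2 in H2.
destruct (IVT_gen b (X1 - 1) (X2 + 1) (PI / 2)) as [x [_ Hx]]; [| |exists x; exact Hx].
- intros x; apply continuity_pt_filterlim, angle_cont.
- rewrite Rmin_right, Rmax_left by lra; lra.
Qed.

Lemma cos_asin_pos : 0 < cos (asin h).
Proof. assert (Ha := asin_range h Hh); apply cos_gt_0; lra. Qed.

Lemma cos_angle_lim_p : is_lim (fun x => cos (b x)) p_infty (cos (asin h)).
Proof. apply is_lim_comp_continuous; [apply Hb|apply continuous_cos]. Qed.

Lemma cos_angle_lim_m : is_lim (fun x => cos (b x)) m_infty (- cos (asin h)).
Proof.
replace (- cos (asin h)) with (cos (PI - asin h))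
  by (rewrite cos_minus, cos_PI, sin_PI; ring).
apply is_lim_comp_continuous; [apply Hb|apply continuous_cos].
Qed.

Lemma sin_angle_lim_p : is_lim (fun x => sin (b x)) p_infty h.
Proof.
rewrite <- (sin_asin h) at 1 by lra.
apply is_lim_comp_continuous; [apply Hb|apply continuous_sin].
Qed.

Lemma sin_angle_lim_m : is_lim (fun x => sin (b x)) m_infty h.
Proof.
replace h with (sin (PI - asin h))
  by (rewrite sin_minus, cos_PI, sin_PI, sin_asin by lra; ring).
apply is_lim_comp_continuous; [apply Hb|apply continuous_sin].
Qed.

Lemma has_limits_sin_angle : has_limits (fun x => sin (b x)).
Proof. split; eexists; [apply sin_angle_lim_p|apply sin_angle_lim_m]. Qed.

Lemma has_limits_speed : has_limits speed.
Proof. apply (has_limits_plus _ (fun _ => - h)); [apply has_limits_sin_angle|apply has_limits_const]. Qed.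

(** * The stable in-plane factor *)

(** The solution of [y' = - cos b y + g] that vanishes where [b = PI / 2]. *)
Definition stable_op (x0 : R) (g : R -> R) (x : R) : R :=
  speed x * (RInt (fun t => g t / speed t) 0 x - RInt (fun t => g t / speed t) 0 x0).

Lemma quotient_cont g : regular g -> forall x, continuous (fun t => g t / speed t) x.
Proof.
intros Hg x; apply (continuous_mult (K := R_AbsRing) g); [apply (proj1 Hg)|].
apply (continuous_comp speed Rinv); [apply (proj1 regular_speed)|].
apply (ex_derive_continuous Rinv); auto_derive.
apply Rgt_not_eq, speed_pos.
Qed.

Lemma stable_op_derive x0 g : regular g ->
  forall x, is_derive (stable_op x0 g) x (- cos (b x) * stable_op x0 g x + g x).
Proof.
intros Hg x; unfold stable_op.
set (G := RInt (fun t => g t / speed t) 0).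
apply is_derive_eq with ((- cos (b x) * speed x) * (G x - G x0) + speed x * (g x / speed x - 0)).
- apply (is_derive_mult speed (fun t => G t - G x0));
    [apply speed_derive| |intros; apply Rmult_comm].
  apply (is_derive_minus G (fun _ => G x0)); [|apply (is_derive_const (G x0))].
  apply (is_derive_primitive (fun t => g t / speed t)), quotient_cont, Hg.
- field; apply Rgt_not_eq, speed_pos.
Qed.

(** Here [cos b] plays the role of a supersolution:
    [(cos b)' + cos b cos b = 1 - h sin b >= 1 - h]. *)
Lemma stable_op_estimate x0 g M : b x0 = PI / 2 -> regular g -> (forall x, Rabs (g x) <= M) ->
  forall x, Rabs (stable_op x0 g x) <= M / (1 - h).
Proof.
intros H0 Hg HM x.
set (G := RInt (fun t => g t / speed t) 0).
set (q := fun t => cos (b t) / speed t).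
assert (HG : forall t, is_derive G t (g t / speed t)).
{ apply (is_derive_primitive (fun t => g t / speed t)), quotient_cont, Hg. }
assert (Hq : forall t, is_derive q t ((1 - h * sin (b t)) / speed t)).
{ intros t; assert (Hs := speed_pos t).
  apply is_derive_eq with ((speed t * sin (b t) * speed t - cos (b t) * (- cos (b t) * speed t))
     / speed t ^ 2).
  - apply (is_derive_div (fun t => cos (b t)) speed); [apply cos_angle_derive|apply speed_derive|lra].
  - replace (speed t * sin (b t) * speed t - cos (b t) * (- cos (b t) * speed t))
      with (speed t * (speed t * sin (b t) + (cos (b t))²)) by (unfold Rsqr; ring).
    rewrite cos2; unfold Rsqr; unfold angle_speed in *; field; lra. }
assert (HM0 : 0 <= M) by (eapply Rle_trans; [apply Rabs_pos|apply (HM 0)]).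
assert (Hi : forall y z, y <= z -> Rabs (G z - G y) <= M / (1 - h) * (q z - q y)).
{ intros y z; apply (increment_le G q _ _ _ y z HG Hq).
  intros t; assert (Hst := sin_angle_bounds t); assert (Hp := speed_pos t).
  rewrite Rabs_div, (Rabs_pos_eq (speed t)) by lra.
  apply Rmult_le_reg_r with (speed t * (1 - h)); [apply Rmult_lt_0_compat; lra|].
  replace (Rabs (g t) / speed t * (speed t * (1 - h))) with (Rabs (g t) * (1 - h)) by (field; lra).
  replace (M / (1 - h) * ((1 - h * sin (b t)) / speed t) * (speed t * (1 - h)))
    with (M * (1 - h * sin (b t))) by (field; lra).
  apply Rmult_le_compat; [apply Rabs_pos|lra|apply HM|nra]. }
assert (Hq0 : q x0 = 0) by (unfold q; rewrite H0, cos_PI2; field; apply Rgt_not_eq, speed_pos).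
assert (HGq : Rabs (G x - G x0) <= M / (1 - h) * Rabs (q x)).
{ assert (Hc : 0 <= M / (1 - h)) by (apply Rmult_le_pos; [lra|left; apply Rinv_0_lt_compat; lra]).
  destruct (Rle_dec x0 x) as [Hx|Hx].
  - eapply Rle_trans; [apply (Hi x0 x Hx)|].
    rewrite Hq0, Rminus_0_r; apply Rmult_le_compat_l; auto using Rle_abs.
  - rewrite Rabs_minus_sym; eapply Rle_trans; [apply (Hi x x0); lra|].
    rewrite Hq0, <- Rabs_Ropp; apply Rmult_le_compat_l; auto.
    eapply Rle_trans; [|apply Rle_abs]; lra. }
assert (Hp := speed_pos x).
change (stable_op x0 g x) with (speed x * (G x - G x0)).
rewrite Rabs_mult, (Rabs_pos_eq (speed x)) by lra.
apply Rle_trans with (speed x * (M / (1 - h) * Rabs (q x))).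
- apply Rmult_le_compat_l; [lra|exact HGq].
- unfold q; rewrite Rabs_div, (Rabs_pos_eq (speed x)) by lra.
  replace (speed x * (M / (1 - h) * (Rabs (cos (b x)) / speed x)))
    with (M / (1 - h) * Rabs (cos (b x))) by (field; lra).
  rewrite <- (Rmult_1_r (M / (1 - h))) at 2; apply Rmult_le_compat_l.
  + apply Rmult_le_pos; [lra|left; apply Rinv_0_lt_compat; lra].
  + apply Rabs_le, COS_bound.
Qed.

Lemma RInt_plus_regular f g : regular f -> regular g -> forall x,
  RInt (fun t => (f t + g t) / speed t) 0 x
    = RInt (fun t => f t / speed t) 0 x + RInt (fun t => g t / speed t) 0 x.
Proof.
intros Hf Hg x.
transitivity (RInt (fun t => plus (f t / speed t) (g t / speed t)) 0 x).
- apply RInt_ext; intros; unfold Rdiv; apply Rmult_plus_distr_r.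
- apply (RInt_plus (V := R_CompleteNormedModule));
    apply (ex_RInt_continuous (V := R_CompleteNormedModule)); intros; now apply quotient_cont.
Qed.

Lemma RInt_scal_regular c f : regular f -> forall x,
  RInt (fun t => (c * f t) / speed t) 0 x = c * RInt (fun t => f t / speed t) 0 x.
Proof.
intros Hf x.
transitivity (RInt (fun t => scal c (f t / speed t)) 0 x).
- apply RInt_ext; intros; unfold Rdiv; apply Rmult_assoc.
- apply (RInt_scal (V := R_CompleteNormedModule));
    apply (ex_RInt_continuous (V := R_CompleteNormedModule)); intros; now apply quotient_cont.
Qed.

Lemma stable_op_bounded x0 : b x0 = PI / 2 -> bounded_op (stable_op x0).
Proof.
intros H0; assert (Hc := cos_asin_pos); split.
- intros f g Hf Hg x; unfold stable_op; rewrite !RInt_plus_regular by auto; ring.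
- intros c f Hf x; unfold stable_op; rewrite !RInt_scal_regular by auto; ring.
- exists (/ (1 - h)); split; [left; apply Rinv_0_lt_compat; lra|]; intros f M Hf HM x.
  eapply Rle_trans; [apply (stable_op_estimate x0 f M); auto|right; unfold Rdiv; ring].
- intros f Hf x; apply (ex_derive_continuous (stable_op x0 f)); eexists; now apply stable_op_derive.
- intros f Hf Hl; destruct (regular_bound f Hf) as [M HM].
  apply (ode_has_limits (stable_op x0 f) (fun x => - cos (b x)) f (- cos (asin h)) (cos (asin h)));
    try lra; auto.
  + now apply stable_op_derive.
  + exists (M / (1 - h)); now apply stable_op_estimate.
  + apply (is_lim_opp (fun x => cos (b x)) p_infty (cos (asin h))), cos_angle_lim_p.
  + rewrite <- (Ropp_involutive (cos (asin h))).
    apply (is_lim_opp (fun x => cos (b x)) m_infty (- cos (asin h))), cos_angle_lim_m.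
Qed.

(** * Integration against the kernel of the in-plane operator *)

Lemma angle_W_der x : is_derive (fun t => - b t) x (speed x).
Proof.
apply is_derive_eq with (- - speed x); [|ring]; apply (is_derive_opp b), angle_derive.
Qed.

Lemma angle_W_lim : is_lim (fun t => - b t) p_infty (- asin h).
Proof. apply (is_lim_opp b p_infty (asin h)), Hb. Qed.

(** The left-hand side is the integral of [speed] from [x] to infinity. The
    inequality expresses that the sine grows at least linearly from [asin h] to
    [PI / 2]; it holds because its two sides agree at [asin h] and
    [((2 - cos t) (sin t - h))' >= 1 - h]. *)
Lemma speed_lower x : b x <= PI / 2 -> b x - asin h <= 2 / (1 - h) * speed x.
Proof.
intros Hx; assert (Ha := asin_range h Hh); assert (Hl := angle_lower x).
assert (Hp := speed_pos x).
set (f := fun t => (2 - cos t) / (1 - h) * (sin t - h) - t).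
assert (H : f (asin h) <= f (b x)).
{ apply (incr_of_derive f
    (fun t => sin t / (1 - h) * (sin t - h) + (2 - cos t) / (1 - h) * cos t - 1)); auto.
  - intros t _; unfold f; auto_derive; [exact I|field; lra].
  - intros t Ht.
    replace (sin t / (1 - h) * (sin t - h) + (2 - cos t) / (1 - h) * cos t - 1)
      with ((sin t * (sin t - h) + (2 - cos t) * cos t - (1 - h)) / (1 - h)) by (field; lra).
    apply Rmult_le_pos; [|left; apply Rinv_0_lt_compat; lra].
    assert (0 <= cos t) by (apply cos_ge_0; lra).
    assert (E := sin2_cos2 t); unfold Rsqr in E.
    assert (B1 := COS_bound t); assert (B2 := SIN_bound t); nra. }
unfold f in H; rewrite sin_asin in H by lra.
change (sin (b x) - h) with (speed x) in H.
assert (0 <= cos (b x)) by (apply cos_ge_0; lra).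
assert ((2 - cos (b x)) / (1 - h) * speed x <= 2 / (1 - h) * speed x).
{ apply Rmult_le_compat_r; [lra|]; apply Rmult_le_compat_r; [left; apply Rinv_0_lt_compat|]; lra. }
lra.
Qed.

Lemma tail_speed_bound g M : regular g -> (forall x, Rabs (g x) <= M) ->
  forall x, Rabs (tail_int speed g x) <= M * (b x - asin h).
Proof.
intros Hg HM x.
eapply Rle_trans;
  [apply (tail_bound speed _ _ (proj1 regular_speed) speed_pos angle_W_der angle_W_lim g M); auto|].
right; ring.
Qed.

End Static.

Section Unstable.

Variables (h : R) (b : R -> R).
Hypothesis Hh : 0 < h < 1.
Hypothesis Hb : static_angle h b.

Notation speed := (angle_speed h b).
Let b' : R -> R := fun x => PI - b (- x).
Let Hb' : static_angle h b' := static_angle_reflect h b Hb.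
Notation speed' := (angle_speed h b').

Lemma speed_reflect x : speed' x = speed (- x).
Proof. unfold angle_speed, b'; rewrite sin_minus, cos_PI, sin_PI; ring. Qed.

(** The integral of [speed * g] over the line; the half-line at minus infinity is
    reflected. *)
Definition total (g : R -> R) : R :=
  tail_int speed g 0 + tail_int (angle_speed h (fun x => PI - b (- x))) (fun t => g (- t)) 0.

Lemma total_split g : regular g -> forall x,
  total g = tail_int speed g x + tail_int speed' (fun t => g (- t)) (- x).
Proof.
intros Hg x.
set (F := fun x => tail_int speed g x + tail_int speed' (fun t => g (- t)) (- x)).
change (total g = F x); transitivity (F 0); [unfold F, total; rewrite Ropp_0; reflexivity|].
apply const_of_derive; intros z; unfold F.
apply is_derive_eq with (- (speed z * g z) + -1 * - (speed' (- z) * g (- - z)));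
  [|rewrite speed_reflect, Ropp_involutive; ring].
apply (is_derive_plus (tail_int speed g) (fun x => tail_int speed' (fun t => g (- t)) (- x))).
- apply tail_derive; [apply (regular_speed h b Hb)|exact Hg].
- apply (is_derive_comp (tail_int speed' (fun t => g (- t))) Ropp).
  + apply (tail_derive speed' (proj1 (regular_speed h b' Hb')) (fun t => g (- t))).
    now apply regular_reflect.
  + auto_derive; [exact I|ring].
Qed.

Let wc : forall x, continuous speed x := proj1 (regular_speed h b Hb).
Let wp : forall x, 0 < speed x := speed_pos h b Hh Hb.
Let Wd := angle_W_der h b Hb.
Let Wl := angle_W_lim h b Hb.
Let wc' : forall x, continuous speed' x := proj1 (regular_speed h b' Hb').
Let wp' : forall x, 0 < speed' x := speed_pos h b' Hh Hb'.
Let Wd' := angle_W_der h b' Hb'.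
Let Wl' := angle_W_lim h b' Hb'.

Lemma total_plus f g : regular f -> regular g -> total (fun t => f t + g t) = total f + total g.
Proof.
intros Hf Hg; unfold total.
rewrite (tail_plus _ _ _ wc wp Wd Wl) by auto.
rewrite (tail_plus _ _ _ wc' wp' Wd' Wl' (fun t => f (- t)) (fun t => g (- t)))
  by now apply regular_reflect.
unfold b'; ring.
Qed.

Lemma total_scal c f : regular f -> total (fun t => c * f t) = c * total f.
Proof.
intros Hf; unfold total.
rewrite (tail_scal _ _ _ wc wp Wd Wl) by auto.
rewrite (tail_scal _ _ _ wc' wp' Wd' Wl' c (fun t => f (- t))) by now apply regular_reflect.
unfold b'; ring.
Qed.

Lemma total_bound g M : regular g -> (forall x, Rabs (g x) <= M) -> Rabs (total g) <= PI * M.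
Proof.
intros Hg HM; assert (Ha := asin_range h Hh).
assert (HM0 : 0 <= M) by (eapply Rle_trans; [apply Rabs_pos|apply (HM 0)]).
apply Rle_trans with (M * (b 0 - asin h) + M * (b' 0 - asin h)).
- apply Rabs_plus_le; [now apply tail_speed_bound|].
  apply (tail_speed_bound h b' Hh Hb' (fun t => g (- t)) M); auto using regular_reflect.
- unfold b'; rewrite Ropp_0; nra.
Qed.

Lemma total_speed_pos : 0 < total speed.
Proof.
assert (Hg := regular_speed h b Hb).
assert (H1 : 0 < tail_int speed speed 0).
{ set (T := tail_int speed speed).
  assert (HT : forall x, is_derive T x (- (speed x * speed x)))
    by (intros; now apply tail_derive).
  assert (H1 : 0 <= T 1).
  { apply (tail_nonneg _ _ _ wc wp Wd Wl); auto; intros; left; apply wp. }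
  destruct (MVT_gen T 0 1 (fun x => - (speed x * speed x))) as [c [_ Hc]].
  - intros; apply HT.
  - intros x _; apply continuity_pt_filterlim, (ex_derive_continuous T); eexists; apply HT.
  - assert (0 < speed c * speed c) by (apply Rmult_lt_0_compat; apply wp).
    assert (T 1 - T 0 < 0) by (rewrite Hc; lra); lra. }
assert (H2 : 0 <= tail_int speed' (fun t => speed (- t)) 0).
{ apply (tail_nonneg _ _ _ wc' wp' Wd' Wl' (fun t => speed (- t))); auto using regular_reflect.
  intros; left; apply wp. }
change (0 < tail_int speed speed 0 + tail_int speed' (fun t => speed (- t)) 0); lra.
Qed.

(** The multiple of [speed] that is removed is the one that the velocity
    produces in the equation. *)
Definition proj (g : R -> R) (x : R) : R := g x + - (total g / total speed) * speed x.

Lemma regular_proj g : regular g -> regular (proj g).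
Proof.
intros Hg; apply (regular_plus g (fun x => - (total g / total speed) * speed x)); auto.
apply regular_scal, (regular_speed h b Hb).
Qed.

Lemma total_proj g : regular g -> total (proj g) = 0.
Proof.
intros Hg; unfold proj.
assert (Hs := regular_speed h b Hb).
rewrite (total_plus g), total_scal by auto using regular_scal.
field; apply Rgt_not_eq, total_speed_pos.
Qed.

Lemma proj_bound g M : regular g -> (forall x, Rabs (g x) <= M) ->
  forall x, Rabs (proj g x) <= (1 + PI / total speed) * M.
Proof.
intros Hg HM x; unfold proj; assert (Hp := total_speed_pos).
replace ((1 + PI / total speed) * M) with (M + PI * M / total speed * 1) by (field; lra).
apply Rabs_plus_le; [auto|]; apply Rabs_mult_le.
- rewrite Rabs_Ropp, Rabs_div by lra; rewrite (Rabs_pos_eq (total speed)) by lra.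
  apply Rmult_le_compat_r; [left; now apply Rinv_0_lt_compat|]; now apply total_bound.
- generalize (wp x) (sin_angle_bounds h b Hh Hb x); unfold angle_speed; intros.
  rewrite Rabs_pos_eq; lra.
Qed.

(** The bounded solution of [y' = cos b y + proj g]; the homogeneous solutions
    [c / speed] grow at both ends, so that the integral of [speed * proj g] has
    to vanish. *)
Definition unstable_op (g : R -> R) (x : R) : R := - tail_int speed (proj g) x / speed x.

Lemma unstable_op_derive g : regular g ->
  forall x, is_derive (unstable_op g) x (cos (b x) * unstable_op g x + proj g x).
Proof.
intros Hg x; unfold unstable_op; assert (Hp := wp x).
set (T := tail_int speed (proj g)).
assert (HT : is_derive T x (- (speed x * proj g x))) by (apply tail_derive; [exact wc|now apply regular_proj]).
apply is_derive_eq with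
  ((- - (speed x * proj g x) * speed x - - T x * (- cos (b x) * speed x)) / speed x ^ 2).
- apply (is_derive_div (fun t => - T t) speed);
    [now apply (is_derive_opp T)|now apply speed_derive|lra].
- unfold Rdiv; field; lra.
Qed.

Lemma unstable_op_estimate g M : regular g -> (forall x, Rabs (g x) <= M) ->
  forall x, Rabs (unstable_op g x) <= 2 / (1 - h) * (1 + PI / total speed) * M.
Proof.
intros Hg HM x; set (M' := (1 + PI / total speed) * M).
assert (HM' := proj_bound g M Hg HM); fold M' in HM'.
assert (HM0 : 0 <= M') by (eapply Rle_trans; [apply Rabs_pos|apply (HM' 0)]).
assert (Hp := wp x); assert (Hgp := regular_proj g Hg).
assert (H : Rabs (tail_int speed (proj g) x) <= M' * (2 / (1 - h) * speed x)).
{ destruct (Rle_dec (b x) (PI / 2)) as [Hx|Hx].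
  - eapply Rle_trans; [apply (tail_speed_bound h b Hh Hb (proj g) M'); auto|].
    apply Rmult_le_compat_l; [auto|now apply speed_lower].
  - assert (E := total_split (proj g) Hgp x); rewrite total_proj in E by auto.
    replace (tail_int speed (proj g) x) with (- tail_int speed' (fun t => proj g (- t)) (- x)) by lra.
    rewrite Rabs_Ropp.
    eapply Rle_trans; [apply (tail_speed_bound h b' Hh Hb' (fun t => proj g (- t)) M');
      auto using regular_reflect|].
    apply Rmult_le_compat_l; [auto|].
    assert (H := speed_lower h b' Hh Hb' (- x)).
    rewrite speed_reflect, Ropp_involutive in H; apply H.
    unfold b'; rewrite Ropp_involutive; lra. }
unfold unstable_op; rewrite Rabs_div, Rabs_Ropp, (Rabs_pos_eq (speed x)) by lra.
apply Rmult_le_reg_r with (speed x); [exact Hp|].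
unfold Rdiv at 1; rewrite Rmult_assoc, Rinv_l, Rmult_1_r by lra.
eapply Rle_trans; [exact H|]; right; unfold M'; ring.
Qed.

Lemma proj_plus f g : regular f -> regular g -> forall x, proj (fun t => f t + g t) x = proj f x + proj g x.
Proof.
intros Hf Hg x; unfold proj; rewrite total_plus by auto; field.
apply Rgt_not_eq, total_speed_pos.
Qed.

Lemma proj_scal c f : regular f -> forall x, proj (fun t => c * f t) x = c * proj f x.
Proof.
intros Hf x; unfold proj; rewrite total_scal by auto; field.
apply Rgt_not_eq, total_speed_pos.
Qed.

Lemma unstable_op_bounded : bounded_op unstable_op.
Proof.
assert (Hc := cos_asin_pos h Hh); assert (Ht := total_speed_pos); split.
- intros f g Hf Hg x; unfold unstable_op.
  replace (proj (fun t => f t + g t)) with (fun t => proj f t + proj g t)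
    by (apply functional_extensionality; intros; now rewrite proj_plus).
  rewrite (tail_plus _ _ _ wc wp Wd Wl) by now apply regular_proj.
  unfold Rdiv; ring.
- intros c f Hf x; unfold unstable_op.
  replace (proj (fun t => c * f t)) with (fun t => c * proj f t)
    by (apply functional_extensionality; intros; now rewrite proj_scal).
  rewrite (tail_scal _ _ _ wc wp Wd Wl) by now apply regular_proj.
  unfold Rdiv; ring.
- exists (2 / (1 - h) * (1 + PI / total speed)); split.
  { assert (HP := PI_RGT_0).
    apply Rmult_le_pos; [left; apply Rdiv_lt_0_compat; lra|].
    assert (0 < PI / total speed) by now apply Rdiv_lt_0_compat. lra. }
  intros f M Hf HM x; now apply unstable_op_estimate.
- intros f Hf x; apply (ex_derive_continuous (unstable_op f)); eexists; now apply unstable_op_derive.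
- intros f Hf Hl; destruct (regular_bound f Hf) as [M HM].
  apply (ode_has_limits (unstable_op f) (fun x => cos (b x)) (proj f) (cos (asin h)) (- cos (asin h)));
    try lra.
  + now apply unstable_op_derive.
  + eexists; now apply unstable_op_estimate.
  + now apply cos_angle_lim_p.
  + now apply cos_angle_lim_m.
  + apply has_limits_plus; auto.
    apply (has_limits_mult (fun _ => _)); [apply has_limits_const|now apply has_limits_speed].
Qed.

Lemma total_op : bounded_op (fun g _ => total g).
Proof.
split.
- intros; now apply total_plus.
- intros; now apply total_scal.
- exists PI; split; [left; exact PI_RGT_0|]; intros; now apply total_bound.
- intros; apply continuous_const.
- intros; apply has_limits_const.
Qed.

End Unstable.

(** * The fixed-point formulation *)

Notation W5 := (prod_NormedModule R_AbsRing (prod_NormedModule R_AbsRing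
  (prod_NormedModule R_AbsRing (prod_NormedModule R_AbsRing R_NormedModule R_NormedModule)
     R_NormedModule) R_NormedModule) R_NormedModule).
Notation R4_NormedModule := (prod_NormedModule R_AbsRing R3_NormedModule R_NormedModule).
Notation CW := (@Cb_NormedModule W5).
Notation Zs := (prod_NormedModule R_AbsRing CW R4_NormedModule).

(** The unknowns: the increment of the in-plane angle, [r], the out-of-plane angle
    divided by [sin b], [q], and the velocity as a constant function. The second
    and the fifth are divided by the scale [d], the fourth is multiplied by it. *)
Definition w1 (w : W5) : R := fst (fst (fst (fst w))).
Definition w2 (w : W5) : R := snd (fst (fst (fst w))).
Definition w3 (w : W5) : R := snd (fst (fst w)).
Definition w4 (w : W5) : R := snd (fst w).
Definition w5 (w : W5) : R := snd w.

Lemma continuous_fst_comp {U V : UniformSpace} (f : R -> prod_UniformSpace U V) x :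
  continuous f x -> continuous (fun t => fst (f t)) x.
Proof.
intros Hf; apply (continuous_comp f fst); [exact Hf|].
destruct (f x); apply continuous_fst.
Qed.

Lemma continuous_snd_comp {U V : UniformSpace} (f : R -> prod_UniformSpace U V) x :
  continuous f x -> continuous (fun t => snd (f t)) x.
Proof.
intros Hf; apply (continuous_comp f snd); [exact Hf|].
destruct (f x); apply continuous_snd.
Qed.

Lemma continuous_pairing {U V : UniformSpace} (f : R -> U) (g : R -> V) x :
  continuous f x -> continuous g x -> continuous (fun t => (f t, g t)) x.
Proof.
intros Hf Hg.
exact (continuous_comp_2 f g (fun u v => (u, v)) x Hf Hg
  (continuous_ext (fun p : U * V => p) _ (f x, g x) (fun p => surjective_pairing p) (continuous_id _))).
Qed.

(** Linear functionals of norm at most one; continuity is stated along curves. *)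
Record coordinate {W : NormedModule R_AbsRing} (p : W -> R) : Prop := {
  co_plus : forall u v, p (plus u v) = p u + p v;
  co_scal : forall c u, p (scal c u) = c * p u;
  co_norm : forall u, Rabs (p u) <= norm u;
  co_cont : forall (f : R -> W) x, continuous f x -> continuous (fun t => p (f t)) x }.

Lemma coordinate_id : coordinate (W := R_NormedModule) (fun x => x).
Proof. split; auto; intros; apply Rle_refl. Qed.

Lemma coordinate_fst {E F : NormedModule R_AbsRing} (p : E -> R) :
  coordinate p -> coordinate (W := prod_NormedModule R_AbsRing E F) (fun w => p (fst w)).
Proof.
intros [H1 H2 H3 H4]; split.
- intros; apply (H1 (fst u) (fst v)).
- intros; apply (H2 c (fst u)).
- intros; eapply Rle_trans; [apply H3|apply (norm_fst_le u)].
- intros; apply H4; now apply (continuous_fst_comp f).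
Qed.

Lemma coordinate_snd {E F : NormedModule R_AbsRing} (p : F -> R) :
  coordinate p -> coordinate (W := prod_NormedModule R_AbsRing E F) (fun w => p (snd w)).
Proof.
intros [H1 H2 H3 H4]; split.
- intros; apply (H1 (snd u) (snd v)).
- intros; apply (H2 c (snd u)).
- intros; eapply Rle_trans; [apply H3|apply (norm_snd_le u)].
- intros; apply H4; now apply (continuous_snd_comp f).
Qed.

Lemma coordinate_w1 : coordinate w1.
Proof. exact (coordinate_fst _ (coordinate_fst _ (coordinate_fst _ (coordinate_fst _ coordinate_id)))). Qed.
Lemma coordinate_w2 : coordinate w2.
Proof. exact (coordinate_fst _ (coordinate_fst _ (coordinate_fst _ (coordinate_snd _ coordinate_id)))). Qed.
Lemma coordinate_w3 : coordinate w3.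
Proof. exact (coordinate_fst _ (coordinate_fst _ (coordinate_snd _ coordinate_id))). Qed.
Lemma coordinate_w4 : coordinate w4.
Proof. exact (coordinate_fst _ (coordinate_snd _ coordinate_id)). Qed.
Lemma coordinate_w5 : coordinate w5.
Proof. exact (coordinate_snd _ coordinate_id). Qed.

Definition p1 (L : R4_NormedModule) : R := fst (fst (fst L)).
Definition p2 (L : R4_NormedModule) : R := snd (fst (fst L)).
Definition p3 (L : R4_NormedModule) : R := snd (fst L).
Definition p4 (L : R4_NormedModule) : R := snd L.

Lemma coordinate_p1 : coordinate p1.
Proof. exact (coordinate_fst _ (coordinate_fst _ (coordinate_fst _ coordinate_id))). Qed.
Lemma coordinate_p2 : coordinate p2.
Proof. exact (coordinate_fst _ (coordinate_fst _ (coordinate_snd _ coordinate_id))). Qed.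
Lemma coordinate_p3 : coordinate p3.
Proof. exact (coordinate_fst _ (coordinate_snd _ coordinate_id)). Qed.
Lemma coordinate_p4 : coordinate p4.
Proof. exact (coordinate_snd _ coordinate_id). Qed.

Definition limits_at_infinity (X : CW) : Prop :=
  has_limits (fun x => w1 (X x)) /\ has_limits (fun x => w2 (X x)) /\
  has_limits (fun x => w3 (X x)) /\ has_limits (fun x => w4 (X x)) /\
  has_limits (fun x => w5 (X x)).

Section Smooth.

Variable L0 : R4_NormedModule.

Definition dom (z : Zs) : Prop := norm (fst z) <= 1 /\ norm (minus (snd z) L0) <= 1.
Definition settled (z : Zs) : Prop := limits_at_infinity (fst z).
Definition smooth (F : R -> Zs -> R) : Prop := exists dF, smooth_family dom settled F dF.

Lemma dom_bounded z : dom z -> norm z <= 2 + norm L0.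
Proof.
destruct z as [X L]; intros [H1 H2]; simpl in H1, H2.
eapply Rle_trans; [apply norm_pair_le|].
assert (norm L <= 1 + norm L0); [|lra].
eapply norm_of_plus; [|exact H2|apply Rle_refl]; module_in constr:(R4_NormedModule).
Qed.

Lemma smooth_field (p : W5 -> R) : coordinate p ->
  (forall X, limits_at_infinity X -> has_limits (fun x => p (X x))) ->
  smooth (fun x z => p (fst z x)).
Proof.
intros [H1 H2 H3 H4] Hl; exists (fun x _ (v : Zs) => p (fst v x)); split.
- apply (C11_linear (Y := R_NormedModule) dom (fun x (z : Zs) => p (fst z x)) (2 + norm L0)).
  + intros x u v; apply (H1 (fst u x) (fst v x)).
  + intros x c v; apply (H2 c (fst v x)).
  + exists 1; split; [lra|]; intros x v; rewrite Rmult_1_l.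
    apply Rle_trans with (norm (fst v x)); [apply H3|].
    apply Rle_trans with (norm (fst v)); [apply (Cb_norm_ge (fst v) x)|apply (norm_fst_le v)].
  + apply dom_bounded.
- intros z x _; apply H4, Cb_continuous.
- intros z v x _; apply H4, Cb_continuous.
- intros z _ Hz; apply Hl, Hz.
Qed.

Lemma smooth_param (p : R4_NormedModule -> R) : coordinate p -> smooth (fun x z => p (snd z)).
Proof.
intros [H1 H2 H3 H4]; exists (fun x _ (v : Zs) => p (snd v)); split.
- apply (C11_linear (Y := R_NormedModule) dom (fun _ (z : Zs) => p (snd z)) (2 + norm L0)).
  + intros x u v; apply (H1 (snd u) (snd v)).
  + intros x c v; apply (H2 c (snd v)).
  + exists 1; split; [lra|]; intros x v; rewrite Rmult_1_l.
    apply Rle_trans with (norm (snd v)); [apply H3|apply (norm_snd_le v)].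
  + apply dom_bounded.
- intros; apply continuous_const.
- intros; apply continuous_const.
- intros; apply has_limits_const.
Qed.

Lemma smooth_w1 : smooth (fun x z => w1 (fst z x)).
Proof. apply smooth_field; [apply coordinate_w1|unfold limits_at_infinity; tauto]. Qed.
Lemma smooth_w2 : smooth (fun x z => w2 (fst z x)).
Proof. apply smooth_field; [apply coordinate_w2|unfold limits_at_infinity; tauto]. Qed.
Lemma smooth_w3 : smooth (fun x z => w3 (fst z x)).
Proof. apply smooth_field; [apply coordinate_w3|unfold limits_at_infinity; tauto]. Qed.
Lemma smooth_w4 : smooth (fun x z => w4 (fst z x)).
Proof. apply smooth_field; [apply coordinate_w4|unfold limits_at_infinity; tauto]. Qed.
Lemma smooth_w5 : smooth (fun x z => w5 (fst z x)).
Proof. apply smooth_field; [apply coordinate_w5|unfold limits_at_infinity; tauto]. Qed.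

Lemma smooth_p1 : smooth (fun _ z => p1 (snd z)).
Proof. apply smooth_param, coordinate_p1. Qed.
Lemma smooth_p2 : smooth (fun _ z => p2 (snd z)).
Proof. apply smooth_param, coordinate_p2. Qed.
Lemma smooth_p3 : smooth (fun _ z => p3 (snd z)).
Proof. apply smooth_param, coordinate_p3. Qed.
Lemma smooth_p4 : smooth (fun _ z => p4 (snd z)).
Proof. apply smooth_param, coordinate_p4. Qed.

Lemma smooth_fun (c : R -> R) : regular c -> has_limits c -> smooth (fun x _ => c x).
Proof. intros; eexists; now apply sf_const. Qed.

Lemma smooth_const (c : R) : smooth (fun _ _ => c).
Proof. apply (smooth_fun (fun _ => c)); [apply regular_const|apply has_limits_const]. Qed.

Lemma smooth_plus F G : smooth F -> smooth G -> smooth (fun x z => F x z + G x z).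
Proof. intros [dF HF] [dG HG]; eexists; apply (sf_plus _ _ F G _ _ HF HG). Qed.

Lemma smooth_minus F G : smooth F -> smooth G -> smooth (fun x z => F x z - G x z).
Proof. intros [dF HF] [dG HG]; eexists; apply (sf_minus _ _ F G _ _ HF HG). Qed.

Lemma smooth_mult F G : smooth F -> smooth G -> smooth (fun x z => F x z * G x z).
Proof. intros [dF HF] [dG HG]; eexists; apply (sf_mult _ _ F G _ _ HF HG). Qed.

Lemma smooth_opp F : smooth F -> smooth (fun x z => - F x z).
Proof. intros [dF HF]; eexists; apply (sf_opp _ _ F _ HF). Qed.

Lemma smooth_sin F : smooth F -> smooth (fun x z => sin (F x z)).
Proof.
intros [dF HF]; eexists.
apply (sf_real _ _ (fun _ => True) sin cos (fun x => - sin x) 1 F dF); auto.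
- apply closed_true.
- intros; apply is_derive_sin.
- intros; apply is_derive_cos.
- intros x _; rewrite Rabs_Ropp; repeat split; apply Rabs_le;
    (apply SIN_bound || apply COS_bound).
Qed.

Lemma smooth_cos F : smooth F -> smooth (fun x z => cos (F x z)).
Proof.
intros [dF HF]; eexists.
apply (sf_real _ _ (fun _ => True) cos (fun x => - sin x) (fun x => - cos x) 1 F dF); auto.
- apply closed_true.
- intros; apply is_derive_cos.
- intros x _; apply (is_derive_opp sin), is_derive_sin.
- intros x _; rewrite !Rabs_Ropp; repeat split; apply Rabs_le;
    (apply SIN_bound || apply COS_bound).
Qed.

Lemma cos_ge_half x : Rabs x <= 1 -> 1 / 2 <= cos x.
Proof.
assert (H : forall y, 0 <= y <= 1 -> 1 / 2 <= cos y).
{ intros y Hy.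
  assert (sin_le : forall t, 0 <= t -> sin t <= t).
  { intros t Ht; destruct (Req_dec t 0) as [->|]; [rewrite sin_0; lra|].
    left; apply sin_lt_x; lra. }
  assert (K : cos 0 + 0 ^ 2 / 2 <= cos y + y ^ 2 / 2).
  { apply (incr_of_derive (fun t => cos t + t ^ 2 / 2) (fun t => - sin t + t)); try lra.
    - intros t _; auto_derive; [exact I|field].
    - intros t Ht; specialize (sin_le t ltac:(lra)); lra. }
  rewrite cos_0 in K; nra. }
intros Hx; destruct (Rle_dec 0 x).
- apply H; rewrite Rabs_pos_eq in Hx; lra.
- rewrite <- cos_neg; apply H; rewrite Rabs_left in Hx; lra.
Qed.

Lemma smooth_sec F : smooth F -> (forall x z, dom z -> Rabs (F x z) <= 1) ->
  smooth (fun x z => / cos (F x z)).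
Proof.
intros HF Hb; destruct (smooth_cos F HF) as [dF HC]; eexists.
apply (sf_real _ _ (fun x => 1 / 2 <= x) Rinv (fun x => - / x ^ 2) (fun x => 2 / x ^ 3) 16
         (fun x z => cos (F x z)) dF); auto.
- intros; lra.
- apply closed_ge.
- intros x Hx; auto_derive; [lra|field; lra].
- intros x Hx; auto_derive; [apply Rgt_not_eq; apply Rmult_lt_0_compat; lra|field; lra].
- intros x Hx.
  assert (Hi : 0 < / x <= 2).
  { split; [apply Rinv_0_lt_compat; lra|].
    replace 2 with (/ (1 / 2)) by field; apply Rinv_le_contravar; lra. }
  rewrite Rabs_Ropp, !Rabs_pos_eq.
  + replace (2 / x ^ 3) with (2 * / x * / x * / x) by (field; lra).
    replace (/ x ^ 2) with (/ x * / x) by (field; lra).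
    repeat split; nra.
  + replace (2 / x ^ 3) with (2 * / x * / x * / x) by (field; lra).
    repeat apply Rmult_le_pos; lra.
  + replace (/ x ^ 2) with (/ x * / x) by (field; lra); apply Rmult_le_pos; lra.
  + lra.
- intros x z Hz; apply cos_ge_half; auto.
Qed.

End Smooth.

Ltac smooth_step :=
  first
  [ assumption
  | apply smooth_w1 | apply smooth_w2 | apply smooth_w3 | apply smooth_w4 | apply smooth_w5
  | apply smooth_p1 | apply smooth_p2 | apply smooth_p3 | apply smooth_p4
  | apply smooth_const
  | lazymatch goal with
    | |- smooth ?L (fun x z => @?A x z + @?B x z) => apply (smooth_plus L A B)
    | |- smooth ?L (fun x z => @?A x z - @?B x z) => apply (smooth_minus L A B)
    | |- smooth ?L (fun x z => @?A x z * @?B x z) => apply (smooth_mult L A B)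
    | |- smooth ?L (fun x z => - @?A x z) => apply (smooth_opp L A)
    | |- smooth ?L (fun x z => sin (@?A x z)) => apply (smooth_sin L A)
    | |- smooth ?L (fun x z => cos (@?A x z)) => apply (smooth_cos L A)
    | |- smooth ?L (fun x z => / cos (@?A x z)) => apply (smooth_sec L A)
    end ].

(** Cauchy's criterion passes to uniform limits. *)
Lemma cauchy_has_limits (f : R -> R) :
  (forall eps, 0 < eps -> exists g, has_limits g /\ forall x, Rabs (f x - g x) <= eps) ->
  has_limits f.
Proof.
intros H.
assert (C : forall F, ProperFilter F ->
  (forall g, has_limits g -> exists l : R, filterlim g F (locally l)) ->
  exists l : R, filterlim f F (locally l)).
{ intros F HF Hg.
  apply (proj1 (filterlim_locally_cauchy (U := R_CompleteSpace) (F := F) f)).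
  intros [eps He]; destruct (H (eps / 4)) as [g [Hl Hfg]]; [lra|].
  destruct (Hg g Hl) as [l Hgl].
  assert (He4 : 0 < eps / 4) by lra.
  exists (fun x => Rabs (g x - l) < eps / 4); split.
  - exact (proj1 (filterlim_locally g l) Hgl (mkposreal _ He4)).
  - intros u v Hu Hv; change (Rabs (f v - f u) < eps).
    assert (H1 := Hfg u); assert (H2 := Hfg v).
    apply Rabs_le_between in H1; apply Rabs_le_between in H2.
    apply Rabs_def2 in Hu; apply Rabs_def2 in Hv; apply Rabs_def1; lra. }
split; [apply (C (Rbar_locally p_infty))|apply (C (Rbar_locally m_infty))]; try typeclasses eauto.
- intros g [Hg _]; exact Hg.
- intros g [_ Hg]; exact Hg.
Qed.

Lemma limits_at_infinity_closed : norm_closed limits_at_infinity.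
Proof.
intros X H.
assert (C : forall p : W5 -> R, coordinate p ->
   (forall Y, limits_at_infinity Y -> has_limits (fun x => p (Y x))) ->
   has_limits (fun x => p (X x))).
{ intros p Hp Hl; apply cauchy_has_limits; intros eps He.
  destruct (H eps He) as [Y [HY Hn]]; exists (fun x => p (Y x)); split; [auto|].
  intros x; eapply Rle_trans; [|exact Hn].
  eapply Rle_trans; [|apply (Cb_norm_ge (minus X Y) x)].
  eapply Rle_trans; [|apply (co_norm p Hp)]; right; f_equal.
  change (minus X Y x) with (plus (X x) (opp (Y x))).
  rewrite (co_plus p Hp).
  replace (p (opp (Y x))) with (p (scal (-1) (Y x))).
  - rewrite (co_scal p Hp); ring.
  - f_equal; exact (scal_opp_one (Y x)). }
unfold limits_at_infinity in *; repeat split; apply C; auto using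
  coordinate_w1, coordinate_w2, coordinate_w3, coordinate_w4, coordinate_w5; tauto.
Qed.

Lemma limits_at_infinity_zero : limits_at_infinity zero.
Proof. repeat split; try (apply (has_limits_const 0)); exists 0; apply is_lim_const. Qed.

(** This identifies the derivative at the base point without looking into its
    construction: a function of one real variable has to be differentiated. *)
Lemma smooth_directional {L0 F dF} (X : CW) : smooth_family (dom L0) settled F dF ->
  forall x, is_derive (fun t : R => F x (plus ((zero, L0) : Zs) (scal t (X, zero)))) 0
              (dF x (zero, L0) (X, zero)).
Proof.
intros [HF _ _ _] x.
set (e := (X, zero) : Zs); set (z := fun t : R => plus ((zero, L0) : Zs) (scal t e)).
assert (Ez : z 0 = (zero, L0)).
{ unfold z; transitivity (plus ((zero, L0) : Zs) (zero : Zs)); [f_equal; exact (scal_zero_l _)|].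
  apply plus_zero_r. }
assert (HD : locally (z 0) (dom L0)).
{ rewrite Ez; generalize (locally_norm_lt ((zero, L0) : Zs) 1 Rlt_0_1); apply filter_imp.
  intros [Y L] HY; split; simpl.
  - apply Rle_trans with (norm (minus ((Y, L) : Zs) (zero, L0))); [|lra].
    eapply Rle_trans; [|apply (norm_fst_le (minus ((Y, L) : Zs) (zero, L0)))].
    right; f_equal; change (Y = minus Y zero); module_in constr:(CW).
  - apply Rle_trans with (norm (minus ((Y, L) : Zs) (zero, L0))); [|lra].
    apply (norm_snd_le (minus ((Y, L) : Zs) (zero, L0))). }
assert (Hz : filterdiff (fun t : R => z t) (locally (0 : R)) (fun t : R => scal t e)).
{ apply filterdiff_ext_lin with (l1 := fun t : R => plus (zero : Zs) (scal t e));
    [|intros t; apply plus_zero_l].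
  apply (filterdiff_plus_fct (fun _ : R => (zero, L0) : Zs) (fun t : R => scal t e));
    [apply filterdiff_const|].
  exact (filterdiff_linear (K := R_AbsRing) (U := R_NormedModule) (V := Zs) (fun t => scal t e)
    (is_linear_scal_l (K := R_AbsRing) (V := Zs) e)). }
assert (H := filterdiff_comp' z (F x) 0 _ _ Hz (C11_filterdiff _ _ _ x (z 0) HF HD)).
rewrite Ez in H; apply (filterdiff_ext_lin _ _ _ H).
intros t; rewrite (C11_hom _ _ _ HF); [reflexivity|].
rewrite <- Ez; exact (locally_singleton _ _ HD).
Qed.

(** * The contraction near the static profile *)

Section Problem.

Variables (alpha h e2 e3 : R) (b : R -> R) (x0 d : R).
Hypothesis Halpha : 0 < alpha.
Hypothesis Hh : 0 < h < 1.
Hypothesis He : e2 ^ 2 + e3 ^ 2 = 1.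
Hypothesis Hb : static_angle h b.
Hypothesis Hx0 : b x0 = PI / 2.
(* small enough for the off-diagonal terms of [rate_bound] to stay below [h / 20] *)
Hypothesis Hd : d = h ^ 2 * (1 - h) / 100.

Definition base_point : R4_NormedModule := (0, h * e2, h * e3, 0).

(** With [be] and [y] the two angles, [be' = h - sin be + r] and
    [y' = - 2 y + q], these are the values of [r'] and of [4 y - y''] prescribed
    by the travelling-wave equation. *)
Definition in_plane (be r y q V H1 H2 H3 K : R) : R :=
  cos be * r + h * cos be
  + 2 * (sin y * / cos y) * (h - sin be + r) * (-2 * y + q)
  + K * (e2 * sin be - e3 * (sin y * / cos y)) * (e2 * cos be)
  + / cos y * (H1 * sin be - (H2 * e2 + H3 * e3) * cos be)
  - V * / cos y * (-2 * y + q) - alpha * V * (h - sin be + r).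

Definition out_of_plane (be r y q V H1 H2 H3 K : R) : R :=
  4 * y - (- (sin y * cos y) * ((h - sin be + r) * (h - sin be + r))
    + sin y * cos y * (cos be * cos be)
    + K * (e2 * cos y * sin be - e3 * sin y) * (- e2 * sin y * sin be - e3 * cos y)
    + H1 * sin y * cos be + (H2 * e2 + H3 * e3) * sin y * sin be
    - (H3 * e2 - H2 * e3) * cos y
    + V * cos y * (h - sin be + r) - alpha * V * (-2 * y + q)).

(** The right-hand sides once the linear parts inverted by the operators below are
    removed: [cos b * r] and the velocity term for [r], [2 * q] for [q], and
    [- cos b * B] for the increment of the angle. *)
Definition force_r (x : R) (z : Zs) : R :=
  in_plane (b x + w1 (fst z x)) (d * w2 (fst z x)) (sin (b x) * w3 (fst z x))
    (/ d * w4 (fst z x)) (d * w5 (fst z x))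
    (p1 (snd z)) (p2 (snd z)) (p3 (snd z)) (p4 (snd z))
  - cos (b x) * (d * w2 (fst z x)) - alpha * (d * w5 (fst z x)) * (sin (b x) - h).

Definition force_q (x : R) (z : Zs) : R :=
  out_of_plane (b x + w1 (fst z x)) (d * w2 (fst z x)) (sin (b x) * w3 (fst z x))
    (/ d * w4 (fst z x)) (d * w5 (fst z x))
    (p1 (snd z)) (p2 (snd z)) (p3 (snd z)) (p4 (snd z)).

Definition force_angle (x : R) (z : Zs) : R :=
  d * w2 (fst z x)
  + (sin (b x) - sin (b x + w1 (fst z x)) + cos (b x) * w1 (fst z x)).

Notation D := (dom base_point).

Lemma smooth_angle : smooth base_point (fun x _ => b x).
Proof.
apply smooth_fun.
- split; [intros; apply (angle_cont h b Hb)|]; exists PI; intros x.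
  assert (Ha := asin_range h Hh); assert (H1 := angle_lower h b Hh Hb x).
  assert (H2 := angle_lower h _ Hh (static_angle_reflect h b Hb) (- x)); cbv beta in H2.
  rewrite Ropp_involutive in H2; apply Rabs_le; lra.
- destruct Hb as [_ [H1 H2]]; split; eexists; eassumption.
Qed.

Lemma w_le (p : W5 -> R) (X : CW) x : coordinate p -> Rabs (p (X x)) <= norm X.
Proof.
intros Hp; eapply Rle_trans; [apply (co_norm p Hp)|apply (Cb_norm_ge X x)].
Qed.

Lemma psi_small x (z : Zs) : D z -> Rabs (sin (b x) * w3 (fst z x)) <= 1.
Proof.
intros [Hz _]; replace 1 with (1 * 1) by ring; apply Rabs_mult_le.
- apply Rabs_le, SIN_bound.
- eapply Rle_trans; [apply (w_le w3), coordinate_w3|exact Hz].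
Qed.

Lemma smooth_force_r : smooth base_point force_r.
Proof.
assert (HA := smooth_angle).
assert (Hs := smooth_sin _ _ HA); assert (Hc := smooth_cos _ _ HA); cbv beta in *.
unfold force_r, in_plane; repeat smooth_step; apply psi_small.
Qed.

Lemma smooth_force_q : smooth base_point force_q.
Proof.
assert (HA := smooth_angle).
unfold force_q, out_of_plane; repeat smooth_step.
Qed.

Lemma smooth_force_angle : smooth base_point force_angle.
Proof.
assert (HA := smooth_angle).
unfold force_angle; repeat smooth_step.
Qed.

Lemma d_pos : 0 < d.
Proof. rewrite Hd; apply Rdiv_lt_0_compat; [apply Rmult_lt_0_compat; nra|lra]. Qed.

Lemma field_direction (p : W5 -> R) (X : CW) (t x : R) : coordinate p ->
  p (fst (plus ((zero, base_point) : Zs) (scal t (X, zero))) x) = t * p (X x).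
Proof.
intros Hp; rewrite <- (co_scal p Hp); f_equal.
transitivity (plus (zero : W5) (scal t (X x))); [reflexivity|].
module_in constr:(W5).
Qed.

Lemma param_direction (X : CW) (t : R) :
  snd (plus ((zero, base_point) : Zs) (scal t (X, zero))) = base_point.
Proof.
transitivity (plus base_point (scal t (zero : R4_NormedModule))); [reflexivity|].
module_in constr:(R4_NormedModule).
Qed.

Ltac to_direction :=
  rewrite param_direction, ?(field_direction w1), ?(field_direction w2), ?(field_direction w3),
    ?(field_direction w4), ?(field_direction w5)
    by auto using coordinate_w1, coordinate_w2, coordinate_w3, coordinate_w4, coordinate_w5;
  reflexivity.

(** The first-order terms cancel, because the static angle solves the equation for
    the field [h * (e2, e3)] and out-of-plane perturbations enter quadratically. *)
Lemma force_r_directional (X : CW) x :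
  is_derive (fun t : R => force_r x (plus ((zero, base_point) : Zs) (scal t (X, zero)))) 0 0.
Proof.
apply (is_derive_ext (fun t : R => in_plane (b x + t * w1 (X x)) (d * (t * w2 (X x)))
  (sin (b x) * (t * w3 (X x))) (/ d * (t * w4 (X x))) (d * (t * w5 (X x)))
  0 (h * e2) (h * e3) 0
  - cos (b x) * (d * (t * w2 (X x))) - alpha * (d * (t * w5 (X x))) * (sin (b x) - h))).
{ intros t; unfold force_r; to_direction. }
generalize (w1 (X x)) (w2 (X x)) (w3 (X x)) (w4 (X x)) (w5 (X x)); intros B r v q V.
unfold in_plane; auto_derive.
- rewrite !Rmult_0_l, !Rmult_0_r, cos_0; repeat split; lra.
- rewrite !Rmult_0_l, !Rmult_0_r, cos_0, sin_0, !Rplus_0_r.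
  assert (Hd0 := d_pos); assert (He3 : e3 ^ 2 = 1 - e2 ^ 2) by lra.
  field_simplify; [|lra]; rewrite He3; field; lra.
Qed.

(** Four minus the potential of the out-of-plane linearization at the static
    profile. *)
Definition excess (x : R) : R := 4 + angle_speed h b x ^ 2 - cos (b x) ^ 2 - h * sin (b x).

Lemma force_q_directional (X : CW) x :
  is_derive (fun t : R => force_q x (plus ((zero, base_point) : Zs) (scal t (X, zero)))) 0
    (excess x * (sin (b x) * w3 (X x))
     + angle_speed h b x * (d * w5 (X x))).
Proof.
apply (is_derive_ext (fun t : R => out_of_plane (b x + t * w1 (X x)) (d * (t * w2 (X x)))
  (sin (b x) * (t * w3 (X x))) (/ d * (t * w4 (X x))) (d * (t * w5 (X x)))
  0 (h * e2) (h * e3) 0)).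
{ intros t; unfold force_q; to_direction. }
generalize (w1 (X x)) (w2 (X x)) (w3 (X x)) (w4 (X x)) (w5 (X x)); intros B r v q V.
unfold out_of_plane, excess, angle_speed; auto_derive; [exact I|].
rewrite !Rmult_0_l, !Rmult_0_r, cos_0, sin_0, !Rplus_0_r.
assert (Hd0 := d_pos); assert (He3 : e3 ^ 2 = 1 - e2 ^ 2) by lra.
field_simplify; [|lra]; rewrite He3; field; lra.
Qed.

Lemma force_angle_directional (X : CW) x :
  is_derive (fun t : R => force_angle x (plus ((zero, base_point) : Zs) (scal t (X, zero)))) 0
    (d * w2 (X x)).
Proof.
apply (is_derive_ext (fun t : R => d * (t * w2 (X x))
  + (sin (b x) - sin (b x + t * w1 (X x)) + cos (b x) * (t * w1 (X x))))).
{ intros t; unfold force_angle.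
  rewrite (field_direction w1), (field_direction w2)
    by auto using coordinate_w1, coordinate_w2; reflexivity. }
auto_derive; [exact I|].
rewrite !Rmult_0_l, !Rplus_0_r; ring.
Qed.

Notation speed := (angle_speed h b).
Notation total := (total h b).

(** The factors [d] and [/ d] implement the scaling of the unknowns. *)
Definition angle_op (g : R -> R) : R -> R := stable_op h b x0 g.
Definition r_op (g : R -> R) (x : R) : R := / d * unstable_op h b g x.
Definition psi_op (g : R -> R) (x : R) : R := / sin (b x) * Sp (Sm g) x.
Definition q_op (g : R -> R) (x : R) : R := d * Sm g x.
Definition velocity_op (g : R -> R) (x : R) : R := - / (d * alpha * total speed) * total g.

Lemma bounded_op_scal c A : bounded_op A -> bounded_op (fun g x => c * A g x).
Proof.
intros HA; apply (bounded_op_comp (fun f x => c * f x) A); [|exact HA].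
apply (bounded_op_mul (fun _ => c)); [apply regular_const|apply has_limits_const].
Qed.

Lemma inv_sin_angle : regular (fun x => / sin (b x)) /\ has_limits (fun x => / sin (b x)).
Proof.
assert (Hs := sin_angle_bounds h b Hh Hb).
assert (ci : forall y, y <> 0 -> continuous Rinv y).
{ intros y Hy; apply (ex_derive_continuous Rinv); auto_derive; exact Hy. }
split; [split|split].
- intros x; apply (continuous_comp (fun x => sin (b x)) Rinv);
    [apply (proj1 (regular_sin_angle h b Hb))|apply ci; specialize (Hs x); lra].
- exists (/ h); intros x; specialize (Hs x).
  change (Rabs (/ sin (b x)) <= / h); rewrite Rabs_pos_eq.
  + apply Rinv_le_contravar; lra.
  + left; apply Rinv_0_lt_compat; lra.
- exists (/ h); apply (is_lim_comp_continuous (fun x => sin (b x)) Rinv p_infty h);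
    [now apply sin_angle_lim_p|apply ci; lra].
- exists (/ h); apply (is_lim_comp_continuous (fun x => sin (b x)) Rinv m_infty h);
    [now apply sin_angle_lim_m|apply ci; lra].
Qed.

Lemma angle_op_bounded : bounded_op angle_op.
Proof. now apply stable_op_bounded. Qed.
Lemma r_op_bounded : bounded_op r_op.
Proof. now apply bounded_op_scal, unstable_op_bounded. Qed.
Lemma psi_op_bounded : bounded_op psi_op.
Proof.
apply (bounded_op_comp (fun f x => / sin (b x) * f x) (fun g => Sp (Sm g))).
- apply bounded_op_mul; apply inv_sin_angle.
- apply (bounded_op_comp Sp Sm); [apply Sp_op|apply Sm_op].
Qed.
Lemma q_op_bounded : bounded_op q_op.
Proof. apply bounded_op_scal, Sm_op. Qed.
Lemma velocity_op_bounded : bounded_op velocity_op.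
Proof. now apply (bounded_op_scal _ (fun g _ => total g)), total_op. Qed.

Definition fixed_point_map (x : R) (z : Zs) : W5 :=
  (angle_op (fun y => force_angle y z) x, r_op (fun y => force_r y z) x, psi_op (fun y => force_q y z) x,
   q_op (fun y => force_q y z) x, velocity_op (fun y => force_r y z) x).

Definition fixed_point_operator (z : Zs) : CW := toCb (W := W5) (fun x => fixed_point_map x z).

(** The out-of-plane operator maps [sin b] to [h], which reads
    [excess * sin b = 4 * sin b - (sin b)'' - h]; the resolvent inverts
    [4 * w - w''] and maps the constant [h] to [h / 4]. *)
Lemma resolvent_supersolution x :
  Sp (Sm (fun y => excess y * sin (b y))) x
    = sin (b x) - h / 4.
Proof.
assert (gs := regular_sin_angle h b Hb); assert (gc := regular_cos_angle h b Hb);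
  assert (gp := regular_speed h b Hb).
set (s1 := fun y => -1 * (speed y * cos (b y))).
set (s2 := fun y => speed y * (cos (b y) * cos (b y)) + -1 * (speed y * (speed y * sin (b y)))).
assert (g1 : regular s1) by (unfold s1; auto using regular_scal, regular_mult).
assert (g2 : regular s2) by (unfold s2; auto using regular_scal, regular_mult, regular_plus).
assert (D1 : forall y, is_derive (fun y => sin (b y)) y (s1 y)).
{ intros y; apply is_derive_eq with (- speed y * cos (b y));
    [now apply sin_angle_derive|unfold s1; ring]. }
assert (D2 : forall y, is_derive s1 y (s2 y)).
{ intros y; unfold s1.
  apply is_derive_eq with
    (-1 * ((- cos (b y) * speed y) * cos (b y) + speed y * (speed y * sin (b y))));
    [|unfold s2; ring].
  apply (is_derive_scal (fun y => speed y * cos (b y))).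
  apply (is_derive_mult speed (fun y => cos (b y)));
    [now apply speed_derive|now apply cos_angle_derive|intros; apply Rmult_comm]. }
set (c1 := fun _ : R => - (h / 2)).
assert (gc1 : regular c1) by apply regular_const.
set (u := fun y => 2 * sin (b y) + s1 y).
assert (gu : regular u) by (unfold u; auto using regular_plus, regular_scal).
set (u' := fun y => 2 * s1 y + s2 y).
assert (gu' : regular u') by (unfold u'; auto using regular_plus, regular_scal).
assert (Du : forall y, is_derive u y (u' y)).
{ intros y; apply (is_derive_plus (fun y => 2 * sin (b y)) s1); [|apply D2].
  apply (is_derive_scal (fun y => sin (b y))), D1. }
assert (gz : regular (fun _ => 0)) by apply regular_const.
assert (E : Sm (fun y => excess y * sin (b y))
            = (fun y => u y + c1 y)).
{ apply functional_extensionality; intros y.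
  rewrite <- (Sm_inverse (fun y => u y + c1 y) (fun y => u' y + 0)); auto using regular_plus.
  - f_equal; apply functional_extensionality; intros t; unfold excess, u, u', s1, s2, c1.
    assert (E := sin2_cos2 (b t)); unfold Rsqr in E; unfold angle_speed.
    nra.
  - intros t; apply (is_derive_plus u c1); [apply Du|apply (is_derive_const (- (h / 2)))]. }
rewrite E; unfold Rminus.
rewrite <- (Sp_inverse (fun y => sin (b y) + - (h / 4)) (fun y => s1 y + 0));
  auto using regular_plus, regular_const.
- f_equal; apply functional_extensionality; intros t; unfold u, s1, c1; field.
- intros t; apply (is_derive_plus (fun y => sin (b y)) (fun _ => - (h / 4)));
    [apply D1|apply (is_derive_const (- (h / 4)))].
Qed.

Lemma op_zero A f x : bounded_op A -> regular f -> (forall y, f y = 0) -> A f x = 0.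
Proof.
intros HA Hf H0; destruct (op_bound _ HA) as [C [_ H]].
assert (H1 := H f 0 Hf ltac:(intros; rewrite H0, Rabs_R0; lra) x).
rewrite Rmult_0_r in H1; apply Rabs_le_between in H1; lra.
Qed.

Lemma W5_norm_le (a1 a2 a3 a4 a5 c1 c2 c3 c4 c5 : R) :
  Rabs a1 <= c1 -> Rabs a2 <= c2 -> Rabs a3 <= c3 -> Rabs a4 <= c4 -> Rabs a5 <= c5 ->
  norm ((a1, a2, a3, a4, a5) : W5) <= c1 + c2 + c3 + c4 + c5.
Proof.
intros; eapply Rle_trans; [apply norm_pair_le|]; apply Rplus_le_compat; [|assumption].
eapply Rle_trans; [apply norm_pair_le|]; apply Rplus_le_compat; [|assumption].
eapply Rle_trans; [apply norm_pair_le|]; apply Rplus_le_compat; [|assumption].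
eapply Rle_trans; [apply norm_pair_le|]; apply Rplus_le_compat; assumption.
Qed.

Lemma q_op_estimate g M : regular g -> (forall x, Rabs (g x) <= M) -> forall x, Rabs (q_op g x) <= d * (M / 2).
Proof.
intros Hg HM x; apply Rabs_mult_le; [rewrite Rabs_pos_eq; [lra|left; apply d_pos]|].
now apply Sm_bound.
Qed.

Lemma excess_bounds x :
  0 <= excess x <= 5.
Proof.
unfold excess; assert (Hs := sin_angle_bounds h b Hh Hb x); assert (Hc := COS_bound (b x)).
assert (0 < speed x < 1) by (unfold angle_speed; lra); nra.
Qed.

(** The resolvent is positive, so a bound of [g] by [n * excess * sin b + m] is
    transported to the solution, and [sin b - h / 4 <= (1 - h / 4) * sin b]. *)
Lemma psi_op_estimate g (n m : R) : regular g -> 0 <= n -> 0 <= m ->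
  (forall x, Rabs (g x) <= n * (excess x * sin (b x)) + m) ->
  forall x, Rabs (psi_op g x) <= n * (1 - h / 4) + m / (4 * h).
Proof.
intros Hg Hn Hm HG x.
assert (gs := regular_sin_angle h b Hb); assert (gc := regular_cos_angle h b Hb);
  assert (gp := regular_speed h b Hb).
set (k := fun y => excess y * sin (b y)).
assert (gk : regular k).
{ unfold k.
  unfold excess.
  replace (fun y => (4 + speed y ^ 2 - cos (b y) ^ 2 - h * sin (b y)) * sin (b y))
    with (fun y => (4 + speed y * speed y + -1 * (cos (b y) * cos (b y)) + - h * sin (b y)) * sin (b y))
    by (apply functional_extensionality; intros; ring).
  apply regular_mult; auto; apply regular_plus; [|now apply regular_scal].
  apply regular_plus; [apply (regular_plus (fun _ => 4)); auto using regular_const, regular_mult|].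
  apply regular_scal; auto using regular_mult. }
assert (HK : bounded_op (fun f => Sp (Sm f))) by (apply bounded_op_comp; [apply Sp_op|apply Sm_op]).
set (G := fun y => n * k y + m).
assert (gG : regular G) by (apply regular_plus; [now apply regular_scal|apply regular_const]).
assert (mono : forall f, regular f -> (forall y, f y <= G y) ->
           Sp (Sm f) x <= n * (sin (b x) - h / 4) + m / 4).
{ intros f Hf H; apply Rle_trans with (Sp (Sm G) x).
  - apply Sp_le; [apply op_regular; auto using Sm_op|apply op_regular; auto using Sm_op|].
    apply Sm_le; auto.
  - unfold G; rewrite (op_plus _ HK (fun y => n * k y) (fun _ => m))
      by auto using regular_scal, regular_const.
    rewrite (op_scal _ HK n k) by auto.
    unfold k at 1; rewrite resolvent_supersolution.
    apply Rplus_le_compat_l.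
    eapply Rle_trans; [apply Rle_abs|].
    replace (m / 4) with (m / 2 / 2) by field.
    apply Sp_bound; [apply op_regular; auto using Sm_op, regular_const|].
    apply Sm_bound; [apply regular_const|].
    intros; rewrite Rabs_pos_eq; lra. }
assert (H1 : Sp (Sm g) x <= n * (sin (b x) - h / 4) + m / 4).
{ apply mono; auto; intros y; eapply Rle_trans; [apply Rle_abs|apply HG]. }
assert (H2 : -1 * Sp (Sm g) x <= n * (sin (b x) - h / 4) + m / 4).
{ rewrite <- (op_scal _ HK (-1) g) by auto.
  apply mono; [now apply regular_scal|]; intros y.
  apply Rle_trans with (Rabs (g y)); [|apply HG].
  rewrite <- Rabs_Ropp; eapply Rle_trans; [|apply Rle_abs]; lra. }
assert (Hs := sin_angle_bounds h b Hh Hb x).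
unfold psi_op; rewrite Rabs_mult, Rabs_pos_eq by (left; apply Rinv_0_lt_compat; lra).
apply Rmult_le_reg_l with (sin (b x)); [lra|].
rewrite <- Rmult_assoc, Rinv_r, Rmult_1_l by lra.
apply Rle_trans with (n * (sin (b x) - h / 4) + m / 4); [apply Rabs_le; lra|].
rewrite Rmult_plus_distr_l; apply Rplus_le_compat.
- assert (0 <= n * (h / 4) * (1 - sin (b x))) by (apply Rmult_le_pos; [apply Rmult_le_pos|]; lra).
  nra.
- apply Rmult_le_reg_r with (4 * h); [lra|].
  replace (m / 4 * (4 * h)) with (m * h) by field.
  replace (sin (b x) * (m / (4 * h)) * (4 * h)) with (m * sin (b x)) by (field; lra).
  apply Rmult_le_compat_l; lra.
Qed.

Definition rate : R := 1 - h / 10.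

Lemma rate_bound n : 0 <= n ->
  d * n / (1 - h) + 0 + (n * (1 - h / 4) + d * n / (4 * h)) + d * ((5 + d) * n / 2) + 0
    <= rate * n.
Proof.
intros Hn; assert (Hd0 := d_pos).
assert (E1 : d * n / (1 - h) = h * h / 100 * n) by (rewrite Hd; field; lra).
assert (E2 : d * n / (4 * h) = h * (1 - h) / 400 * n) by (rewrite Hd; field; lra).
assert (d1 : d <= h / 100).
{ rewrite Hd; apply Rmult_le_compat_r; [lra|]; assert (0 <= h * (1 - h)) by nra; nra. }
rewrite E1, E2; unfold rate.
assert (h * h / 100 * n <= h / 100 * n) by (apply Rmult_le_compat_r; nra).
assert (h * (1 - h) / 400 * n <= h / 400 * n) by (apply Rmult_le_compat_r; nra).
assert (d * ((5 + d) * n / 2) <= h / 100 * (6 * n / 2)).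
{ apply Rmult_le_compat; try lra; [apply Rmult_le_pos; [apply Rmult_le_pos; lra|lra]|].
  apply Rmult_le_compat_r; [lra|]; apply Rmult_le_compat_r; lra. }
nra.
Qed.

(** At the base point the derivative of the map has one diagonal entry, of norm
    [1 - h / 4], and off-diagonal entries that the scaling makes small. *)
Theorem profile_family :
  exists rho (X : R4_NormedModule -> CW) (dX : R4_NormedModule -> R4_NormedModule -> CW),
    0 < rho <= 1 /\
    C11 (I := unit) (fun p => norm (minus p base_point) <= rho) (fun _ => X) (fun _ => dX) /\
    X base_point = zero /\
    forall p, norm (minus p base_point) <= rho ->
      norm (X p) <= 1 /\ (forall x, X p x = fixed_point_map x (X p, p)) /\ limits_at_infinity (X p).
Proof.
destruct smooth_force_angle as [dNb HNb], smooth_force_r as [dNr HNr], smooth_force_q as [dNf HNf].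
assert (F1 := sf_op _ _ angle_op _ _ angle_op_bounded HNb).
assert (F2 := sf_op _ _ r_op _ _ r_op_bounded HNr).
assert (F3 := sf_op _ _ psi_op _ _ psi_op_bounded HNf).
assert (F4 := sf_op _ _ q_op _ _ q_op_bounded HNf).
assert (F5 := sf_op _ _ velocity_op _ _ velocity_op_bounded HNr).
set (dTf := fun (x : R) (z v : Zs) =>
  (angle_op (fun y => dNb y z v) x, r_op (fun y => dNr y z v) x, psi_op (fun y => dNf y z v) x,
   q_op (fun y => dNf y z v) x, velocity_op (fun y => dNr y z v) x) : W5).
assert (HC : C11 (Y := W5) D fixed_point_map dTf).
{ exact (C11_pair D _ _ _ _ (C11_pair D _ _ _ _ (C11_pair D _ _ _ _
    (C11_pair D _ _ _ _ (sf_C11 _ _ _ _ F1) (sf_C11 _ _ _ _ F2)) (sf_C11 _ _ _ _ F3))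
    (sf_C11 _ _ _ _ F4)) (sf_C11 _ _ _ _ F5)). }
assert (cT : forall z x, D z -> continuous (fun y => fixed_point_map y z : W5) x).
{ intros z x Hz; exact (continuous_pairing _ _ x (continuous_pairing _ _ x (continuous_pairing _ _ x (continuous_pairing _ _ x (sf_cont _ _ _ _ F1 z x Hz)
      (sf_cont _ _ _ _ F2 z x Hz))
      (sf_cont _ _ _ _ F3 z x Hz))
      (sf_cont _ _ _ _ F4 z x Hz))
      (sf_cont _ _ _ _ F5 z x Hz)). }
assert (cdT : forall z v x, D z -> continuous (fun y => dTf y z v : W5) x).
{ intros z v x Hz; exact (continuous_pairing _ _ x (continuous_pairing _ _ x (continuous_pairing _ _ x (continuous_pairing _ _ x (sf_dcont _ _ _ _ F1 z v x Hz)
      (sf_dcont _ _ _ _ F2 z v x Hz))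
      (sf_dcont _ _ _ _ F3 z v x Hz))
      (sf_dcont _ _ _ _ F4 z v x Hz))
      (sf_dcont _ _ _ _ F5 z v x Hz)). }
assert (HT := C11_lift D fixed_point_map dTf HC cT cdT).
assert (TE : forall z, D z -> forall x, fixed_point_operator z x = fixed_point_map x z).
{ intros z Hz; apply (toCb_eq (W := W5)), (family_admissible D fixed_point_map dTf HC cT z Hz). }
assert (D0 : D (zero, base_point)).
{ split; simpl; [apply Rle_trans with 0; [right; apply norm_zero|lra]|].
  rewrite norm_minus_self; lra. }
assert (Hd0 := d_pos).
assert (Ht : 0 <= rate < 1) by (unfold rate; lra).
destruct (parametric_fixed_point CW R4_NormedModule base_point fixed_point_operator
  (fun z v => toCb (W := W5) (fun x => dTf x z v)) limits_at_infinity rate)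
  as [rho [X [dX [Hrho [HX [HX0 HXp]]]]]].
- apply geo_complete_Cb; repeat apply geo_complete_pair; apply geo_complete_R.
- exact HT.
- apply Cb_ext; intros x; rewrite TE by exact D0; unfold fixed_point_map.
  assert (gb := sf_regular _ _ _ _ (zero, base_point) HNb D0).
  assert (gr := sf_regular _ _ _ _ (zero, base_point) HNr D0).
  assert (gf := sf_regular _ _ _ _ (zero, base_point) HNf D0).
  assert (Zb : forall y, force_angle y (zero, base_point) = 0).
  { intros y; unfold force_angle.
    change (d * 0 + (sin (b y) - sin (b y + 0) + cos (b y) * 0) = 0); rewrite Rplus_0_r; ring. }
  assert (Zr : forall y, force_r y (zero, base_point) = 0).
  { intros y; unfold force_r.
    change (in_plane (b y + 0) (d * 0) (sin (b y) * 0) (/ d * 0) (d * 0) 0 (h * e2) (h * e3) 0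
      - cos (b y) * (d * 0) - alpha * (d * 0) * (sin (b y) - h) = 0).
    unfold in_plane; rewrite !Rmult_0_r, cos_0, sin_0, !Rplus_0_r.
    replace (h * e2 * e2 + h * e3 * e3) with h
      by (replace (h * e2 * e2 + h * e3 * e3) with (h * (e2 ^ 2 + e3 ^ 2)) by ring;
          rewrite He; ring).
    field. }
  assert (Zf : forall y, force_q y (zero, base_point) = 0).
  { intros y; unfold force_q.
    change (out_of_plane (b y + 0) (d * 0) (sin (b y) * 0) (/ d * 0) (d * 0) 0 (h * e2) (h * e3) 0 = 0).
    unfold out_of_plane; rewrite !Rmult_0_r, sin_0; ring. }
  rewrite (op_zero angle_op), (op_zero r_op), (op_zero psi_op), (op_zero q_op), (op_zero velocity_op)
    by auto using angle_op_bounded, r_op_bounded, psi_op_bounded, q_op_bounded, velocity_op_bounded.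
  reflexivity.
- exact Ht.
- intros v; apply Cb_norm_le; intros x.
  assert (Av := family_der_admissible D fixed_point_map dTf HC cdT (zero, base_point) (v, zero) D0).
  rewrite (toCb_eq (W := W5)) by exact Av.
  set (n := norm v); assert (Hn : 0 <= n) by apply norm_ge_0.
  assert (gb := sf_der_regular _ _ _ _ (zero, base_point) (v, zero) HNb D0).
  assert (gr := sf_der_regular _ _ _ _ (zero, base_point) (v, zero) HNr D0).
  assert (gf := sf_der_regular _ _ _ _ (zero, base_point) (v, zero) HNf D0).
  assert (Eb : forall y, dNb y (zero, base_point) (v, zero) = d * w2 (v y)).
  { intros y; rewrite <- (is_derive_unique _ _ _ (smooth_directional v HNb y)).
    apply is_derive_unique, force_angle_directional. }
  assert (Er : forall y, dNr y (zero, base_point) (v, zero) = 0).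
  { intros y; rewrite <- (is_derive_unique _ _ _ (smooth_directional v HNr y)).
    apply is_derive_unique, force_r_directional. }
  assert (Ef : forall y, dNf y (zero, base_point) (v, zero) =
    excess y * (sin (b y) * w3 (v y))
     + speed y * (d * w5 (v y))).
  { intros y; rewrite <- (is_derive_unique _ _ _ (smooth_directional v HNf y)).
    apply is_derive_unique, force_q_directional. }
  assert (Bf : forall y, Rabs (dNf y (zero, base_point) (v, zero)) <=
    n * (excess y * sin (b y)) + d * n).
  { intros y; rewrite Ef.
    assert (Hs := sin_angle_bounds h b Hh Hb y); assert (Hc := excess_bounds y).
    apply Rabs_plus_le.
    - replace (n * (excess y * sin (b y)))
        with (excess y * (sin (b y) * n)) by ring.
      apply Rabs_mult_le; [rewrite Rabs_pos_eq; lra|].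
      apply Rabs_mult_le; [rewrite Rabs_pos_eq; lra|apply (w_le w3), coordinate_w3].
    - replace (d * n) with (1 * (d * n)) by ring.
      apply Rabs_mult_le; [unfold angle_speed; rewrite Rabs_pos_eq; lra|].
      apply Rabs_mult_le; [rewrite Rabs_pos_eq; lra|apply (w_le w5), coordinate_w5]. }
  eapply Rle_trans; [|apply (rate_bound n Hn)].
  apply W5_norm_le.
  + apply (stable_op_estimate h b Hh Hb x0 _ (d * n)); auto.
    intros y; rewrite Eb; apply Rabs_mult_le; [rewrite Rabs_pos_eq; lra|].
    apply (w_le w2), coordinate_w2.
  + rewrite (op_zero r_op) by auto using r_op_bounded; rewrite Rabs_R0; lra.
  + apply (psi_op_estimate _ n (d * n)); auto; apply Rmult_le_pos; lra.
  + apply q_op_estimate; auto; intros y; eapply Rle_trans; [apply Bf|].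
    assert (Hs := sin_angle_bounds h b Hh Hb y); assert (Hc := excess_bounds y).
    rewrite Rmult_plus_distr_r; apply Rplus_le_compat_r.
    rewrite Rmult_comm; apply Rmult_le_compat_r; nra.
  + rewrite (op_zero velocity_op) by auto using velocity_op_bounded; rewrite Rabs_R0; lra.
- apply limits_at_infinity_zero.
- apply limits_at_infinity_closed.
- intros Y p HD HY.
  assert (HL : forall q : W5 -> R, has_limits (fun x => q (fixed_point_map x (Y, p))) ->
             has_limits (fun x => q (fixed_point_operator (Y, p) x))).
  { intros q Hq; replace (fun x => q (fixed_point_operator (Y, p) x)) with (fun x => q (fixed_point_map x (Y, p))); auto.
    apply functional_extensionality; intros x; now rewrite TE. }
  split; [|split; [|split; [|split]]];
    [apply (HL w1)|apply (HL w2)|apply (HL w3)|apply (HL w4)|apply (HL w5)].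
  + apply (sf_lim _ _ _ _ F1 (Y, p) HD HY).
  + apply (sf_lim _ _ _ _ F2 (Y, p) HD HY).
  + apply (sf_lim _ _ _ _ F3 (Y, p) HD HY).
  + apply (sf_lim _ _ _ _ F4 (Y, p) HD HY).
  + apply (sf_lim _ _ _ _ F5 (Y, p) HD HY).
- exists rho, X, dX; split; [exact Hrho|]; split; [exact HX|]; split; [exact HX0|].
  intros p Hp; destruct (HXp p Hp) as [H1 [H2 H3]]; split; [exact H1|]; split; [|exact H3].
  intros x; rewrite <- H2 at 1; apply TE; split; simpl; [exact H1|lra].
Qed.

End Problem.

(** * From fixed points to travelling waves *)

(** The travelling-wave equation for the angles, in which [r] and [q] replace the
    first derivatives; the bound keeps the profile away from the poles of the
    coordinates. *)
Record wave_system (alpha h e2 e3 : R) (L : R4_NormedModule) (be r ps q : R -> R) (V : R) : Prop := {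
  ws_be : forall x, is_derive be x (h - sin (be x) + r x);
  ws_r : forall x, is_derive r x
    (in_plane alpha h e2 e3 (be x) (r x) (ps x) (q x) V (p1 L) (p2 L) (p3 L) (p4 L));
  ws_ps : forall x, is_derive ps x (-2 * ps x + q x);
  ws_q : forall x, is_derive q x (2 * q x -
    out_of_plane alpha h e2 e3 (be x) (r x) (ps x) (q x) V (p1 L) (p2 L) (p3 L) (p4 L));
  ws_small : forall x, Rabs (ps x) <= 1 }.

Section FixedPoint.

Variables (alpha h e2 e3 : R) (b : R -> R) (x0 d : R).
Hypothesis Halpha : 0 < alpha.
Hypothesis Hh : 0 < h < 1.
Hypothesis He : e2 ^ 2 + e3 ^ 2 = 1.
Hypothesis Hb : static_angle h b.
Hypothesis Hx0 : b x0 = PI / 2.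
Hypothesis Hd : d = h ^ 2 * (1 - h) / 100.

(** The velocity component of the fixed point restores exactly the multiple of
    [speed] that [proj] removes from the equation for [r]. *)
Lemma fixed_point_wave (X : CW) (L : R4_NormedModule) :
  norm X <= 1 -> norm (minus L (base_point h e2 e3)) <= 1 ->
  (forall x, X x = fixed_point_map alpha h e2 e3 b x0 d x (X, L)) ->
  wave_system alpha h e2 e3 L (fun x => b x + w1 (X x)) (fun x => d * w2 (X x))
    (fun x => sin (b x) * w3 (X x)) (fun x => / d * w4 (X x)) (d * w5 (X 0)).
Proof.
intros HX HL HT.
set (z := (X, L) : Zs).
assert (Dz : dom (base_point h e2 e3) z) by (split; assumption).
assert (Hd0 := d_pos h d Hh Hd).
assert (Hs := sin_angle_bounds h b Hh Hb).
destruct (smooth_force_angle h e2 e3 b d Hh Hb) as [dNb HNb].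
destruct (smooth_force_r alpha h e2 e3 b d Hh Hb) as [dNr HNr].
destruct (smooth_force_q alpha h e2 e3 b d Hh Hb) as [dNf HNf].
assert (gb := sf_regular _ _ _ _ z HNb Dz); assert (gr := sf_regular _ _ _ _ z HNr Dz);
  assert (gf := sf_regular _ _ _ _ z HNf Dz).
set (fb := fun y => force_angle b d y z) in *; set (fr := fun y => force_r alpha h e2 e3 b d y z) in *;
  set (ff := fun y => force_q alpha h e2 e3 b d y z) in *.
assert (Et := total_speed_pos h b Hh Hb).
assert (E1 : forall x, w1 (X x) = stable_op h b x0 fb x).
{ intros x; rewrite HT; reflexivity. }
assert (E2 : forall x, d * w2 (X x) = unstable_op h b fr x).
{ intros x; rewrite HT.
  change (d * (/ d * unstable_op h b fr x) = unstable_op h b fr x); field; lra. }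
assert (E4 : forall x, / d * w4 (X x) = Sm ff x).
{ intros x; rewrite HT.
  change (/ d * (d * Sm ff x) = Sm ff x); field; lra. }
assert (E3 : forall x, sin (b x) * w3 (X x) = Sp (Sm ff) x).
{ intros x; rewrite HT.
  change (sin (b x) * (/ sin (b x) * Sp (Sm ff) x) = Sp (Sm ff) x).
  field; specialize (Hs x); lra. }
assert (E5 : forall x, d * w5 (X x) = - total h b fr / (alpha * total h b (angle_speed h b))).
{ intros x; rewrite HT.
  change (d * (- / (d * alpha * total h b (angle_speed h b)) * total h b fr)
    = - total h b fr / (alpha * total h b (angle_speed h b))); field; repeat split; lra. }
assert (E5' : forall x, d * w5 (X x) = d * w5 (X 0)) by (intros; rewrite !E5; reflexivity).
set (V := d * w5 (X 0)) in *.
assert (HV : alpha * V = - (total h b fr / total h b (angle_speed h b))).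
{ unfold V; rewrite E5; field; lra. }
split.
- intros x.
  apply is_derive_eq with (- angle_speed h b x + (- cos (b x) * w1 (X x) + fb x)).
  + apply (is_derive_plus b (fun x => w1 (X x))); [now apply angle_derive|].
    rewrite E1; apply (is_derive_ext (stable_op h b x0 fb)); [intros; symmetry; apply E1|].
    now apply stable_op_derive.
  + unfold fb, force_angle, z, angle_speed; cbn [fst snd]; ring.
- intros x.
  apply (is_derive_ext (unstable_op h b fr)); [intros; symmetry; apply E2|].
  apply is_derive_eq with (cos (b x) * unstable_op h b fr x + proj h b fr x); [now apply unstable_op_derive|].
  unfold proj; rewrite <- HV, <- E2.
  unfold fr at 1, force_r, z; cbn [fst snd]; rewrite E5'; unfold angle_speed; ring.
- intros x; rewrite E3, E4.
  apply (is_derive_ext (Sp (Sm ff))); [intros; symmetry; apply E3|].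
  apply Sp_derive, op_regular; [apply Sm_op|exact gf].
- intros x.
  apply (is_derive_ext (Sm ff)); [intros; symmetry; apply E4|].
  apply is_derive_eq with (2 * Sm ff x - ff x); [now apply Sm_derive|].
  rewrite <- E4; unfold ff, force_q, z; cbn [fst snd]; rewrite E5'; reflexivity.
- intros x; exact (psi_small h e2 e3 b x z Dz).
Qed.

End FixedPoint.

Lemma is_derive_pair {E F : NormedModule R_AbsRing} (f : R -> E) (g : R -> F) x l k :
  is_derive f x l -> is_derive g x k ->
  is_derive (V := prod_NormedModule R_AbsRing E F) (fun t => (f t, g t)) x (l, k).
Proof.
intros Hf Hg.
apply (filterdiff_comp'_2 f g (fun u v => (u, v) : prod_NormedModule R_AbsRing E F) x
  (fun y => scal y l) (fun y => scal y k) (fun u v => (u, v)) Hf Hg).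
apply filterdiff_ext_lin with (l1 := fun t => t); [|intros []; reflexivity].
apply filterdiff_ext with (f := fun t => t); [intros []; reflexivity|].
apply filterdiff_id.
Qed.

(** The equation in an orthonormal frame in which the profile is
    [(cos y cos be, cos y sin be, sin y)]: it holds as soon as its components
    along the two coordinate directions do. [D2] stands for [cos y * be'']. *)
Lemma frame_equation (c s C S B1 P1 D2 P2 V al F1 Fe Fp : R) :
  c ^ 2 + s ^ 2 = 1 -> C ^ 2 + S ^ 2 = 1 ->
  P2 = - S * C * B1 ^ 2 - (- S * c * F1 - S * s * Fe + C * Fp) + V * C * B1 - al * V * P1 ->
  D2 = 2 * S * B1 * P1 - (- s * F1 + c * Fe) - V * P1 - al * V * C * B1 ->
  let m1 := C * c in let me := C * s in let mp := S in
  let m1' := - S * c * P1 - C * s * B1 in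
  let me' := - S * s * P1 + C * c * B1 in
  let mp' := C * P1 in
  let h1 := - C * c * P1 ^ 2 + 2 * S * s * P1 * B1 - C * c * B1 ^ 2 - S * c * P2 - s * D2 + F1 in
  let he := - C * s * P1 ^ 2 - 2 * S * c * P1 * B1 - C * s * B1 ^ 2 - S * s * P2 + c * D2 + Fe in
  let hp := - S * P1 ^ 2 + C * P2 + Fp in
  V * m1' + al * V * (me * mp' - mp * me') + (me * hp - mp * he) = 0 /\
  V * me' + al * V * (mp * m1' - m1 * mp') + (mp * h1 - m1 * hp) = 0 /\
  V * mp' + al * V * (m1 * me' - me * m1') + (m1 * he - me * h1) = 0.
Proof.
intros E1 E2 -> ->; cbv zeta.
assert (Es : s ^ 2 = 1 - c ^ 2) by lra; assert (ES : S ^ 2 = 1 - C ^ 2) by lra.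
repeat split; ring [Es ES].
Qed.

Definition profile (e2 e3 be ps : R) : R3 :=
  (cos ps * cos be, e2 * (cos ps * sin be) - e3 * sin ps, e3 * (cos ps * sin be) + e2 * sin ps).

Lemma profile_S2 e2 e3 be ps : e2 ^ 2 + e3 ^ 2 = 1 -> S2 (profile e2 e3 be ps).
Proof.
intros He; unfold S2, profile, dot.
assert (E1 := sin2_cos2 be); assert (E2 := sin2_cos2 ps); unfold Rsqr in *.
assert (Es : sin be ^ 2 = 1 - cos be ^ 2) by lra; assert (ES : sin ps ^ 2 = 1 - cos ps ^ 2) by lra.
assert (E3 : e3 ^ 2 = 1 - e2 ^ 2) by lra.
ring [Es ES E3].
Qed.

Section Wave.

Variables (alpha h e2 e3 : R) (L : R4_NormedModule) (be r ps q : R -> R) (V : R).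
Hypothesis He : e2 ^ 2 + e3 ^ 2 = 1.
Hypothesis HW : wave_system alpha h e2 e3 L be r ps q V.

Let B1 x := h - sin (be x) + r x.
Let P1 x := -2 * ps x + q x.
Let B2 x := - cos (be x) * B1 x
  + in_plane alpha h e2 e3 (be x) (r x) (ps x) (q x) V (p1 L) (p2 L) (p3 L) (p4 L).
Let P2 x := -2 * P1 x + (2 * q x
  - out_of_plane alpha h e2 e3 (be x) (r x) (ps x) (q x) V (p1 L) (p2 L) (p3 L) (p4 L)).

Lemma B1_derive x : is_derive B1 x (B2 x).
Proof.
unfold B1, B2.
apply is_derive_eq with (0 - B1 x * cos (be x)
  + in_plane alpha h e2 e3 (be x) (r x) (ps x) (q x) V (p1 L) (p2 L) (p3 L) (p4 L));
  [|unfold B1; ring].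
apply (is_derive_plus (fun x => h - sin (be x)) r); [|apply HW].
apply (is_derive_minus (fun _ => h)); [apply (is_derive_const h)|].
apply (is_derive_comp sin be); [apply is_derive_sin|apply (ws_be _ _ _ _ _ _ _ _ _ _ HW)].
Qed.

Lemma P1_derive x : is_derive P1 x (P2 x).
Proof.
apply (is_derive_plus (fun x => -2 * ps x) q); [|apply (ws_q _ _ _ _ _ _ _ _ _ _ HW)].
apply (is_derive_scal ps), (ws_ps _ _ _ _ _ _ _ _ _ _ HW).
Qed.

Lemma derive_product (f g : R -> R) x f' g' :
  is_derive f x f' -> is_derive g x g' -> is_derive (fun t => f t * g t) x (f' * g x + f x * g').
Proof. intros; apply (is_derive_mult f g); auto; intros; apply Rmult_comm. Qed.

Lemma trig_derives x :
  is_derive (fun t => sin (be t)) x (cos (be x) * B1 x) /\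
  is_derive (fun t => cos (be t)) x (- sin (be x) * B1 x) /\
  is_derive (fun t => sin (ps t)) x (cos (ps x) * P1 x) /\
  is_derive (fun t => cos (ps t)) x (- sin (ps x) * P1 x).
Proof.
assert (D1 := ws_be _ _ _ _ _ _ _ _ _ _ HW x); assert (D2 := ws_ps _ _ _ _ _ _ _ _ _ _ HW x).
change (is_derive be x (B1 x)) in D1; change (is_derive ps x (P1 x)) in D2.
split; [|split; [|split]].
- apply is_derive_eq with (B1 x * cos (be x)); [|ring].
  apply (is_derive_comp sin be); [apply is_derive_sin|exact D1].
- apply is_derive_eq with (B1 x * - sin (be x)); [|ring].
  apply (is_derive_comp cos be); [apply is_derive_cos|exact D1].
- apply is_derive_eq with (P1 x * cos (ps x)); [|ring].
  apply (is_derive_comp sin ps); [apply is_derive_sin|exact D2].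
- apply is_derive_eq with (P1 x * - sin (ps x)); [|ring].
  apply (is_derive_comp cos ps); [apply is_derive_cos|exact D2].
Qed.

(** In the frame of [frame_equation] the system is the equation; rotating the
    transverse plane by the unit vector [(e2, e3)] commutes with cross products. *)
Theorem wave_system_travelling_wave :
  travelling_wave alpha L V (fun x => profile e2 e3 (be x) (ps x)).
Proof.
set (m1' := fun x => - sin (ps x) * cos (be x) * P1 x - cos (ps x) * sin (be x) * B1 x).
set (me' := fun x => - sin (ps x) * sin (be x) * P1 x + cos (ps x) * cos (be x) * B1 x).
set (mp' := fun x => cos (ps x) * P1 x).
set (m1'' := fun x => - cos (ps x) * cos (be x) * P1 x ^ 2
  + 2 * sin (ps x) * sin (be x) * P1 x * B1 x - cos (ps x) * cos (be x) * B1 x ^ 2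
  - sin (ps x) * cos (be x) * P2 x - sin (be x) * (cos (ps x) * B2 x)).
set (me'' := fun x => - cos (ps x) * sin (be x) * P1 x ^ 2
  - 2 * sin (ps x) * cos (be x) * P1 x * B1 x - cos (ps x) * sin (be x) * B1 x ^ 2
  - sin (ps x) * sin (be x) * P2 x + cos (be x) * (cos (ps x) * B2 x)).
set (mp'' := fun x => - sin (ps x) * P1 x ^ 2 + cos (ps x) * P2 x).
assert (D : forall x, is_derive (fun t => cos (ps t) * cos (be t)) x (m1' x) /\
   is_derive (fun t => cos (ps t) * sin (be t)) x (me' x) /\
   is_derive (fun t => sin (ps t)) x (mp' x)).
{ intros x; destruct (trig_derives x) as [sb [cb [sp cp]]]; split; [|split].
  - apply is_derive_eq with ((- sin (ps x) * P1 x) * cos (be x) + cos (ps x) * (- sin (be x) * B1 x));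
      [exact (derive_product _ _ x _ _ cp cb)|unfold m1'; ring].
  - apply is_derive_eq with ((- sin (ps x) * P1 x) * sin (be x) + cos (ps x) * (cos (be x) * B1 x));
      [exact (derive_product _ _ x _ _ cp sb)|unfold me'; ring].
  - exact sp. }
assert (D' : forall x, is_derive m1' x (m1'' x) /\ is_derive me' x (me'' x) /\
   is_derive mp' x (mp'' x)).
{ intros x; destruct (trig_derives x) as [sb [cb [sp cp]]].
  assert (b2 := B1_derive x); assert (q2 := P1_derive x).
  assert (msp : is_derive (fun t => - sin (ps t)) x (- (cos (ps x) * P1 x)))
    by now apply (is_derive_opp (fun t => sin (ps t))).
  split; [|split].
  - apply is_derive_eq with
     ((- (cos (ps x) * P1 x) * cos (be x) + - sin (ps x) * (- sin (be x) * B1 x)) * P1 x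
        + (- sin (ps x) * cos (be x)) * P2 x
      - (((- sin (ps x) * P1 x) * sin (be x) + cos (ps x) * (cos (be x) * B1 x)) * B1 x
        + (cos (ps x) * sin (be x)) * B2 x)); [|unfold m1''; ring].
    exact (is_derive_minus _ _ x _ _
      (derive_product _ _ x _ _ (derive_product _ _ x _ _ msp cb) q2)
      (derive_product _ _ x _ _ (derive_product _ _ x _ _ cp sb) b2)).
  - apply is_derive_eq with
     ((- (cos (ps x) * P1 x) * sin (be x) + - sin (ps x) * (cos (be x) * B1 x)) * P1 x
        + (- sin (ps x) * sin (be x)) * P2 x
      + (((- sin (ps x) * P1 x) * cos (be x) + cos (ps x) * (- sin (be x) * B1 x)) * B1 x
        + (cos (ps x) * cos (be x)) * B2 x)); [|unfold me''; ring].
    exact (is_derive_plus _ _ x _ _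
      (derive_product _ _ x _ _ (derive_product _ _ x _ _ msp sb) q2)
      (derive_product _ _ x _ _ (derive_product _ _ x _ _ cp cb) b2)).
  - apply is_derive_eq with ((- sin (ps x) * P1 x) * P1 x + cos (ps x) * P2 x);
      [exact (derive_product _ _ x _ _ cp q2)|unfold mp''; ring]. }
assert (lin : forall (f g : R -> R) a c x f' g', is_derive f x f' -> is_derive g x g' ->
          is_derive (fun t => a * f t + c * g t) x (a * f' + c * g')).
{ intros f g a c x f' g' Hf Hg; apply (is_derive_plus (fun t => a * f t) (fun t => c * g t));
    [now apply (is_derive_scal f)|now apply (is_derive_scal g)]. }
exists (fun x => (m1' x, e2 * me' x - e3 * mp' x, e3 * me' x + e2 * mp' x)),
  (fun x => (m1'' x, e2 * me'' x - e3 * mp'' x, e3 * me'' x + e2 * mp'' x)).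
split; [|split].
- intros x; destruct (D x) as [d1 [d2 d3]].
  apply is_derive_pair; [apply is_derive_pair|]; [exact d1| |now apply lin].
  apply is_derive_eq with (e2 * me' x + - e3 * mp' x); [|ring].
  apply (is_derive_ext (fun t => e2 * (cos (ps t) * sin (be t)) + - e3 * sin (ps t)));
    [intros; simpl; ring|now apply lin].
- intros x; destruct (D' x) as [d1 [d2 d3]].
  apply is_derive_pair; [apply is_derive_pair|]; [exact d1| |now apply lin].
  apply is_derive_eq with (e2 * me'' x + - e3 * mp'' x); [|ring].
  apply (is_derive_ext (fun t => e2 * me' t + - e3 * mp' t));
    [intros; simpl; ring|now apply lin].
- intros x.
  assert (Hc : cos (ps x) <> 0)
    by (assert (H := cos_ge_half _ (ws_small _ _ _ _ _ _ _ _ _ _ HW x)); lra).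
  destruct L as [[[H1 H2] H3] K] eqn:EL.
  set (m2 := e2 * (cos (ps x) * sin (be x)) - e3 * sin (ps x)).
  set (F1 := cos (ps x) * cos (be x) + H1).
  set (Fe := - K * m2 * e2 + (H2 * e2 + H3 * e3)).
  set (Fp := K * m2 * e3 + (H3 * e2 - H2 * e3)).
  assert (Es := sin2_cos2 (be x)); assert (ES := sin2_cos2 (ps x)); unfold Rsqr in *.
  destruct (frame_equation (cos (be x)) (sin (be x)) (cos (ps x)) (sin (ps x)) (B1 x) (P1 x)
     (cos (ps x) * B2 x) (P2 x) V alpha F1 Fe Fp) as [G1 [G2 G3]].
  + lra.
  + lra.
  + unfold P2, out_of_plane, F1, Fe, Fp, m2, B1, P1, p1, p2, p3, p4; simpl fst; simpl snd.
    ring.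
  + unfold B2, in_plane, F1, Fe, Fp, m2, B1, P1, p1, p2, p3, p4; simpl fst; simpl snd.
    field; exact Hc.
  + clear EL.
    assert (E3 : e3 ^ 2 = 1 - e2 ^ 2) by lra.
    fold (m1' x) in G1, G2, G3; fold (me' x) in G1, G2, G3; fold (mp' x) in G1, G2, G3.
    fold (m1'' x) in G1, G2, G3; fold (me'' x) in G1, G2, G3; fold (mp'' x) in G1, G2, G3.
    revert G1 G2 G3; unfold F1, Fe, Fp, m2.
    generalize (m1' x) (me' x) (mp' x) (m1'' x) (me'' x) (mp'' x); intros a1 ae ap c1 ce cp.
    unfold profile, effective_field, applied_field, anisotropy, xhat, yhat, zhat, dot, cross.
    unfold minus.
    repeat (progress (unfold plus, opp, scal, zero, mult, prod_plus, prod_opp, prod_zero,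
      prod_scal; simpl)).
    generalize (cos (be x)) (sin (be x)) (cos (ps x)) (sin (ps x)); intros c s C S G1 G2 G3.
    match goal with |- (?a, ?b, ?c) = _ => assert (a = 0 /\ b = 0 /\ c = 0) end.
    { repeat split.
      - eapply eq_trans; [|exact G1]; ring [E3].
      - match type of G2 with ?a = _ => match type of G3 with ?k = _ =>
          transitivity (e2 * a - e3 * k); [ring [E3]|rewrite G2, G3; ring] end end.
      - match type of G2 with ?a = _ => match type of G3 with ?k = _ =>
          transitivity (e3 * a + e2 * k); [ring [E3]|rewrite G2, G3; ring] end end. }
    destruct H as [-> [-> ->]]; reflexivity.
Qed.

End Wave.

(** * Boundary values *)

(** The equations of Lagrange: minus the gradient of the potential is [l * p]. *)
Definition critical (L : R4) (p : R3) (l : R) : Prop :=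
  S2 p /\
  let '(x, y, z) := p in
  let '(H1, H2, H3, K) := L in
  x + H1 = l * x /\ - K * y + H2 = l * y /\ H3 = l * z.

Lemma potential_coord H1 H2 H3 K x y z :
  potential (H1, H2, H3, K) (x, y, z)
    = 1 / 2 * (1 - x ^ 2 + K * y ^ 2 - 2 * (H1 * x + H2 * y + H3 * z)).
Proof.
unfold potential, applied_field, anisotropy, xhat, yhat, zhat, dot.
repeat (progress (unfold plus, scal, mult, prod_plus, prod_scal; simpl)); ring.
Qed.

Lemma poly_limit_nonneg (a c2 c3 c4 r : R) : 0 < r ->
  (forall t, 0 < t < r -> 0 <= a + t * c2 + t ^ 2 * c3 + t ^ 3 * c4) -> 0 <= a.
Proof.
intros Hr H; apply Rnot_lt_le; intros Ha.
set (M := Rabs c2 + Rabs c3 + Rabs c4 + 1).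
assert (HM : 0 < M) by (unfold M; generalize (Rabs_pos c2) (Rabs_pos c3) (Rabs_pos c4); lra).
set (t := Rmin (r / 2) (Rmin 1 (- a / (2 * M)))).
assert (Hq : 0 < - a / (2 * M)) by (apply Rdiv_lt_0_compat; lra).
assert (Ht : 0 < t) by (unfold t; repeat apply Rmin_glb_lt; lra).
assert (Ht1 : t <= r / 2) by apply Rmin_l.
assert (Ht2 : t <= 1) by (eapply Rle_trans; [apply Rmin_r|apply Rmin_l]).
assert (Ht3 : t <= - a / (2 * M)) by (eapply Rle_trans; [apply Rmin_r|apply Rmin_r]).
specialize (H t ltac:(lra)).
assert (HtM : t * M <= - a / 2).
{ apply Rmult_le_compat_r with (r := M) in Ht3; [|lra].
  replace (- a / (2 * M) * M) with (- a / 2) in Ht3 by (field; lra); exact Ht3. }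
assert (B2 : c2 <= Rabs c2) by apply Rle_abs; assert (B3 : c3 <= Rabs c3) by apply Rle_abs;
  assert (B4 : c4 <= Rabs c4) by apply Rle_abs.
assert (A2 : t * c2 <= t * Rabs c2) by (apply Rmult_le_compat_l; lra).
assert (A3 : t ^ 2 * c3 <= t * Rabs c3).
{ apply Rle_trans with (t ^ 2 * Rabs c3); [apply Rmult_le_compat_l; [nra|lra]|].
  apply Rmult_le_compat_r; [apply Rabs_pos|nra]. }
assert (A4 : t ^ 3 * c4 <= t * Rabs c4).
{ apply Rle_trans with (t ^ 3 * Rabs c4); [apply Rmult_le_compat_l; [apply pow_le; lra|lra]|].
  apply Rmult_le_compat_r; [apply Rabs_pos|]. simpl; rewrite Rmult_1_r.
  assert (t * t <= 1) by nra; nra. }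
unfold M in HtM; nra.
Qed.

(** The great circle through [p] in the tangent direction [(u, v, w)], in its
    rational parametrization. *)
Lemma local_min_variation (H1 H2 H3 K x y z u v w : R) :
  local_min_on_S2 (potential (H1, H2, H3, K)) (x, y, z) -> x * u + y * v + z * w = 0 ->
  let n := u ^ 2 + v ^ 2 + w ^ 2 in
  let l := (x + H1) * x + (- K * y + H2) * y + H3 * z in
  exists r, 0 < r /\ forall t, 0 < t < r ->
    0 <= 2 * t ^ 2 * ((- u ^ 2 + K * v ^ 2) - 2 * t * n * (- u * x + K * v * y)
             + t ^ 2 * n ^ 2 * (- x ^ 2 + K * y ^ 2))
         - 2 * t * (1 + t ^ 2 * n) * ((x + H1) * u + (- K * y + H2) * v + H3 * w)
         + 2 * t ^ 2 * n * (1 + t ^ 2 * n) * l.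
Proof.
intros [HS [eps Heps]] Ht n l.
unfold S2, dot in HS.
assert (Hn : 0 <= n) by (unfold n; nra).
set (M := 1 + n + Rabs u + Rabs v + Rabs w).
assert (HM : 0 < M) by (unfold M; generalize (Rabs_pos u) (Rabs_pos v) (Rabs_pos w); lra).
exists (Rmin 1 (eps / (2 * M))); split.
{ apply Rmin_glb_lt; [lra|]; apply Rdiv_lt_0_compat; [apply cond_pos|lra]. }
intros t [Ht0 Htr].
assert (Ht1 : t < 1) by (generalize (Rmin_l 1 (eps / (2 * M))); lra).
assert (Ht2 : t * (2 * M) < eps).
{ assert (H : t < eps / (2 * M)) by (generalize (Rmin_r 1 (eps / (2 * M))); lra).
  apply Rmult_lt_compat_r with (r := 2 * M) in H; [|lra].
  replace (eps / (2 * M) * (2 * M)) with (pos eps) in H by (field; lra); exact H. }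
set (m := 1 + t ^ 2 * n).
assert (Hm : 1 <= m) by (unfold m; assert (0 <= t ^ 2 * n) by (apply Rmult_le_pos; nra); lra).
set (q := fun a c : R => (2 * t * c - 2 * t ^ 2 * n * a) / m).
assert (Eq : forall a c, q a c * m = 2 * t * c - 2 * t ^ 2 * n * a)
  by (intros; unfold q; field; lra).
assert (Hball : forall a c, a ^ 2 <= 1 -> Rabs c <= Rabs u + Rabs v + Rabs w ->
          Rabs (a + q a c - a) < eps).
{ intros a c Ha Hc; unfold q.
  replace (a + (2 * t * c - 2 * t ^ 2 * n * a) / m - a) with ((2 * t * (c - t * n * a)) * / m)
    by (field; lra).
  apply Rle_lt_trans with ((2 * t * M) * 1); [|lra].
  apply Rabs_mult_le.
  - apply Rabs_mult_le; [rewrite Rabs_pos_eq; lra|].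
    assert (Ha1 : Rabs a <= 1) by (apply Rabs_le; nra).
    unfold Rminus; apply Rle_trans with (Rabs c + Rabs (t * n * a)).
    + eapply Rle_trans; [apply Rabs_triang|]; rewrite Rabs_Ropp; lra.
    + assert (Rabs (t * n * a) <= 1 * n * 1).
      { repeat apply Rabs_mult_le; auto; rewrite Rabs_pos_eq; lra. }
      unfold M; lra.
  - rewrite Rabs_pos_eq; [|left; apply Rinv_0_lt_compat; lra].
    rewrite <- Rinv_1; apply Rinv_le_contravar; lra. }
assert (Hin : ball ((x, y, z) : R3_NormedModule) eps (x + q x u, y + q y v, z + q z w)).
{ assert (x ^ 2 <= 1 /\ y ^ 2 <= 1 /\ z ^ 2 <= 1) as [X2 [Y2 Z2]].
  { assert (0 <= x ^ 2) by apply pow2_ge_0; assert (0 <= y ^ 2) by apply pow2_ge_0;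
    assert (0 <= z ^ 2) by apply pow2_ge_0; lra. }
  generalize (Rabs_pos u) (Rabs_pos v) (Rabs_pos w); intros.
  split; [split|].
  - apply (Hball x u); lra.
  - apply (Hball y v); lra.
  - apply (Hball z w); lra. }
specialize (Heps _ Hin); clear Hin Hball.
assert (EX := Eq x u); assert (EY := Eq y v); assert (EZ := Eq z w).
revert Heps EX EY EZ; generalize (q x u) (q y v) (q z w); intros X Y Z Heps EX EY EZ.
assert (HqS : S2 (x + X, y + Y, z + Z)).
{ unfold S2, dot.
  assert (E : (X ^ 2 + Y ^ 2 + Z ^ 2 + 2 * (x * X + y * Y + z * Z)) * m ^ 2 = 0).
  { transitivity ((X * m) ^ 2 + (Y * m) ^ 2 + (Z * m) ^ 2
      + 2 * m * (x * (X * m) + y * (Y * m) + z * (Z * m))); [ring|].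
    rewrite EX, EY, EZ.
    transitivity (4 * t ^ 4 * n ^ 2 * (x * x + y * y + z * z)
      - 8 * t ^ 3 * n * (x * u + y * v + z * w) + 4 * t ^ 2 * n
      + 2 * m * (2 * t * (x * u + y * v + z * w) - 2 * t ^ 2 * n * (x * x + y * y + z * z)));
      [unfold n; ring|].
    rewrite HS, Ht; unfold m; ring. }
  apply Rmult_integral in E; destruct E as [E|E]; [lra|].
  assert (0 < m ^ 2) by nra; lra. }
specialize (Heps HqS); rewrite !potential_coord in Heps.
apply Rmult_le_compat_r with (r := m ^ 2) in Heps; [|nra].
match goal with |- 0 <= ?e => cut (e =
  1 / 2 * (- (X * m) ^ 2 + K * (Y * m) ^ 2)
  - m * ((x + H1) * (X * m) + (- K * y + H2) * (Y * m) + H3 * (Z * m))) end.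
- intros ->; nra.
- rewrite EX, EY, EZ; unfold m, l; field.
Qed.

(** The variation along a great circle is a polynomial in [t]. Its first-order
    term vanishes for all tangent directions, which gives the critical equations;
    the second-order term is nonnegative. *)
Lemma local_min_critical (H1 H2 H3 K x y z : R) :
  local_min_on_S2 (potential (H1, H2, H3, K)) (x, y, z) ->
  exists l, critical (H1, H2, H3, K) (x, y, z) l /\
    forall u v w, x * u + y * v + z * w = 0 ->
      0 <= - u ^ 2 + K * v ^ 2 + l * (u ^ 2 + v ^ 2 + w ^ 2).
Proof.
intros Hmin.
assert (HS : x * x + y * y + z * z = 1) by exact (proj1 Hmin).
set (l := (x + H1) * x + (- K * y + H2) * y + H3 * z).
assert (G : forall u v w, x * u + y * v + z * w = 0 ->
              (x + H1) * u + (- K * y + H2) * v + H3 * w <= 0).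
{ intros u v w Ht.
  destruct (local_min_variation H1 H2 H3 K x y z u v w Hmin Ht) as [r [Hr H]]; fold l in H.
  set (n := u ^ 2 + v ^ 2 + w ^ 2) in *.
  set (g := (x + H1) * u + (- K * y + H2) * v + H3 * w) in *.
  set (a := - u ^ 2 + K * v ^ 2) in *; set (c := - u * x + K * v * y) in *;
    set (e := - x ^ 2 + K * y ^ 2) in *.
  assert (0 <= - g); [|lra].
  apply (poly_limit_nonneg _ (a + n * l) (- 2 * n * c - n * g) (n ^ 2 * e + n ^ 2 * l) r Hr).
  intros t Htr; specialize (H t Htr).
  apply Rmult_le_reg_l with (2 * t); [lra|]; rewrite Rmult_0_r.
  eapply Rle_trans; [exact H|]; right; ring. }
assert (G0 : forall u v w, x * u + y * v + z * w = 0 ->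
              (x + H1) * u + (- K * y + H2) * v + H3 * w = 0).
{ intros u v w Ht; apply Rle_antisym; [now apply G|].
  assert (H := G (- u) (- v) (- w) ltac:(lra)); lra. }
exists l; split; [split; [exact (proj1 Hmin)|]|].
- assert (E := G0 (x + H1 - l * x) (- K * y + H2 - l * y) (H3 - l * z)).
  assert (Et : x * (x + H1 - l * x) + y * (- K * y + H2 - l * y) + z * (H3 - l * z) = 0).
  { transitivity (l - l * (x * x + y * y + z * z)); [unfold l; ring|rewrite HS; ring]. }
  specialize (E Et).
  assert (Q : (x + H1 - l * x) ^ 2 + (- K * y + H2 - l * y) ^ 2 + (H3 - l * z) ^ 2 = 0).
  { transitivity ((x + H1) * (x + H1 - l * x) + (- K * y + H2) * (- K * y + H2 - l * y)
      + H3 * (H3 - l * z)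
      - l * (x * (x + H1 - l * x) + y * (- K * y + H2 - l * y) + z * (H3 - l * z))); [ring|].
    rewrite E, Et; ring. }
  assert (sq : forall s : R, 0 <= s ^ 2) by (intros; apply pow2_ge_0).
  assert (Q1 := sq (x + H1 - l * x)); assert (Q2 := sq (- K * y + H2 - l * y));
    assert (Q3 := sq (H3 - l * z)).
  assert (z0 : forall s : R, s ^ 2 = 0 -> s = 0) by (intros s Hs; nra).
  repeat split.
  + assert (x + H1 - l * x = 0) by (apply z0; lra); lra.
  + assert (- K * y + H2 - l * y = 0) by (apply z0; lra); lra.
  + assert (H3 - l * z = 0) by (apply z0; lra); lra.
- intros u v w Ht.
  destruct (local_min_variation H1 H2 H3 K x y z u v w Hmin Ht) as [r [Hr H]]; fold l in H.
  rewrite (G0 u v w Ht) in H.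
  set (n := u ^ 2 + v ^ 2 + w ^ 2) in *.
  set (a := - u ^ 2 + K * v ^ 2) in *; set (c := - u * x + K * v * y) in *;
    set (e := - x ^ 2 + K * y ^ 2) in *.
  assert (0 <= a + l * n); [|lra].
  apply (poly_limit_nonneg _ (- 2 * n * c) (n ^ 2 * e + n ^ 2 * l) 0 r Hr).
  intros t Htr; specialize (H t Htr).
  apply Rmult_le_reg_l with (2 * t ^ 2); [nra|]; rewrite Rmult_0_r.
  eapply Rle_trans; [exact H|]; right; ring.
Qed.

(** Near the equator [x = 0], the second variation towards the poles bounds the
    multiplier below by almost [1]; the equatorial part of the field is then too
    large to be close to a field of size [h < 1]. *)
Lemma local_min_away (h e2 e3 eps H1 H2 H3 K x y z : R) :
  0 < h < 1 -> e2 ^ 2 + e3 ^ 2 = 1 -> eps = h * (1 - h) / 10 ->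
  Rabs K <= eps -> Rabs (H2 - h * e2) <= eps -> Rabs (H3 - h * e3) <= eps ->
  local_min_on_S2 (potential (H1, H2, H3, K)) (x, y, z) -> (1 - h) / 12 <= x ^ 2.
Proof.
intros Hh He Heps HK HH2 HH3 Hmin.
destruct (local_min_critical _ _ _ _ _ _ _ Hmin) as [l [[HS [_ [C2 C3]]] HQ]].
unfold S2, dot in HS.
apply Rnot_lt_le; intros Hx.
set (n := y ^ 2 + z ^ 2).
assert (En : x ^ 2 = 1 - n) by (unfold n; lra).
assert (Hx0 : 0 <= x ^ 2) by apply pow2_ge_0.
assert (Hn : 1 - (1 - h) / 12 < n) by lra.
assert (Ht : x * (1 - x * x) + y * (- x * y) + z * (- x * z) = 0).
{ transitivity (x * (1 - (x * x + y * y + z * z))); [ring|rewrite HS; ring]. }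
specialize (HQ _ _ _ Ht).
assert (HQ' : 0 <= - n ^ 2 + K * (x ^ 2 * y ^ 2) + l * n).
{ eapply Rle_trans; [exact HQ|]; right.
  transitivity (- (1 - x ^ 2) ^ 2 + K * (x ^ 2 * y ^ 2)
    + l * ((1 - x ^ 2) ^ 2 + x ^ 2 * (y ^ 2 + z ^ 2))); [ring|].
  fold n; rewrite En; ring. }
apply Rabs_le_between in HK; apply Rabs_le_between in HH2; apply Rabs_le_between in HH3.
assert (He0 : 0 < eps) by (rewrite Heps; apply Rdiv_lt_0_compat; nra).
assert (Hy : 0 <= y ^ 2 <= n) by (unfold n; nra).
assert (Hl : n - eps <= l).
{ assert (A1 : K * (x ^ 2 * y ^ 2) <= eps * (1 * n)).
  { apply Rle_trans with (eps * (x ^ 2 * y ^ 2)); [apply Rmult_le_compat_r; nra|].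
    apply Rmult_le_compat_l; [lra|]; apply Rmult_le_compat; lra. }
  apply Rmult_le_reg_r with n; [lra|]; lra. }
assert (eps1 : eps <= (1 - h) / 10) by (rewrite Heps; nra).
set (k := l - eps).
assert (Hk : 1 - (1 - h) / 3 <= k) by (unfold k; lra).
assert (Hk0 : 0 < k) by lra.
assert (F1 : k ^ 2 * n <= H2 ^ 2 + H3 ^ 2).
{ replace H2 with ((l + K) * y) by lra; rewrite C3.
  replace (((l + K) * y) ^ 2 + (l * z) ^ 2) with ((l + K) ^ 2 * y ^ 2 + l ^ 2 * z ^ 2) by ring.
  unfold n; rewrite Rmult_plus_distr_l; apply Rplus_le_compat;
    apply Rmult_le_compat_r; try apply pow2_ge_0; apply pow_incr; unfold k in *; lra. }
assert (F2 : H2 ^ 2 + H3 ^ 2 <= h ^ 2 + 4 * h * eps + 2 * eps ^ 2).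
{ assert (Rabs e2 <= 1 /\ Rabs e3 <= 1) as [A2 A3] by (split; apply Rabs_le; nra).
  apply Rabs_le_between in A2; apply Rabs_le_between in A3.
  set (a := H2 - h * e2) in *; set (c := H3 - h * e3) in *.
  replace H2 with (a + h * e2) by (unfold a; ring); replace H3 with (c + h * e3) by (unfold c; ring).
  replace ((a + h * e2) ^ 2 + (c + h * e3) ^ 2)
    with (h ^ 2 * (e2 ^ 2 + e3 ^ 2) + 2 * h * (a * e2 + c * e3) + (a ^ 2 + c ^ 2)) by ring.
  rewrite He.
  assert (a * e2 <= eps * 1) by nra; assert (c * e3 <= eps * 1) by nra.
  assert (a ^ 2 <= eps ^ 2) by nra; assert (c ^ 2 <= eps ^ 2) by nra.
  nra. }
assert (F3 : (1 - (1 - h) / 3) ^ 3 <= k ^ 2 * n).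
{ replace ((1 - (1 - h) / 3) ^ 3) with ((1 - (1 - h) / 3) ^ 2 * (1 - (1 - h) / 3)) by ring.
  apply Rmult_le_compat; [apply pow2_ge_0|lra| |lra]; apply pow_incr; lra. }
assert (F4 : h <= (1 - (1 - h) / 3) ^ 3) by nra.
assert (F5 : h ^ 2 + 4 * h * eps + 2 * eps ^ 2 < h).
{ rewrite Heps.
  replace (h ^ 2 + 4 * h * (h * (1 - h) / 10) + 2 * (h * (1 - h) / 10) ^ 2)
    with (h - h * (1 - h) * (1 - 4 * h / 10 - 2 * (h * (1 - h)) / 100)) by field.
  assert (0 < h * (1 - h)) by nra.
  assert (0 < 1 - 4 * h / 10 - 2 * (h * (1 - h)) / 100) by nra.
  nra. }
lra.
Qed.

(** Subtracting the two systems and pairing with the difference gives a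
    quadratic form in it. Both multipliers are close to [1], so this form is
    small along [x] and coercive along the equator: the difference would be
    almost parallel to [x], whereas the sphere bounds its component along [x] by
    the equatorial ones when both points are on the same side. *)
Lemma critical_unique (k H1 H2 H3 K x y z l x' y' z' l' : R) :
  0 < k <= 1 / 12 -> Rabs H1 <= k ^ 2 / 8 -> Rabs K <= k ^ 2 / 8 ->
  k <= x ^ 2 -> k <= x' ^ 2 -> 0 < x * x' ->
  critical (H1, H2, H3, K) (x, y, z) l -> critical (H1, H2, H3, K) (x', y', z') l' ->
  (x, y, z) = (x', y', z').
Proof.
intros Hk HH1 HK Hx Hx' Hxx [HS [A1 [A2 A3]]] [HS' [A1' [A2' A3']]].
unfold S2, dot in *.
assert (mult_near : forall a m, k <= a ^ 2 -> a + H1 = m * a -> Rabs (m - 1) <= k / 8).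
{ intros a m Ha Em.
  assert (E : (m - 1) ^ 2 * a ^ 2 = H1 ^ 2) by (replace H1 with ((m - 1) * a) by lra; ring).
  assert (HH : H1 ^ 2 <= (k ^ 2 / 8) ^ 2).
  { rewrite <- (pow2_abs H1); apply pow_incr; split; [apply Rabs_pos|exact HH1]. }
  assert (Hs : (m - 1) ^ 2 <= (k / 8) ^ 2).
  { apply Rmult_le_reg_r with k; [lra|].
    apply Rle_trans with ((m - 1) ^ 2 * a ^ 2); [apply Rmult_le_compat_l; [apply pow2_ge_0|lra]|].
    rewrite E; eapply Rle_trans; [exact HH|].
    replace ((k ^ 2 / 8) ^ 2) with ((k / 8) ^ 2 * (k * k)) by field.
    apply Rmult_le_compat_l; [apply pow2_ge_0|nra]. }
  rewrite <- (Rabs_pos_eq (k / 8)) by lra; apply Rsqr_le_abs_0; unfold Rsqr; lra. }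
assert (L1 := mult_near x l Hx A1); assert (L2 := mult_near x' l' Hx' A1').
apply Rabs_le_between in L1; apply Rabs_le_between in L2; apply Rabs_le_between in HK.
set (u := x' - x); set (v := y' - y); set (w := z' - z).
assert (E1 : (l + l' - 2) * u ^ 2 + (2 * K + l + l') * v ^ 2 + (l + l') * w ^ 2 = 0).
{ assert (D1 : - u = l * x - l' * x') by (unfold u; lra).
  assert (D2 : K * v = l * y - l' * y') by (unfold v; lra).
  assert (D3 : 0 = l * z - l' * z') by lra.
  replace ((l + l' - 2) * u ^ 2 + (2 * K + l + l') * v ^ 2 + (l + l') * w ^ 2)
    with (2 * ((- u) * u + (K * v) * v + 0 * w) + (l + l') * (u ^ 2 + v ^ 2 + w ^ 2)) by ring.
  rewrite D1, D2; rewrite D3 at 1; unfold u, v, w.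
  transitivity ((l - l') * (1 - (x * x + y * y + z * z)) - (l - l') * (1 - (x' * x' + y' * y' + z' * z')));
    [ring|rewrite HS, HS'; ring]. }
assert (E2 : (x + x') * u = - ((y + y') * v + (z + z') * w)) by (unfold u, v, w; lra).
assert (E3 : (x + x') ^ 2 * u ^ 2 <= 4 * (v ^ 2 + w ^ 2)).
{ replace ((x + x') ^ 2 * u ^ 2) with (((x + x') * u) ^ 2) by ring; rewrite E2.
  apply Rle_trans with (((y + y') ^ 2 + (z + z') ^ 2) * (v ^ 2 + w ^ 2)).
  - assert (0 <= ((y + y') * w - (z + z') * v) ^ 2) by apply pow2_ge_0; lra.
  - apply Rmult_le_compat_r; [nra|].
    assert (sq : forall s : R, 0 <= s ^ 2) by (intros; apply pow2_ge_0).
    generalize (sq (y - y')) (sq (z - z')) (sq x) (sq x'); lra. }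
assert (E4 : 2 * k * u ^ 2 <= 4 * (v ^ 2 + w ^ 2)).
{ eapply Rle_trans; [|exact E3]; apply Rmult_le_compat_r; [apply pow2_ge_0|nra]. }
assert (k2 : k ^ 2 / 8 <= k / 8) by nra.
assert (sq : forall s : R, 0 <= s ^ 2) by (intros; apply pow2_ge_0).
assert (U := sq u); assert (Vv := sq v); assert (Ww := sq w).
assert (E5 : v ^ 2 + w ^ 2 <= k / 4 * u ^ 2).
{ assert (1 * v ^ 2 <= (2 * K + l + l') * v ^ 2) by (apply Rmult_le_compat_r; lra).
  assert (1 * w ^ 2 <= (l + l') * w ^ 2) by (apply Rmult_le_compat_r; lra).
  assert (- (k / 4) * u ^ 2 <= (l + l' - 2) * u ^ 2) by (apply Rmult_le_compat_r; lra).
  lra. }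
assert (U0 : u ^ 2 = 0) by nra.
assert (z0 : forall s : R, s ^ 2 <= 0 -> s = 0) by (intros s Hs; nra).
assert (u = 0) by (apply z0; lra).
assert (v = 0) by (apply z0; rewrite U0 in E5; lra).
assert (w = 0) by (apply z0; rewrite U0 in E5; lra).
unfold u, v, w in *; f_equal; [f_equal|]; lra.
Qed.

(** * Limits of the profiles *)

(** By the mean value theorem on intervals of length one. *)
Lemma derivative_limit_zero (y g : R -> R) (i : Rbar) (l k : R) :
  i = p_infty \/ i = m_infty ->
  (forall x, is_derive y x (g x)) -> is_lim y i l -> is_lim g i k -> k = 0.
Proof.
assert (P : forall (y g : R -> R) (l k : R), (forall x, is_derive y x (g x)) ->
          is_lim y p_infty l -> is_lim g p_infty k -> k = 0).
{ clear; intros y g l k Hy Hl Hk.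
  apply cond_eq; intros eps Heps; rewrite Rminus_0_r.
  apply is_lim_spec in Hl; apply is_lim_spec in Hk.
  assert (He : 0 < eps / 4) by lra.
  destruct (Hl (mkposreal _ He)) as [X1 H1]; destruct (Hk (mkposreal _ He)) as [X2 H2].
  simpl in H1, H2.
  set (x := Rmax X1 X2 + 1).
  assert (Hx1 : X1 < x) by (unfold x; generalize (Rmax_l X1 X2); lra).
  assert (Hx2 : X2 < x) by (unfold x; generalize (Rmax_r X1 X2); lra).
  destruct (MVT_gen y x (x + 1) g) as [c [Hc E]].
  - intros; apply Hy.
  - intros z _; apply continuity_pt_filterlim, (ex_derive_continuous y); eexists; apply Hy.
  - rewrite Rmin_left, Rmax_right in Hc by lra.
    assert (A1 := H1 x Hx1); assert (A2 := H1 (x + 1) ltac:(lra));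
      assert (A3 := H2 c ltac:(lra)).
    apply Rabs_def2 in A1; apply Rabs_def2 in A2; apply Rabs_def2 in A3.
    apply Rabs_def1; lra. }
intros [-> | ->] Hy Hl Hk; [now apply (P y g l k)|].
assert (E : -1 * k = 0); [|lra].
apply (P (fun x => y (- x)) (fun x => -1 * g (- x)) l).
- intros x; apply (is_derive_comp y Ropp); [apply Hy|auto_derive; [exact I|ring]].
- now apply is_lim_reflect.
- apply (is_lim_scal_l (fun x => g (- x)) (-1) p_infty k); now apply is_lim_reflect.
Qed.

Lemma is_lim_prod (f g : R -> R) (i : Rbar) (a c : R) :
  is_lim f i a -> is_lim g i c -> is_lim (fun x => f x * g x) i (a * c).
Proof. intros Hf Hg; exact (is_lim_mult f g i a c Hf Hg I). Qed.

Lemma is_lim_inv_cos (f : R -> R) (i : Rbar) (a : R) :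
  cos a <> 0 -> is_lim f i a -> is_lim (fun x => / cos (f x)) i (/ cos a).
Proof.
intros Ha Hf; apply (is_lim_comp_continuous f (fun t => / cos t)); [exact Hf|].
apply (ex_derive_continuous (fun t => / cos t)); auto_derive; exact Ha.
Qed.

Ltac lim_step :=
  first
  [ assumption
  | apply is_lim_const
  | lazymatch goal with
    | |- is_lim (fun x => @?A x + @?B x) _ (Finite (?a + ?c)) => apply (is_lim_plus' A B)
    | |- is_lim (fun x => @?A x - @?B x) _ (Finite (?a - ?c)) => apply (is_lim_minus' A B)
    | |- is_lim (fun x => @?A x * @?B x) _ (Finite (?a * ?c)) => apply (is_lim_prod A B)
    | |- is_lim (fun x => - @?A x) ?i (Finite (- ?a)) => apply (is_lim_opp A i (Finite a))
    | |- is_lim (fun x => sin (@?A x)) _ (Finite (sin ?a)) =>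
        apply (is_lim_comp_continuous A sin); [|apply continuous_sin]
    | |- is_lim (fun x => cos (@?A x)) _ (Finite (cos ?a)) =>
        apply (is_lim_comp_continuous A cos); [|apply continuous_cos]
    | |- is_lim (fun x => / cos (@?A x)) _ (Finite (/ cos ?a)) => apply (is_lim_inv_cos A)
    end ].

(** All derivatives tend to zero, so the limits solve the system with the
    derivatives removed: the effective field has no tangential component. *)
Lemma wave_limit_critical alpha h e2 e3 (L : R4) be r ps q V (i : Rbar) (bi ri pi qi : R) :
  e2 ^ 2 + e3 ^ 2 = 1 -> wave_system alpha h e2 e3 L be r ps q V ->
  i = p_infty \/ i = m_infty ->
  is_lim be i bi -> is_lim r i ri -> is_lim ps i pi -> is_lim q i qi -> cos pi <> 0 ->
  exists l, critical L (profile e2 e3 bi pi) l.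
Proof.
intros He HW Hi Lb Lr Lp Lq Hc.
assert (E1 : h - sin bi + ri = 0).
{ apply (derivative_limit_zero be (fun x => h - sin (be x) + r x) i bi); auto.
  - apply HW.
  - repeat lim_step. }
assert (E2 : -2 * pi + qi = 0).
{ apply (derivative_limit_zero ps (fun x => -2 * ps x + q x) i pi); auto.
  - apply (ws_ps _ _ _ _ _ _ _ _ _ _ HW).
  - repeat lim_step. }
assert (E3 : in_plane alpha h e2 e3 bi ri pi qi V (p1 L) (p2 L) (p3 L) (p4 L) = 0).
{ apply (derivative_limit_zero r _ i ri _ Hi (ws_r _ _ _ _ _ _ _ _ _ _ HW)); auto.
  unfold in_plane; repeat lim_step; exact Hc. }
assert (E4 : 2 * qi - out_of_plane alpha h e2 e3 bi ri pi qi V (p1 L) (p2 L) (p3 L) (p4 L) = 0).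
{ apply (derivative_limit_zero q _ i qi _ Hi (ws_q _ _ _ _ _ _ _ _ _ _ HW)); auto.
  unfold out_of_plane; repeat lim_step. }
destruct L as [[[H1 H2] H3] K].
unfold in_plane in E3; unfold out_of_plane in E4; cbn [p1 p2 p3 p4 fst snd] in E3, E4.
unfold p1, p2, p3, p4 in E3, E4; simpl in E3, E4.
rewrite E1, E2 in E3, E4.
replace ri with (sin bi - h) in E3 by lra; replace qi with (2 * pi) in E4 by lra.
assert (Eb := sin2_cos2 bi); assert (Ep := sin2_cos2 pi); unfold Rsqr in *.
revert E3 E4 Eb Ep Hc; unfold profile, critical.
assert (HS := profile_S2 e2 e3 bi pi He); unfold profile in HS; revert HS.
generalize (cos bi) (sin bi) (cos pi) (sin pi); intros c s C S HS E3 E4 Eb Ep Hc.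
set (m2 := e2 * (C * s) - e3 * S).
set (F1 := C * c + H1).
set (Fe := - K * m2 * e2 + (H2 * e2 + H3 * e3)).
set (Fp := K * m2 * e3 + (H3 * e2 - H2 * e3)).
assert (T1 : - s * F1 + c * Fe = 0).
{ apply Rmult_eq_reg_l with (/ C); [|now apply Rinv_neq_0_compat].
  rewrite Rmult_0_r; apply Ropp_eq_reg; rewrite Ropp_0, <- E3; unfold F1, Fe, m2; field; exact Hc. }
assert (T2 : - S * c * F1 - S * s * Fe + C * Fp = 0).
{ transitivity (2 * (2 * pi) - 4 * pi
   - (S * C * (c * c) + K * (e2 * C * s - e3 * S) * (- e2 * S * s - e3 * C)
      + H1 * S * c + (H2 * e2 + H3 * e3) * S * s - (H3 * e2 - H2 * e3) * C));
   [unfold F1, Fe, Fp, m2; ring|].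
  lra. }
set (l := F1 * (C * c) + Fe * (C * s) + Fp * S).
assert (Es : s ^ 2 = 1 - c ^ 2) by lra; assert (ES : S ^ 2 = 1 - C ^ 2) by lra.
assert (A1 : F1 = l * (C * c)).
{ transitivity (l * (C * c) + - s * (- s * F1 + c * Fe)
    + - S * c * (- S * c * F1 - S * s * Fe + C * Fp)); [unfold l; ring [Es ES]|].
  rewrite T1, T2; ring. }
assert (A2 : Fe = l * (C * s)).
{ transitivity (l * (C * s) + c * (- s * F1 + c * Fe)
    + - S * s * (- S * c * F1 - S * s * Fe + C * Fp)); [unfold l; ring [Es ES]|].
  rewrite T1, T2; ring. }
assert (A3 : Fp = l * S).
{ transitivity (l * S + C * (- S * c * F1 - S * s * Fe + C * Fp)); [unfold l; ring [Es ES]|].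
  rewrite T2; ring. }
assert (E3' : e3 ^ 2 = 1 - e2 ^ 2) by lra.
exists l; split; [exact HS|]; repeat split.
- exact A1.
- transitivity (e2 * Fe - e3 * Fp); [unfold Fe, Fp, m2; ring [E3']|].
  rewrite A2, A3; unfold m2; ring.
- transitivity (e3 * Fe + e2 * Fp); [unfold Fe, Fp, m2; ring [E3']|].
  rewrite A2, A3; unfold m2; ring.
Qed.

(** * The travelling waves *)

Lemma C11_reindex {I J : Type} {Z Y : NormedModule R_AbsRing} (D : Z -> Prop)
    (F : I -> Z -> Y) dF (s : J -> I) :
  C11 D F dF -> C11 D (fun j => F (s j)) (fun j => dF (s j)).
Proof.
intros [F1 F2 [C3 [P3 F3]] [C4 [P4 F4]] [C5 [P5 F5]] [C6 [P6 F6]] [C7 [P7 F7]]]; split; auto.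
- exists C3; auto. - exists C4; auto. - exists C5; auto.
- exists C6; split; auto; intros; now apply F6.
- exists C7; split; auto; intros; now apply F7.
Qed.

Lemma filterlim_R3 {F : (R -> Prop) -> Prop} {HF : Filter F} (f g k : R -> R) (a b c : R) :
  filterlim f F (locally a) -> filterlim g F (locally b) -> filterlim k F (locally c) ->
  filterlim (fun x => (f x, g x, k x)) F (locally ((a, b, c) : R3)).
Proof.
intros Hf Hg Hk.
assert (pair : forall (U W : UniformSpace) (u : R -> U) (w : R -> W) (lu : U) (lw : W),
   filterlim u F (locally lu) -> filterlim w F (locally lw) ->
   filterlim (fun x => (u x, w x)) F (locally ((lu, lw) : prod_UniformSpace U W))).
{ intros U W u w lu lw Hu Hw P [eps HP].
  assert (A := Hu _ (locally_ball lu eps)); assert (B := Hw _ (locally_ball lw eps)).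
  change (F (fun x => P (u x, w x))).
  apply (filter_imp (fun x => ball lu eps (u x) /\ ball lw eps (w x))).
  - intros x [H1 H2]; apply HP; split; assumption.
  - apply filter_and; assumption. }
apply (pair _ _ (fun x => (f x, g x))); [apply (pair _ _ f g)|]; assumption.
Qed.

Lemma cos_lipschitz x y : Rabs (cos x - cos y) <= Rabs (x - y).
Proof.
destruct (MVT_gen cos y x (fun t => - sin t)) as [c [_ E]].
- intros; apply is_derive_cos.
- intros t _; apply continuity_pt_filterlim, continuous_cos.
- rewrite E, <- (Rmult_1_l (Rabs (x - y))); apply Rabs_mult_le; [|apply Rle_refl].
  rewrite Rabs_Ropp; apply Rabs_le, SIN_bound.
Qed.

Lemma is_lim_bounded (f : R -> R) (i : Rbar) (l M : R) :
  is_lim f i l -> (forall x, Rabs (f x) <= M) -> Rabs l <= M.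
Proof.
intros Hl HM; apply Rabs_le; split.
- assert (H := is_lim_le_loc (fun _ => - M) f i (- M) l).
  apply H; [|apply is_lim_const|exact Hl].
  apply filter_forall; intros x; specialize (HM x); apply Rabs_le_between in HM; lra.
- assert (H := is_lim_le_loc f (fun _ => M) i l M).
  apply H; [|exact Hl|apply is_lim_const].
  apply filter_forall; intros x; specialize (HM x); apply Rabs_le_between in HM; lra.
Qed.

Section Main.

Variables (alpha h e2 e3 : R) (b : R -> R).
Hypothesis Halpha : 0 < alpha.
Hypothesis Hh : 0 < h < 1.
Hypothesis He : e2 ^ 2 + e3 ^ 2 = 1.
Hypothesis Hb : static_angle h b.

Notation base := (base_point h e2 e3).

(** The limit is a critical point, and its first component is at least half of that
    of the static profile, on the same side as [p]; uniqueness of the critical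
    point identifies the two. *)
Lemma profile_limit_is_minimum (L : R4) (X : CW) r q V (i : Rbar) (bi s : R) (p : R3) :
  wave_system alpha h e2 e3 L (fun x => b x + w1 (X x)) r (fun x => sin (b x) * w3 (X x)) q V ->
  (forall x, Rabs (w1 (X x)) <= cos (asin h) / 4) ->
  (forall x, Rabs (w3 (X x)) <= cos (asin h) / 4) ->
  limits_at_infinity X -> has_limits r -> has_limits q ->
  (i = p_infty /\ s = 1 \/ i = m_infty /\ s = -1) ->
  is_lim b i bi -> cos bi = s * cos (asin h) ->
  norm (minus (L : R4_NormedModule) base) <= ((1 - h) / 12) ^ 2 / 8 ->
  norm (minus (L : R4_NormedModule) base) <= h * (1 - h) / 10 ->
  local_min_on_S2 (potential L) p -> 0 < s * dot xhat p ->
  filterlim (fun x => profile e2 e3 (b x + w1 (X x)) (sin (b x) * w3 (X x)))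
    (Rbar_locally i) (locally p).
Proof.
intros HW Hw1 Hw3 HX Hr Hq Hi Hbi Hcos HL1 HL2 Hp Hsp.
assert (Hc0 := cos_asin_pos h Hh).
assert (Hi' : i = p_infty \/ i = m_infty) by tauto.
assert (lim : forall f, has_limits f -> exists l : R, is_lim f i l).
{ intros f [Hf Hf']; destruct Hi' as [-> | ->]; assumption. }
destruct HX as [X1 [_ [X3 _]]].
destruct (lim _ X1) as [l1 Hl1]; destruct (lim _ X3) as [l3 Hl3].
destruct (lim _ Hr) as [lr Hlr]; destruct (lim _ Hq) as [lq Hlq].
set (be := fun x => b x + w1 (X x)) in *; set (ps := fun x => sin (b x) * w3 (X x)) in *.
assert (Lb : is_lim be i (bi + l1)) by (apply is_lim_plus'; assumption).
assert (Lp : is_lim ps i (sin bi * l3)).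
{ apply is_lim_prod; [apply is_lim_comp_continuous; [assumption|apply continuous_sin]|assumption]. }
assert (B1 := is_lim_bounded _ _ _ _ Hl1 Hw1); assert (B3 := is_lim_bounded _ _ _ _ Hl3 Hw3).
assert (cos1 : cos (asin h) <= 1) by apply COS_bound.
assert (Bp : Rabs (sin bi * l3) <= cos (asin h) / 4).
{ replace (cos (asin h) / 4) with (1 * (cos (asin h) / 4)) by ring.
  apply Rabs_mult_le; [apply Rabs_le, SIN_bound|exact B3]. }
assert (Hcp : 1 / 2 <= cos (sin bi * l3)) by (apply cos_ge_half; lra).
set (bi' := bi + l1) in *; set (pi := sin bi * l3) in *.
destruct (wave_limit_critical alpha h e2 e3 L be r ps q V i bi' lr pi lq) as [l Hcrit]; auto; [lra|].
destruct L as [[[H1 H2] H3] K]; destruct p as [[x y] z].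
destruct (local_min_critical _ _ _ _ _ _ _ Hp) as [l' [Hcrit' _]].
assert (HK : Rabs K <= norm (minus ((H1, H2, H3, K) : R4_NormedModule) base)).
{ eapply Rle_trans; [|apply (co_norm _ coordinate_p4)].
  right; f_equal; unfold p4, base_point; simpl; unfold plus, opp; simpl; ring. }
assert (HH1 : Rabs H1 <= norm (minus ((H1, H2, H3, K) : R4_NormedModule) base)).
{ eapply Rle_trans; [|apply (co_norm _ coordinate_p1)].
  right; f_equal; unfold p1, base_point; simpl; unfold plus, opp; simpl; ring. }
assert (HH2 : Rabs (H2 - h * e2) <= norm (minus ((H1, H2, H3, K) : R4_NormedModule) base)).
{ eapply Rle_trans; [|apply (co_norm _ coordinate_p2)].
  right; f_equal. }
assert (HH3 : Rabs (H3 - h * e3) <= norm (minus ((H1, H2, H3, K) : R4_NormedModule) base)).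
{ eapply Rle_trans; [|apply (co_norm _ coordinate_p3)].
  right; f_equal. }
assert (Hx : (1 - h) / 12 <= x ^ 2).
{ apply (local_min_away h e2 e3 (h * (1 - h) / 10) H1 H2 H3 K x y z); auto; lra. }
assert (Hs : s = 1 \/ s = -1) by tauto.
set (x' := cos pi * cos bi').
assert (Hx' : cos (asin h) / 2 <= s * x').
{ assert (C1 : Rabs (cos bi' - s * cos (asin h)) <= cos (asin h) / 4).
  { rewrite <- Hcos; eapply Rle_trans; [apply cos_lipschitz|].
    unfold bi'; replace (bi + l1 - bi) with l1 by ring; exact B1. }
  assert (C2 : Rabs (cos pi - 1) <= cos (asin h) / 4).
  { rewrite <- cos_0; eapply Rle_trans; [apply cos_lipschitz|].
    rewrite Rminus_0_r; exact Bp. }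
  apply Rabs_le_between in C1; apply Rabs_le_between in C2.
  assert (C3 := COS_bound bi'); unfold x'; destruct Hs; subst s; nra. }
assert (kk : (cos (asin h)) ^ 2 = (1 - h) * (1 + h)).
{ assert (E := sin2_cos2 (asin h)); rewrite sin_asin in E by lra; unfold Rsqr in E; lra. }
assert (Hx'2 : (1 - h) / 12 <= x' ^ 2).
{ assert ((cos (asin h) / 2) ^ 2 <= (s * x') ^ 2) by (apply pow_incr; lra).
  replace ((s * x') ^ 2) with (x' ^ 2) in H by (destruct Hs; subst s; ring).
  replace ((cos (asin h) / 2) ^ 2) with (cos (asin h) ^ 2 / 4) in H by field.
  rewrite kk in H; nra. }
assert (Hxx : 0 < x' * x).
{ unfold dot, xhat in Hsp.
  assert (0 < s * x) by lra; destruct Hs; subst s; nra. }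
assert (E : profile e2 e3 bi' pi = (x, y, z)).
{ apply (critical_unique ((1 - h) / 12) H1 H2 H3 K x' _ _ l x y z l'); auto; lra. }
rewrite <- E.
assert (G1 : is_lim (fun x => cos (ps x) * cos (be x)) i (cos pi * cos bi')) by repeat lim_step.
assert (G2 : is_lim (fun x => e2 * (cos (ps x) * sin (be x)) - e3 * sin (ps x)) i
  (e2 * (cos pi * sin bi') - e3 * sin pi)) by repeat lim_step.
assert (G3 : is_lim (fun x => e3 * (cos (ps x) * sin (be x)) + e2 * sin (ps x)) i
  (e3 * (cos pi * sin bi') + e2 * sin pi)) by repeat lim_step.
clear - G1 G2 G3 Hi'.
destruct Hi'; subst i; apply (filterlim_R3 _ _ _ _ _ _ G1 G2 G3).
Qed.

End Main.

Section Family.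

Variables (h e2 e3 d : R) (b : R -> R).
Hypothesis Hh : 0 < h < 1.
Hypothesis Hb : static_angle h b.

Notation base := (base_point h e2 e3).

Definition wave_of (x : R) (z : Zs) : R3 :=
  profile e2 e3 (b x + w1 (fst z x)) (sin (b x) * w3 (fst z x)).

Lemma wave_of_smooth : exists dm,
  C11 (Y := R3_NormedModule) (dom base) wave_of dm /\
  (forall z x, dom base z -> continuous (fun y => wave_of y z : R3_NormedModule) x) /\
  (forall z v x, dom base z -> continuous (fun y => dm y z v : R3_NormedModule) x).
Proof.
assert (HA := smooth_angle h e2 e3 b Hh Hb).
assert (S1 : smooth base (fun x z =>
  cos (sin (b x) * w3 (fst z x)) * cos (b x + w1 (fst z x)))) by repeat smooth_step.
assert (S2 : smooth base (fun x z =>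
  e2 * (cos (sin (b x) * w3 (fst z x)) * sin (b x + w1 (fst z x)))
    - e3 * sin (sin (b x) * w3 (fst z x)))) by repeat smooth_step.
assert (S3 : smooth base (fun x z =>
  e3 * (cos (sin (b x) * w3 (fst z x)) * sin (b x + w1 (fst z x)))
    + e2 * sin (sin (b x) * w3 (fst z x)))) by repeat smooth_step.
destruct S1 as [d1 [A1 B1 C1 _]], S2 as [d2 [A2 B2 C2 _]], S3 as [d3 [A3 B3 C3 _]].
exists (fun x z v => (d1 x z v, d2 x z v, d3 x z v)); split; [|split].
- exact (C11_pair _ _ _ _ _ (C11_pair _ _ _ _ _ A1 A2) A3).
- intros z x Hz.
  exact (continuous_pairing _ _ x (continuous_pairing _ _ x (B1 z x Hz) (B2 z x Hz)) (B3 z x Hz)).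
- intros z v x Hz.
  exact (continuous_pairing _ _ x (continuous_pairing _ _ x (C1 z v x Hz) (C2 z v x Hz))
    (C3 z v x Hz)).
Qed.

End Family.

Lemma static_profile_eq (h h2 h3 : R) (b : R -> R) (x : R) :
  h = sqrt (h2 ^ 2 + h3 ^ 2) ->
  static_profile h2 h3 b x = profile (h2 / h) (h3 / h) (b x) 0.
Proof.
intros ->; unfold static_profile, profile, xhat, yhat, zhat.
set (k := sqrt (h2 ^ 2 + h3 ^ 2)); rewrite cos_0, sin_0.
repeat (progress (unfold plus, scal, mult, prod_plus, prod_scal; simpl)).
unfold Rdiv; f_equal; [f_equal|]; ring.
Qed.

Theorem theorem4p4 :
  forall (alpha h2 h3 : R),
    0 < alpha ->
    0 < h2 ^ 2 + h3 ^ 2 < 1 ->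
  forall (beta : R -> R),
    static_angle (sqrt (h2 ^ 2 + h3 ^ 2)) beta ->
  forall (mplus mminus : R4 -> R3),
    locally ((0, h2, h3, 0) : R4)
      (fun L => boundary_values L (mplus L) (mminus L)) ->
  exists (U : R4 -> Prop) (m : R4 -> Cb R3_NormedModule) (V : R4 -> R),
    open U /\ U (0, h2, h3, 0) /\
    (forall L : R4, U L ->
       (forall xi, S2 (m L xi)) /\
       travelling_wave alpha L (V L) (m L) /\
       filterlim (m L) (Rbar_locally p_infty) (locally (mplus L)) /\
       filterlim (m L) (Rbar_locally m_infty) (locally (mminus L))) /\
    C1_on U V /\
    C1_on U m /\
    (forall xi, m (0, h2, h3, 0) xi = static_profile h2 h3 beta xi).
Proof.
intros alpha h2 h3 Halpha Hh23 b Hb mplus mminus [eps Hbv].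
remember (sqrt (h2 ^ 2 + h3 ^ 2)) as h eqn:Eh.
assert (Eh2 : h ^ 2 = h2 ^ 2 + h3 ^ 2) by (rewrite Eh; apply pow2_sqrt; lra).
assert (Hh : 0 < h < 1).
{ assert (0 < h) by (rewrite Eh; apply sqrt_lt_R0; lra); nra. }
set (e2 := h2 / h); set (e3 := h3 / h).
assert (He : e2 ^ 2 + e3 ^ 2 = 1).
{ unfold e2, e3; replace ((h2 / h) ^ 2 + (h3 / h) ^ 2) with ((h2 ^ 2 + h3 ^ 2) / h ^ 2)
    by (field; lra). rewrite <- Eh2; field; lra. }
assert (EL0 : ((0, h2, h3, 0) : R4) = base_point h e2 e3).
{ unfold base_point, e2, e3; f_equal; f_equal; [f_equal|]; field; lra. }
rewrite EL0 in *.
destruct (middle_exists h b Hh Hb) as [x0 Hx0].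
set (d := h ^ 2 * (1 - h) / 100).
destruct (profile_family alpha h e2 e3 b x0 d Hh He Hb Hx0 eq_refl)
  as [rho [X [dX [Hrho [HX [HX0 HXp]]]]]].
destruct (wave_of_smooth h e2 e3 b Hh Hb) as [dm [Hm [cm cdm]]].
destruct (C11_lip _ _ _ HX) as [C [HC Hlip]]; specialize (Hlip tt).
assert (Hc := cos_asin_pos h Hh).
set (ball0 := fun p : R4_NormedModule => norm (minus p (base_point h e2 e3)) <= rho).
(* the five bounds: existence of the fixed point, the neighbourhood of the
   hypothesis, smallness of the angles, and the fields allowed in
   [critical_unique] and in [local_min_away] *)
set (s := Rmin (Rmin rho eps) (Rmin (cos (asin h) / (4 * (C + 1)))
           (Rmin (((1 - h) / 12) ^ 2 / 8) (h * (1 - h) / 10)))).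
assert (Hs : 0 < s).
{ unfold s; repeat apply Rmin_glb_lt; try (apply cond_pos); try lra.
  - apply Rdiv_lt_0_compat; lra.
  - apply Rdiv_lt_0_compat; [apply pow_lt|]; lra.
  - apply Rdiv_lt_0_compat; [apply Rmult_lt_0_compat|]; lra. }
assert (s1 : s <= rho) by (unfold s; eapply Rle_trans; [apply Rmin_l|apply Rmin_l]).
assert (s2 : s <= eps) by (unfold s; eapply Rle_trans; [apply Rmin_l|apply Rmin_r]).
assert (s3 : s <= cos (asin h) / (4 * (C + 1)))
  by (unfold s; eapply Rle_trans; [apply Rmin_r|apply Rmin_l]).
assert (s4 : s <= ((1 - h) / 12) ^ 2 / 8)
  by (unfold s; eapply Rle_trans; [apply Rmin_r|eapply Rle_trans; [apply Rmin_r|apply Rmin_l]]).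
assert (s5 : s <= h * (1 - h) / 10)
  by (unfold s; eapply Rle_trans; [apply Rmin_r|eapply Rle_trans; [apply Rmin_r|apply Rmin_r]]).
set (U := fun p : R4_NormedModule => norm (minus p (base_point h e2 e3)) < s).
assert (HU : forall p, U p -> locally p U).
{ intros p Hp.
  assert (Hr : 0 < s - norm (minus p (base_point h e2 e3))) by (unfold U in Hp; lra).
  generalize (locally_norm_lt p _ Hr); apply filter_imp; intros y Hy; unfold U.
  apply Rle_lt_trans with (norm (minus y p) + norm (minus p (base_point h e2 e3))); [|lra].
  apply (norm_of_plus _ (minus y p) (minus p (base_point h e2 e3)));
    [module_in constr:(R4_NormedModule)|lra|lra]. }
assert (HUB : forall p, U p -> ball0 p) by (unfold U, ball0; intros; lra).
assert (HUB' : forall p, U p -> locally p ball0).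
{ intros p Hp; generalize (HU p Hp); apply filter_imp; exact HUB. }
assert (HD : forall p, ball0 p -> dom (base_point h e2 e3) (X p, p)).
{ intros p Hp; split; [apply HXp; exact Hp|simpl; unfold ball0 in Hp; lra]. }
assert (HG : C11 (I := unit) (Z := R4_NormedModule) (Y := Zs) ball0
   (fun _ p => (X p, p)) (fun _ p w => (dX p w, w))).
{ apply (C11_pair (Y := CW) (Y' := R4_NormedModule) ball0 (fun _ => X) (fun _ p => p)
    (fun _ => dX) (fun _ _ w => w) HX).
  apply (C11_linear ball0 (fun _ p => p) (rho + norm (base_point h e2 e3))); auto.
  - exists 1; split; [lra|]; intros; lra.
  - intros p Hp; eapply norm_of_plus; [|exact Hp|apply Rle_refl].
    module_in constr:(R4_NormedModule). }
set (mf := fun (p : R4_NormedModule) x => wave_of e2 e3 b x (X p, p)).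
assert (HM : C11 (I := unit) ball0
   (fun _ p => toCb (W := R3_NormedModule) (mf p))
   (fun _ p w => toCb (W := R3_NormedModule) (fun x => dm x (X p, p) (dX p w, w)))).
{ apply (C11_lift (W := R3_NormedModule) ball0 (fun x p => mf p x)
    (fun x p w => dm x (X p, p) (dX p w, w))).
  - exact (C11_comp ball0 (dom (base_point h e2 e3)) (wave_of e2 e3 b) dm _ _ Hm
      (C11_reindex ball0 _ _ (fun _ : R => tt) HG) (fun _ p Hp => HD p Hp)).
  - intros p x Hp; apply cm, HD, Hp.
  - intros p w x Hp; apply cdm, HD, Hp. }
assert (Emf : forall p, ball0 p -> Cb_fun (toCb (W := R3_NormedModule) (mf p)) = mf p).
{ intros p Hp; apply functional_extensionality; intros x.
  apply (toCb_eq (W := R3_NormedModule)).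
  exact (family_admissible (dom (base_point h e2 e3)) _ dm Hm cm (X p, p) (HD p Hp)). }
exists U, (fun p => toCb (W := R3_NormedModule) (mf p)), (fun p => d * w5 (X p 0)).
split; [|split; [|split; [|split; [|split]]]].
- exact HU.
- unfold U; rewrite norm_minus_self; exact Hs.
- intros L HL.
  assert (HLb := HUB L HL); rewrite Emf by exact HLb.
  destruct (HXp L HLb) as [Hn [HT Hlim]].
  assert (HL1 : norm (minus (L : R4_NormedModule) (base_point h e2 e3)) <= 1)
    by (unfold ball0 in HLb; lra).
  assert (HW := fixed_point_wave alpha h e2 e3 b x0 d Halpha Hh Hb eq_refl (X L) L Hn HL1 HT).
  assert (HXs : norm (X L) <= cos (asin h) / 4).
  { assert (B0 : ball0 (base_point h e2 e3)) by (unfold ball0; rewrite norm_minus_self; lra).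
    apply Rle_trans with (C * s).
    - apply Rle_trans with (C * norm (minus (L : R4_NormedModule) (base_point h e2 e3))).
      + eapply Rle_trans; [|apply (Hlip (base_point h e2 e3) L B0 HLb)].
        right; f_equal; rewrite HX0; module_in constr:(CW).
      + apply Rmult_le_compat_l; [exact HC|unfold U in HL; lra].
    - apply Rle_trans with ((C + 1) * (cos (asin h) / (4 * (C + 1)))); [|right; field; lra].
      apply Rmult_le_compat; lra. }
  assert (Hw : forall p, coordinate p -> forall x, Rabs (p (X L x)) <= cos (asin h) / 4).
  { intros p Hp x; eapply Rle_trans; [apply (w_le p), Hp|exact HXs]. }
  assert (BV : boundary_values L (mplus L) (mminus L)).
  { apply Hbv, (norm_compat1 (V := R4_NormedModule)); unfold U in HL; lra. }
  destruct BV as [[P1 P2] [M1 M2]].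
  assert (HL4 : norm (minus (L : R4_NormedModule) (base_point h e2 e3)) <= ((1 - h) / 12) ^ 2 / 8)
    by (unfold U in HL; lra).
  assert (HL5 : norm (minus (L : R4_NormedModule) (base_point h e2 e3)) <= h * (1 - h) / 10)
    by (unfold U in HL; lra).
  assert (Hr : has_limits (fun x => d * w2 (X L x))).
  { apply (has_limits_mult (fun _ => d)); [apply has_limits_const|apply Hlim]. }
  assert (Hq : has_limits (fun x => / d * w4 (X L x))).
  { apply (has_limits_mult (fun _ => / d)); [apply has_limits_const|apply Hlim]. }
  destruct Hb as [Hb1 [Hbm Hbp]].
  assert (Hb : static_angle h b) by (split; [|split]; assumption).
  split; [|split; [|split]].
  + intros x; apply profile_S2, He.
  + exact (wave_system_travelling_wave alpha h e2 e3 L _ _ _ _ _ He HW).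
  + apply (profile_limit_is_minimum alpha h e2 e3 b Hh He L (X L) _ _ _ p_infty (asin h) 1
      (mplus L) HW); auto using coordinate_w1, coordinate_w3; try lra; try ring.
  + apply (profile_limit_is_minimum alpha h e2 e3 b Hh He L (X L) _ _ _ m_infty (PI - asin h) (-1)
      (mminus L) HW); auto using coordinate_w1, coordinate_w3; try lra; try ring.
    rewrite cos_minus, cos_PI, sin_PI; ring.
- apply (C11_C1_on U ball0 _ (fun p w => d * w5 (dX p w 0))); [|exact HUB'].
  assert (Hlin : C11 (I := unit) (Z := Zs) (Y := R_NormedModule) (dom (base_point h e2 e3))
     (fun _ z => d * w5 (fst z 0)) (fun _ _ v => d * w5 (fst v 0))).
  { apply (C11_linear (Y := R_NormedModule) _ (fun _ (z : Zs) => d * w5 (fst z 0))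
      (2 + norm (base_point h e2 e3))).
    - intros _ u v; exact (Rmult_plus_distr_l d (w5 (fst u 0)) (w5 (fst v 0))).
    - intros _ c v; change (d * (c * w5 (fst v 0)) = c * (d * w5 (fst v 0))); ring.
    - exists (Rabs d); split; [apply Rabs_pos|]; intros _ v.
      apply Rabs_mult_le; [apply Rle_refl|].
      eapply Rle_trans; [apply (w_le w5), coordinate_w5|apply (norm_fst_le v)].
    - apply dom_bounded. }
  exact (C11_comp ball0 (dom (base_point h e2 e3)) _ _ _ _ Hlin HG (fun _ p Hp => HD p Hp)).
- exact (C11_C1_on U ball0 _ _ HM HUB').
- intros x; rewrite Emf by (apply HUB; unfold U; rewrite norm_minus_self; exact Hs).
  rewrite (static_profile_eq h) by (rewrite <- Eh; reflexivity).
  unfold mf, wave_of; rewrite HX0.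
  change (profile e2 e3 (b x + 0) (sin (b x) * 0) = profile e2 e3 (b x) 0).
  rewrite Rplus_0_r, Rmult_0_r; reflexivity.
Qed.
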